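(* Let $\alpha\in\mathbb R$ and $N\in\mathbb N$ be fixed and suppose that $G$ satisfies the conditions (G) and (D) of the context. For every $0<\tau<1$, the numerical Markov chain $\{u_m^N\}_{m\ge0}$ admits a unique invariant probability measure $\pi_\alpha^{\tau,N}$ on $H_{N,-1}^\alpha:=H_N\cap H_{-1}^\alpha$.
   Context: Setting. Let $d\in\{1,2,3\}$, $\mathcal D=(0,1)^d$, $H=L^2(\mathcal D)$ with norm $\|\cdot\|$ and inner product $\langle\cdot,\cdot\rangle$; $L^4=L^4(\mathcal D)$. Let $A=-\Delta$ with homogeneous Neumann boundary conditions, with orthonormal eigenbasis $\{\phi_k\}_{k\ge0}$ of $H$, $A\phi_k=\lambda_k\phi_k$, $0=\lambda_0<\lambda_1\le\lambda_2\le\cdots$, $\phi_0=|\mathcal D|^{-1/2}$. Let $\dot H=\{v\in H:\int_{\mathcal D}v\,dx=0\}$. For $\beta\in\mathbb R$, $\|v\|_{\dot H^\beta}=(\sum_{j\ge1}\lambda_j^\beta|\langle v,\phi_j\rangle|^2)^{1/2}$, $\|v\|_\beta=(\|v\|_{\dot H^\beta}^2+|\langle v,\phi_0\rangle|^2)^{1/2}$, with corresponding spaces $\dot H^\beta$ (zero-mean elements) and $H^\beta$ (for $\beta<0$ understood as completions). Noise. On a filtered probability space $(\Omega,\mathcal F,\{\mathcal F_t\}_{t\ge0},\mathbb P)$, $W(t)=\sum_{k\ge1}\sqrt{q_k}\phi_k\beta_k(t)$ is an $\dot H$-valued $Q$-Wiener process, where $\beta_k$ are independent Brownian motions and $Q$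 is self-adjoint nonnegative on $\dot H$ with eigenpairs $(q_k,\phi_k)_{k\ge1}$. Put $U_0=Q^{1/2}\dot H$ and let $\mathcal L_2^\theta$ be the Hilbert--Schmidt operators from $U_0$ to $\dot H^\theta$, $\theta\in\{-1,0,1\}$, so $\|T\|_{\mathcal L_2^\theta}^2=\sum_{k\ge1}\|TQ^{1/2}\phi_k\|_{\dot H^\theta}^2$. The diffusion coefficient is a map $G:H^{-1}\to\mathcal L_2^{-1}$. (G) There are constants $L_1,\dots,L_8>0$ with: $\|G(u)-G(v)\|_{\mathcal L_2^0}^2\le L_1\|u-v\|^2$ for $u,v\in H$; $\|G(u)-G(v)\|_{\mathcal L_2^{-1}}^2\le L_2\|u-v\|_{-1}^2$ for $u,v\in H^{-1}$; $\|G(u)\|_{\mathcal L_2^0}^2\le L_3\|u\|^2+L_4$ for $u\in H$; $\|G(u)\|_{\mathcal L_2^1}^2\le L_5\|u\|_1^2+L_6$ for $u\in H^1$; $\sum_{k\ge1}\|G(u)Q^{1/2}\phi_k\|_{\dot H^{d/4}}^2\le L_7\|u\|_{L^4}^2+L_8$ for $u\in L^4$. (D) With $C_{d,4}$ the constant of the Sobolev embedding $H^{d/4}\hookrightarrow L^4$ and $\mathfrak m_r=\mathbb E|Z|^r=2^{r/2}\Gamma(\frac{r+1}2)/\sqrt\pi$ ($Z$ standard Gaussian): $\max\{5L_2,59L_3\}<\lambda_1(\lambda_1-1)$, and $\max\{11,20q-29\}(L_5+4C_{d,4}^2L_7)+\frac1{4q}\mathfrak m_{4q}(\sqrt8C_{d,4}^2L_7)^{2q}<\lambda_1^2-1$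 for all $1\le q\le16$. Numerical Markov chain. $H_{-1}:=H^{-1}$, $H_{-1}^\alpha=\{v\in H_{-1}:\langle v,\phi_0\rangle=\alpha\}$, $F(u)(x)=u(x)^3-u(x)$. $P_N$ is the $H$-orthogonal projection onto $H_N=\mathrm{span}\{\phi_0,\dots,\phi_N\}$; for a step size $\tau>0$, $t_m=m\tau$, $\Delta_mW=W(t_{m+1})-W(t_m)$. The chain $(u_m^N)_{m\ge0}\subset H_N$ is defined, from an initial value $u_0^N\in H_{N,-1}^\alpha$, by $u_{m+1}^N-u_m^N=-\tau A^2u_{m+1}^N-\tau AP_NF(u_{m+1}^N)+P_NG(u_m^N)\Delta_mW$; it preserves $\langle u_m^N,\phi_0\rangle$, hence stays in $H_{N,-1}^\alpha$. A probability measure on $H_{N,-1}^\alpha$ is invariant if it is invariant under the one-step transition kernel of this chain. *)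

(* Defs.v *)
From HB Require Import structures.
From mathcomp Require Import all_boot all_order all_algebra.
From mathcomp Require Import all_classical all_reals all_analysis.

Set Implicit Arguments.
Unset Strict Implicit.
Unset Printing Implicit Defensive.

Import Order.TTheory GRing.Theory Num.Def Num.Theory.
Import numFieldNormedType.Exports.

Local Open Scope classical_set_scope.
Local Open Scope ring_scope.

(* A point of R^d is a [d.-tuple R], which carries the product (Borel)
   sigma-algebra. *)

Section cube_measure.
Variable R : realType.

Definition leb01 : set (measurableTypeR R) -> \bar R :=
  mrestr (@lebesgue_measure R)
    (measurable_itv `]0%R, 1%R[ : measurable (`]0%R, 1%R[ : set R)).

HB.instance Definition _ := Measure.on leb01.

Let leb01_setT : leb01 setT = 1%E.
Proof.
by rewrite /leb01 /mrestr setTI lebesgue_measure_itv/= lte01 oppr0 adde0.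
Qed.

HB.instance Definition _ := Measure_isProbability.Build _ _ _ leb01 leb01_setT.

Definition tcons n (p : measurableTypeR R * n.-tuple (measurableTypeR R)) :
    n.+1.-tuple (measurableTypeR R) :=
  [the n.+1.-tuple (measurableTypeR R) of p.1 :: p.2].

Let measurable_tcons n : measurable_fun setT (@tcons n).
Proof. exact: measurable_cons. Qed.

HB.instance Definition _ n :=
  isMeasurableFun.Build _ _ _ _ (@tcons n) (@measurable_tcons n).

(* [distribution] is the push-forward along [tcons]. *)
Fixpoint cube_measure (d : nat) :
    probability (d.-tuple (measurableTypeR R)) R :=
  match d return probability (d.-tuple (measurableTypeR R)) R with
  | 0 => \d_([tuple] : 0.-tuple (measurableTypeR R))
  | n.+1 => distribution (leb01 \x cube_measure n)%E (@tcons n)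
  end.

End cube_measure.

Section definitions.
Variable R : realType.

Local Notation point d := (d.-tuple (measurableTypeR R)).

Definition on_rows d (f : point d -> R) (r : 'rV[R]_d) : R :=
  f [tuple r ord0 i | i < d].

Definition partial d (i : 'I_d) (g : 'rV[R]_d -> R) : 'rV[R]_d -> R :=
  fun x => 'D_(delta_mx ord0 i : 'rV[R]_d) g x.

Definition laplacian d (g : 'rV[R]_d -> R) : 'rV[R]_d -> R :=
  fun x => \sum_(i < d) partial i (partial i g) x.

Record C2 d (g : 'rV[R]_d -> R) : Prop := {
  C2_derivable1 : forall x (i : 'I_d), derivable g x (delta_mx ord0 i);
  C2_derivable2 : forall x (i j : 'I_d),
    derivable (partial i g) x (delta_mx ord0 j);
  C2_continuous0 : continuous g;
  C2_continuous1 : forall i : 'I_d, continuous (partial i g);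
  C2_continuous2 : forall i j : 'I_d, continuous (partial j (partial i g)) }.

(* Eigenfunctions of the Neumann Laplacian of a cube are restrictions of smooth
   functions on R^d; [g] is such an extension, and only its values on the closed
   cube are constrained by the equation and the boundary condition. *)
Record neumann_eigenpair d (g : 'rV[R]_d -> R) (l : R) : Prop := {
  eigen_C2 : C2 g;
  eigen_eq : forall x : 'rV[R]_d, (forall i, 0 < x ord0 i < 1) ->
    - laplacian g x = l * g x;
  eigen_bc : forall x : 'rV[R]_d, (forall i, 0 <= x ord0 i <= 1) ->
    forall i : 'I_d, x ord0 i = 0 \/ x ord0 i = 1 -> partial i g x = 0 }.

Definition inL2 d (f : point d -> R) : Prop := f \in Lfun (cube_measure R d) 2%:E.
Definition inL4 d (f : point d -> R) : Prop := f \in Lfun (cube_measure R d) 4%:E.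
Definition normL2 d (f : point d -> R) : \bar R :=
  'N[cube_measure R d]_2%:E[EFin \o f].
Definition normL4 d (f : point d -> R) : \bar R :=
  'N[cube_measure R d]_4%:E[EFin \o f].

Definition inner d (f g : point d -> R) : R :=
  \int[cube_measure R d]_x (f x * g x).

Definition fourier d (phi : nat -> point d -> R) (f : point d -> R) : nat -> R :=
  fun k => inner f (phi k).

Record neumann_eigenbasis d (phi : nat -> point d -> R) (lam : nat -> R) :
    Prop := {
  basis_L2 : forall k, inL2 (phi k);
  basis_orthonormal : forall j k, inner (phi j) (phi k) = (j == k)%:R;
  basis_expansion : forall f, inL2 f ->
    normL2 (fun x => f x - \sum_(k < n) fourier phi f k * phi k x)
      @[n --> \oo] --> 0%E;
  basis_eigen : forall k, neumann_eigenpair (on_rows (phi k)) (lam k);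
  basis_phi0 : forall x, (forall i, 0 < tnth x i < 1) -> phi 0%N x = 1;
  basis_lam0 : lam 0%N = 0;
  basis_lam1 : 0 < lam 1%N;
  basis_lam_le : forall j k, (j <= k)%N -> lam j <= lam k }.

(* An element of H^b is the sequence [c] of its coefficients in the eigenbasis,
   i.e. the formal series \sum_k c_k phi_k.  For b < 0 this is a model of the
   completion of H for the norm of H^b; f in H = L^2 is identified with
   [fourier phi f]. *)

Definition sqnorm_dot (lam : nat -> R) (b : R) (c : nat -> R) : \bar R :=
  (\sum_(1 <= j <oo) (lam j `^ b * c j ^+ 2)%:E)%E.

Definition sqnorm (lam : nat -> R) (b : R) (c : nat -> R) : \bar R :=
  (sqnorm_dot lam b c + (c 0%N ^+ 2)%:E)%E.

Definition inH (lam : nat -> R) (b : R) (c : nat -> R) : Prop :=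
  (sqnorm lam b c < +oo)%E.

Definition inHdot (lam : nat -> R) (b : R) (c : nat -> R) : Prop :=
  c 0%N = 0 /\ inH lam b c.

(* [q] is the sequence of eigenvalues of Q; only its values at k >= 1 are
   relevant. *)

Definition sqrtQ (q : nat -> R) (g : nat -> R) : nat -> R :=
  fun k => Num.sqrt (q k) * g k.

Definition U0 (lam q : nat -> R) : set (nat -> R) :=
  sqrtQ q @` [set g | inHdot lam 0 g].

Definition unit_seq (k : nat) : nat -> R := fun j => (j == k)%:R.

Definition sqnorm_HS (lam q : nat -> R) (b : R) (T : (nat -> R) -> nat -> R) :
    \bar R :=
  (\sum_(1 <= k <oo) sqnorm_dot lam b (T (sqrtQ q (unit_seq k))))%E.

(* The norm of h in U_0 is the least norm of a g in Hdot with Q^{1/2} g = h,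
   so [HS_bounded] is boundedness of [T] on U_0. *)
Record hilbert_schmidt (lam q : nat -> R) (b : R) (T : (nat -> R) -> nat -> R) :
    Prop := {
  HS_range : forall h, U0 lam q h -> inHdot lam b (T h);
  HS_linear : forall a h1 h2, U0 lam q h1 -> U0 lam q h2 ->
    T (fun k => a * h1 k + h2 k) = (fun k => a * T h1 k + T h2 k);
  HS_bounded : exists M : R, forall g, inHdot lam 0 g ->
    (sqnorm_dot lam b (T (sqrtQ q g)) <= M%:E * sqnorm_dot lam 0 g)%E;
  HS_finite : (sqnorm_HS lam q b T < +oo)%E }.

Definition seqB (c1 c2 : nat -> R) : nat -> R := fun k => c1 k - c2 k.

Definition opB (T1 T2 : (nat -> R) -> nat -> R) : (nat -> R) -> nat -> R :=
  fun h => seqB (T1 h) (T2 h).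

Record cond_G d (phi : nat -> point d -> R) (lam q : nat -> R)
    (G : (nat -> R) -> (nat -> R) -> nat -> R)
    (L1 L2 L3 L4 L5 L6 L7 L8 : R) : Prop := {
  G_pos : [/\ 0 < L1, 0 < L2, 0 < L3 & 0 < L4] /\
          [/\ 0 < L5, 0 < L6, 0 < L7 & 0 < L8];
  G_lip0 : forall u v, inL2 u -> inL2 v ->
    (sqnorm_HS lam q 0 (opB (G (fourier phi u)) (G (fourier phi v)))
      <= L1%:E * normL2 (fun x => (u x - v x)%R) ^+ 2)%E;
  G_lipm1 : forall u v, inH lam (-1) u -> inH lam (-1) v ->
    (sqnorm_HS lam q (-1) (opB (G u) (G v))
      <= L2%:E * sqnorm lam (-1) (seqB u v))%E;
  G_growth0 : forall u, inL2 u ->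
    (sqnorm_HS lam q 0 (G (fourier phi u)) <= L3%:E * normL2 u ^+ 2 + L4%:E)%E;
  G_growth1 : forall u, inL2 u -> inH lam 1 (fourier phi u) ->
    (sqnorm_HS lam q 1 (G (fourier phi u))
      <= L5%:E * sqnorm lam 1 (fourier phi u) + L6%:E)%E;
  G_growth4 : forall u, inL4 u ->
    (sqnorm_HS lam q (d%:R / 4) (G (fourier phi u))
      <= L7%:E * normL4 u ^+ 2 + L8%:E)%E }.

(* [C] is a constant of the embedding of H^{d/4} into L^4. *)
Definition sobolev_constant d (phi : nat -> point d -> R) (lam : nat -> R)
    (C : R) : Prop :=
  forall u, inL2 u -> inH lam (d%:R / 4) (fourier phi u) ->
    (normL4 u <= C%:E * (sqnorm lam (d%:R / 4) (fourier phi u)) `^ (2^-1))%E.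

Definition gaussian_moment (r : R) : R :=
  \int[normal_prob 0 1]_x (`|x| `^ r).

Record cond_D (lam : nat -> R) (C L2 L3 L5 L7 : R) : Prop := {
  D_contraction : maxr (5 * L2) (59 * L3) < lam 1%N * (lam 1%N - 1);
  D_moment : forall r : R, 1 <= r <= 16 ->
    maxr 11 (20 * r - 29) * (L5 + 4 * C ^+ 2 * L7)
    + (4 * r)^-1 * gaussian_moment (4 * r)
        * (Num.sqrt 8 * C ^+ 2 * L7) `^ (2 * r)
    < lam 1%N ^+ 2 - 1 }.

Section probability.
Context (dO : measure_display) (Omega : measurableType dO).
Variable P : probability Omega R.

Definition filtration (F : R -> set (set Omega)) : Prop :=
  [/\ forall t, 0 <= t -> sigma_algebra setT (F t),
      forall t, 0 <= t -> F t `<=` measurable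
    & forall s t, 0 <= s -> s <= t -> F s `<=` F t].

Definition generated_by (I : Type) (D : set I) (X : I -> Omega -> R) :
    set (set Omega) :=
  <<s [set B | exists i A, [/\ D i, measurable A & B = X i @^-1` A]] >>.

Record brownian_motion (F : R -> set (set Omega)) (b : R -> Omega -> R) :
    Prop := {
  bm_adapted : forall t, 0 <= t ->
    forall A : set R, measurable A -> F t (b t @^-1` A);
  bm_init : {ae P, forall w, b 0 w = 0};
  bm_gaussian : forall s t, 0 <= s -> s < t ->
    forall A : set R, measurable A ->
    P [set w | A (b t w - b s w)] = normal_prob 0 (Num.sqrt (t - s)) A;
  bm_continuous : {ae P, forall w, {within `[0, +oo[, continuous (b ^~ w)}} }.

(* Only the indices k >= 1 are relevant. *)
Record brownian_family (F : R -> set (set Omega))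
    (beta : nat -> R -> Omega -> R) : Prop := {
  bf_bm : forall k, (1 <= k)%N -> brownian_motion F (beta k);
  bf_indep : forall (J : seq nat) (B : nat -> set Omega),
    uniq J -> all (fun k => 0 < k)%N J ->
    (forall k, k \in J -> generated_by [set t | 0 <= t] (beta k) (B k)) ->
    P (\big[setI/setT]_(k <- J) B k) = (\prod_(k <- J) P (B k))%E;
  bf_increments : forall s t, 0 <= s -> s <= t -> forall A B, F s A ->
    generated_by [set k | (1 <= k)%N] (fun k w => beta k t w - beta k s w) B ->
    P (A `&` B) = (P A * P B)%E }.

Definition wiener (q : nat -> R) (beta : nat -> R -> Omega -> R)
    (t : R) (w : Omega) : nat -> R :=
  fun k => if k == 0%N then 0 else Num.sqrt (q k) * beta k t w.

Record Q_wiener (lam : nat -> R) (F : R -> set (set Omega)) (q : nat -> R)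
    (beta : nat -> R -> Omega -> R) : Prop := {
  QW_filtration : filtration F;
  QW_nonneg : forall k, (1 <= k)%N -> 0 <= q k;
  QW_brownian : brownian_family F beta;
  QW_valued : forall t, 0 <= t ->
    {ae P, forall w, inHdot lam 0 (wiener q beta t w)} }.

Definition increment (q : nat -> R) (beta : nat -> R -> Omega -> R)
    (tau : R) (m : nat) (w : Omega) : nat -> R :=
  seqB (wiener q beta (m.+1%:R * tau) w) (wiener q beta (m%:R * tau) w).

Definition truncate (n : nat) (h : nat -> R) : nat -> R :=
  fun k => if (k <= n)%N then h k else 0.

(* An increment [dW] of W is in general not U_0-valued; T dW is the limit in
   L^2(Omega; H^{-1}) of \sum_(1 <= k <= n) (dbeta_k) T Q^{1/2} phi_k, which is T
   applied to the projection of [dW] on the span of phi_1, ..., phi_n. *)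
Definition applied_increment (lam : nat -> R) (T : (nat -> R) -> nat -> R)
    (dW : Omega -> nat -> R) (xi : Omega -> nat -> R) : Prop :=
  (forall j, measurable_fun setT (fun w => xi w j)) /\
  (\int[P]_w sqnorm lam (-1) (seqB (xi w) (T (truncate n (dW w)))))%E
    @[n --> \oo] --> 0%E.

(* H_N is identified with R^{N+1} through the coordinates in the orthonormal
   basis phi_0, ..., phi_N. *)

Definition HN (N : nat) := N.+1.-tuple (measurableTypeR R).

Definition seq_of N (c : HN N) : nat -> R := fun k => nth 0 c k.

Definition fun_of d (phi : nat -> point d -> R) N (c : HN N) : point d -> R :=
  fun x => \sum_(k < N.+1) tnth c k * phi k x.

Definition HN_mean N (alpha : R) : set (HN N) := [set c | tnth c ord0 = alpha].

Definition nonlin d (f : point d -> R) : point d -> R :=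
  fun x => f x ^+ 3 - f x.

(* [V] is the value at time t_(m+1) of the chain that is at [u] at time t_m: the
   scheme is written coordinatewise, A being multiplication by lam_j on the j-th
   coordinate. *)
Definition scheme_step d (phi : nat -> point d -> R) (lam q : nat -> R)
    (beta : nat -> R -> Omega -> R) (G : (nat -> R) -> (nat -> R) -> nat -> R)
    (tau : R) N (m : nat) (u : HN N) (V : Omega -> HN N) : Prop :=
  measurable_fun setT V /\
  exists2 xi : Omega -> nat -> R,
    applied_increment lam (G (seq_of u)) (increment q beta tau m) xi &
    {ae P, forall w, forall j : 'I_N.+1,
      tnth (V w) j - tnth u j =
        - tau * lam j ^+ 2 * tnth (V w) j
        - tau * lam j * fourier phi (nonlin (fun_of phi (V w))) j
        + xi w j}.

Definition transition_kernel d (phi : nat -> point d -> R) (lam q : nat -> R)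
    (beta : nat -> R -> Omega -> R) (G : (nat -> R) -> (nat -> R) -> nat -> R)
    (tau : R) N (K : R.-pker (HN N) ~> (HN N)) : Prop :=
  forall (m : nat) (u : HN N), exists2 V : Omega -> HN N,
    scheme_step phi lam q beta G tau m u V &
    forall B, measurable B -> K u B = P (V @^-1` B).

(* A probability measure on H_{N,-1}^alpha is a probability measure on H_N that
   is concentrated on this closed set. *)
Definition invariant_probability d (phi : nat -> point d -> R)
    (lam q : nat -> R) (beta : nat -> R -> Omega -> R)
    (G : (nat -> R) -> (nat -> R) -> nat -> R) (tau : R) N (alpha : R)
    (mu : probability (HN N) R) : Prop :=
  mu (HN_mean alpha) = 1%E /\
  exists2 K : R.-pker (HN N) ~> (HN N),
    transition_kernel phi lam q beta G tau K &
    forall B, measurable B -> (\int[mu]_u K u B)%E = mu B.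

End probability.
End definitions.

(* Main.v *)
(* Unique solvability of the implicit step makes the chain a random map
   u -> Phi(u, e) driven by independent copies of a sequence e of Gaussian
   variables.  In H^{-1} the cubic term is monotone and the squared Lipschitz
   constant of G is L_2, so on each slice of prescribed mean the map contracts mean
   squared distances by the factor
     (1 + 6 tau L_2) / (1 + 2 tau lam_1 (lam_1 - 1)),
   which (D) makes smaller than 1 (6 tau is a crude bound for the variance tau of
   an increment).  Composing the maps in backward order, the orbits of all starting
   points converge almost surely to one random variable: its law is invariant, and
   it is the only invariant law because an invariant law is the law of each
   backward iterate started from it. *)
Require Import Defs.
From HB Require Import structures.
From mathcomp Require Import all_boot all_order all_algebra.
From mathcomp Require Import all_classical all_reals all_analysis.
From mathcomp Require Import measurable_realfun ring lra.
Import Order.TTheory GRing.Theory Num.Theory.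
Import numFieldNormedType.Exports.
Local Open Scope classical_set_scope.
Local Open Scope ring_scope.

Set Implicit Arguments.
Unset Strict Implicit.
Unset Printing Implicit Defensive.

(** The obstacle is that an increment of the Wiener process need not lie in [U0]: [G u] applied to
    it exists only as a mean square limit, for each [u] separately, while a random map needs one
    function of [(u, e)], defined everywhere and jointly measurable. The noise is therefore reduced
    to the real sequence [e] of Brownian increments, and each coordinate of the limit is selected as
    an upper limit along truncation indices read off from the coefficients of [G u]. The implicit
    step is solved as the critical point equation of a coercive functional, a minimizing movement in
    [H^{-1}]. Coercivity and expansivity rest on [lam 1 > 1], which (D) forces because [L_2 > 0] and
    [lam 1 > 0]. For fixed noise the random map is not known to be continuous in [u], so limits in
    the recursion are taken in mean square. *)

(** * Sequences of independent variables and their splitting into two halves *)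

Section noise_space.
Variable R : realType.

Definition cylinder (n : nat) (A : nat -> set R) : set (nat -> R) :=
  [set e | forall k, (k < n)%N -> A k (e k)].

(** Only initial segments of coordinates are constrained; since a side may be the whole line, this
    covers every finite set of coordinates and makes the family stable under intersection. *)
Definition cylinders : set (set (nat -> R)) :=
  [set C | exists n A, (forall k, measurable (A k)) /\ C = cylinder n A].

Definition noise := g_sigma_algebraType cylinders.

Lemma cylinders_setI : setI_closed cylinders.
Proof.
move=> _ _ [n [A [mA ->]]] [m [B [mB ->]]].
exists (maxn n m), (fun k => (if (k < n)%N then A k else setT) `&`
  (if (k < m)%N then B k else setT)); split.
  by move=> k; apply: measurableI; case: ifP.
apply/seteqP; split=> e /=.
  by move=> [hA hB] k _; split; case: ifPn => // ?; [exact: hA|exact: hB].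
move=> h; split=> k kn.
  by have := h k; rewrite leq_max kn => /(_ isT)[].
by have := h k; rewrite leq_max kn orbT => /(_ isT)[].
Qed.

Lemma measurable_cylinder n (A : nat -> set R) :
  (forall k, measurable (A k)) -> measurable (cylinder n A : set noise).
Proof. by move=> mA; apply: sub_sigma_algebra; exists n, A. Qed.

Lemma measurable_coord k : measurable_fun setT (fun e : noise => e k).
Proof.
move=> _ B mB; rewrite setTI.
rewrite (_ : _ @^-1` _ = cylinder k.+1 (fun i => if i == k then B else setT)).
  by apply: measurable_cylinder => i; case: ifP.
apply/seteqP; split=> e /=; first by move=> Be i _; case: eqVneq => [->|].
by move=> /(_ k (ltnSn k)); rewrite eqxx.
Qed.

Lemma measurable_noiseP d (T : measurableType d) (f : T -> noise) :
  (forall k, measurable_fun setT (fun x => f x k)) -> measurable_fun setT f.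
Proof.
move=> mf; apply: (@measurability _ _ _ noise _ _ cylinders) => //.
move=> _ [_ [n [A [mA ->]]] <-]; rewrite setTI.
rewrite (_ : _ @^-1` _ = \bigcap_(k in `I_n) ((fun x => f x k) @^-1` A k)).
  by apply: bigcap_measurableType => // k _; rewrite -[_ @^-1` _]setTI; exact: mf.
by apply/seteqP; split=> x /= h k; exact: h.
Qed.

Lemma noise_measure_unique (m1 m2 : {measure set noise -> \bar R}) :
  (m1 setT < +oo)%E ->
  (forall n A, (forall k, measurable (A k)) ->
    m1 (cylinder n A) = m2 (cylinder n A)) ->
  forall B, measurable B -> m1 B = m2 B.
Proof.
move=> m1oo m12 B mB.
apply: (@measure_unique _ R noise cylinders (fun=> setT)) => //.
- exact: cylinders_setI.
- move=> _; exists 0%N, (fun=> setT); split=> //.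
  by apply/seteqP; split=> // e _ k.
- by rewrite bigcup_const//; exists 0%N.
- by move=> _ [n [A [mA ->]]]; exact: m12.
Qed.

(** No infinite product measure is constructed: the product law is recognized by its values on
    cylinders, and the instance used is the law of the Brownian increments. *)
Definition iid (g : probability (measurableTypeR R) R)
    (nu : probability noise R) : Prop :=
  forall n A, (forall k, measurable (A k)) ->
    nu (cylinder n A) = (\prod_(k < n) g (A k))%E.

Lemma iid_coord g nu k B : iid g nu -> measurable B ->
  nu [set e | B (e k)] = g B.
Proof.
move=> nug mB.
rewrite (_ : [set e | _] =
    cylinder k.+1 (fun i => if i == k then B else setT)).
  rewrite nug; last by move=> i; case: ifP.
  rewrite big_ord_recr/= eqxx big1 ?mul1e// => -[i ik] _ /=.
  by rewrite (ltn_eqF ik); exact: probability_setT.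
apply/seteqP; split=> e /=; first by move=> Be i _; case: eqVneq => [->|].
by move=> /(_ k (ltnSn k)); rewrite eqxx.
Qed.

Lemma iid_unique g (nu nu' : probability noise R) : iid g nu -> iid g nu' ->
  forall B, measurable B -> nu B = nu' B.
Proof.
move=> h h'; apply: noise_measure_unique.
  by rewrite (@le_lt_trans _ _ 1%E) ?ltry//; exact: probability_le1.
by move=> n A mA; exact: etrans (h n A mA) (esym (h' n A mA)).
Qed.

Definition evens (e : noise) : noise := fun k => e k.*2.
Definition odds (e : noise) : noise := fun k => e k.*2.+1.

Lemma measurable_evens : measurable_fun setT evens.
Proof. by apply: measurable_noiseP => k; exact: measurable_coord. Qed.

Lemma measurable_odds : measurable_fun setT odds.
Proof. by apply: measurable_noiseP => k; exact: measurable_coord. Qed.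

(** Both cylinders are padded with full sides to a common length [p]; the joint constraint is then a
    cylinder of length [p.*2] whose sides alternate between the two. *)
Lemma iid_evens_odds_cylinder g nu n m A B : iid g nu ->
  (forall k, measurable (A k)) -> (forall k, measurable (B k)) ->
  nu (evens @^-1` cylinder n A `&` odds @^-1` cylinder m B) =
  (nu (cylinder n A) * nu (cylinder m B))%E.
Proof.
move=> nug mA mB.
pose A' k := if (k < n)%N then A k else setT.
pose B' k := if (k < m)%N then B k else setT.
have mA' k : measurable (A' k) by rewrite /A'; case: ifP.
have mB' k : measurable (B' k) by rewrite /B'; case: ifP.
pose p := maxn n m.
have extend j (D : nat -> set R) : (j <= p)%N ->
    cylinder j D = cylinder p (fun k => if (k < j)%N then D k else setT).
  move=> jp; apply/seteqP; split=> e /= h k kp; last first.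
    by have := h k; rewrite kp (leq_trans kp)// => /(_ isT).
  by case: ifPn => // kj; exact: h.
rewrite (extend n A) ?leq_maxl// (extend m B) ?leq_maxr//.
rewrite -/A' -/B'.
pose C k := if odd k then B' k./2 else A' k./2.
have mC k : measurable (C k) by rewrite /C; case: ifP.
rewrite (_ : _ `&` _ = cylinder p.*2 C); last first.
  apply/seteqP; split=> e /=; rewrite /cylinder /evens /odds /=.
    move=> [hA hB] k kp; rewrite /C.
    have kp2 : (k./2 < p)%N by rewrite ltn_half_double.
    have := odd_double_half k; case: ifP => ok /= <-.
      by rewrite add1n/= uphalf_double; exact: hB.
    by rewrite add0n doubleK; exact: hA.
  move=> h; split=> k kp.
    have := h k.*2; rewrite ltn_double kp => /(_ isT).
    by rewrite /C odd_double doubleK.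
  have := h k.*2.+1; rewrite ltn_Sdouble kp => /(_ isT).
  by rewrite /C /= odd_double/= uphalf_double.
rewrite (nug _ _ mC) (nug _ _ mA') (nug _ _ mB').
elim: (p) => [|r IH]; first by rewrite !big_ord0 mule1.
rewrite doubleS !big_ord_recr/= IH.
rewrite {1 2}/C /= odd_double/= doubleK uphalf_double.
by rewrite -!muleA; congr (_ * _)%E; rewrite muleCA.
Qed.

(** A pi-system argument in each factor in turn: with the other event frozen, both sides are finite
    measures that agree on cylinders. Taking one event to be everything shows that each half has law
    [nu] again. *)
Lemma iid_evens_odds g nu (A B : set noise) : iid g nu ->
  measurable A -> measurable B ->
  nu (evens @^-1` A `&` odds @^-1` B) = (nu A * nu B)%E.
Proof.
move=> nug mA mB.
have mpe (D : set noise) : measurable D -> measurable (evens @^-1` D).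
  by move=> mD; rewrite -[_ @^-1` _]setTI; exact: measurable_evens.
have mpo (D : set noise) : measurable D -> measurable (odds @^-1` D).
  by move=> mD; rewrite -[_ @^-1` _]setTI; exact: measurable_odds.
have fin (D : set noise) : measurable D -> nu D \is a fin_num.
  by move=> mD; exact: fin_num_measure.
pose pe (D : set noise) (mD : measurable (odds @^-1` D)) :=
  [the {measure set noise -> \bar R} of
     pushforward (mrestr nu mD) evens].
pose po (D : set noise) (mD : measurable (evens @^-1` D)) :=
  [the {measure set noise -> \bar R} of
     pushforward (mrestr nu mD) odds].
have r (D : set noise) : 0 <= fine (nu D) by rewrite fine_ge0.
have step1 D n E : measurable D -> (forall k, measurable (E k)) ->
    nu (evens @^-1` D `&` odds @^-1` cylinder n E) =
    (nu D * nu (cylinder n E))%E.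
  move=> mD mE.
  have mo := mpo _ (measurable_cylinder n mE).
  pose m2 : {measure set noise -> \bar R} :=
    mscale (NngNum (r (cylinder n E))) nu.
  have H X : measurable X -> pushforward (mrestr nu mo) evens X = m2 X.
    apply: (@noise_measure_unique (pe measurable_evens _ mo) m2).
      rewrite /pe /= /pushforward /mrestr.
      apply: (@le_lt_trans _ _ 1%E); last exact: ltry.
      by apply: probability_le1; apply: measurableI; first exact: mpe.
    move=> p F mF; rewrite /pe /= /pushforward /mrestr /m2 /mscale/=.
    rewrite (iid_evens_odds_cylinder _ _ nug)// fineK 1?muleC// fin//.
    exact: measurable_cylinder.
  move: (H D mD); rewrite /pushforward /mrestr /m2 /mscale/= => ->.
  by rewrite /mscale/= fineK 1?muleC// fin//; exact: measurable_cylinder.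
have me := mpe _ mA.
pose m2 : {measure set noise -> \bar R} := mscale (NngNum (r A)) nu.
have H X : measurable X -> pushforward (mrestr nu me) odds X = m2 X.
  apply: (@noise_measure_unique (po measurable_odds _ me) m2).
    rewrite /po /= /pushforward /mrestr.
    apply: (@le_lt_trans _ _ 1%E); last exact: ltry.
    by apply: probability_le1; apply: measurableI; first exact: mpo.
  move=> p F mF; rewrite /po /= /pushforward /mrestr /m2 /mscale/=.
  by rewrite setIC step1// fineK// fin.
move: (H B mB); rewrite /pushforward /mrestr /m2 /mscale/=.
by rewrite setIC => ->; rewrite /mscale/= fineK// fin.
Qed.

Definition halves (e : noise) : noise * noise := (evens e, odds e).

Lemma measurable_halves : measurable_fun setT halves.
Proof.
apply: measurable_fun_pair; [exact: measurable_evens|exact: measurable_odds].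
Qed.

(** The law of [halves] is the product of [nu] with itself, so Tonelli applies; the even half is the
    variable of the inner integral. *)
Lemma ge0_integral_halves g nu (f : noise * noise -> \bar R) : iid g nu ->
  measurable_fun setT f -> (forall z, 0 <= f z)%E ->
  (\int[nu]_e f (halves e) = \int[nu]_b \int[nu]_a f (a, b))%E.
Proof.
move=> nug mf f0.
rewrite -(fubini_tonelli2 _ mf f0).
rewrite -(@ge0_integral_pushforward _ _ _ _ _ _ measurable_halves nu setT f)//.
pose pf := [the {measure set (noise * noise) -> \bar R} of
  pushforward nu halves].
have pfE A B : measurable A -> measurable B ->
    pf measurable_halves (A `*` B) = (nu A * nu B)%E.
  by move=> mA mB; rewrite -(iid_evens_odds nug).
have := @product_measure_unique _ _ _ _ _ nu nu (pf measurable_halves) pfE.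
move=> H; apply: eq_measure_integral => [|mh X mX _].
  exact: measurable_halves.
exact: esym (H X mX).
Qed.

End noise_space.

(** * Symmetry and second moment of the centred Gaussian law *)

Section normal_second_moment.
Variable R : realType.
Local Notation leb := (@lebesgue_measure R).

(** The Radon-Nikodym derivative of [normal_prob] equals [normal_pdf] almost everywhere, because
    both have the same integrals over measurable sets. *)
Lemma ge0_integral_normal_prob (m s : R) (f : R -> \bar R) :
  measurable_fun setT f -> (forall x, 0 <= f x)%E ->
  (\int[normal_prob m s]_x f x = \int[leb]_x (f x * (normal_pdf m s x)%:E))%E.
Proof.
move=> mf f0; have dom := normal_prob_dominates m s.
rewrite -(Radon_Nikodym_SigmaFinite.change_of_variables dom)//.
have mpdf : measurable_fun setT (fun x : R => (normal_pdf m s x)%:E).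
  by apply/measurable_EFinP; exact: measurable_normal_pdf.
have fi := Radon_Nikodym_SigmaFinite.f_integrable dom.
have mRN := measurable_int _ fi.
apply: ge0_ae_eq_integral => //.
- exact: emeasurable_funM.
- exact: emeasurable_funM.
- by move=> x _; rewrite mule_ge0// Radon_Nikodym_SigmaFinite.f_ge0.
- by move=> x _; rewrite mule_ge0// lee_fin normal_pdf_ge0.
- apply: ae_eqe_mul2l; apply: integral_ae_eq => // A _ mA.
  by rewrite -Radon_Nikodym_SigmaFinite.f_integral.
Qed.

Lemma normal_prob0N (s : R) (A : set R) : s != 0 -> measurable A ->
  normal_prob 0 s (-%R @^-1` A) = normal_prob 0 s A.
Proof.
move=> s0 mA; have mN : measurable_fun [set: measurableTypeR R]
    (-%R : measurableTypeR R -> measurableTypeR R) by exact: oppr_measurable.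
have mpdf B : measurable_fun B (fun x : R => (normal_pdf 0 s x)%:E).
  by apply/measurable_funTS/measurable_EFinP; exact: measurable_normal_pdf.
rewrite /normal_prob; transitivity
  (\int[leb]_(x in -%R @^-1` A)
     (((fun x : R => (normal_pdf 0 s x)%:E) \o -%R) x))%E.
  apply: eq_integral => x _ /=.
  by rewrite !(normal_pdfE _ s0) /normal_fun !subr0 sqrrN.
have pdf0 : {in A, forall x : R, 0 <= (normal_pdf 0 s x)%:E}%E.
  by move=> x _; rewrite lee_fin normal_pdf_ge0.
apply: etrans (esym (ge0_integral_pushforward mN leb mA (mpdf A) pdf0)) _.
by apply: eq_measure_integral => B mB _; exact: lebesgue_measureN.
Qed.

(* With z = x^2 / (8 s^2), the bound 3 z <= exp (3 z) trades the factor x^2 for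
   the heavier tail of the density with standard deviation 2 s. *)
Lemma sqr_normal_pdf_le (s x : R) : 0 < s ->
  x ^+ 2 * normal_pdf 0 s x <= 6 * s ^+ 2 * normal_pdf 0 (2 * s) x.
Proof.
move=> s0; have s20 : 0 < 2 * s by rewrite mulr_gt0.
rewrite !normal_pdfE ?gt_eqF// /normal_fun subr0.
have -> : normal_peak (2 * s) = 2^-1 * normal_peak s.
  rewrite /normal_peak -invfM; congr (_^-1).
  rewrite (_ : (2 * s) ^+ 2 * pi *+ 2 = 2 ^+ 2 * (s ^+ 2 * pi *+ 2)); last first.
    by ring.
  by rewrite sqrtrM ?sqr_ge0// sqrtr_sqr ger0_norm.
set p := normal_peak s; have p0 : 0 <= p by exact: normal_peak_ge0.
pose z := x ^+ 2 / (8 * s ^+ 2).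
have z0 : 0 <= z by rewrite divr_ge0 ?sqr_ge0// mulr_ge0 ?sqr_ge0.
have s2 : s ^+ 2 != 0 by rewrite sqrf_eq0 gt_eqF.
have -> : - x ^+ 2 / (s ^+ 2 *+ 2) = - (3 * z) - z.
  by rewrite /z; field; rewrite gt_eqF.
have -> : - x ^+ 2 / ((2 * s) ^+ 2 *+ 2) = - z.
  by rewrite /z; field; rewrite gt_eqF.
have -> : x ^+ 2 = 8 * s ^+ 2 * z by rewrite /z; field; rewrite gt_eqF.
rewrite expRD expRN; set E := expR (- z); have E0 : 0 <= E by exact: expR_ge0.
have := expR_ge1Dx (3 * z); set F := expR (3 * z) => F1.
have F0 : 0 < F by exact: expR_gt0.
have zF : z * F^-1 <= 3^-1.
  by rewrite ler_pdivrMr// mulrC -ler_pdivrMr ?invr_gt0// invrK; lra.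
have -> : 8 * s ^+ 2 * z * (p * (F^-1 * E)) = (s ^+ 2 * p * E) * (8 * (z * F^-1)).
  by ring.
have -> : 6 * s ^+ 2 * (2^-1 * p * E) = (s ^+ 2 * p * E) * 3 by field.
apply: ler_wpM2l; last by lra.
by apply: mulr_ge0 => //; apply: mulr_ge0 => //; exact: sqr_ge0.
Qed.

(** The density with deviation [2 * s] has mass one, so integrating the pointwise bound leaves the
    constant 6. The true value is [s ^+ 2]; (D) leaves room for the loss. *)
Lemma normal_second_moment (s : R) : 0 < s ->
  (\int[normal_prob 0 s]_x (x ^+ 2)%:E <= (6 * s ^+ 2)%:E)%E.
Proof.
move=> s0.
have msq : measurable_fun setT (fun x : R => (x ^+ 2)%:E).
  exact/measurable_EFinP/measurable_funX.
rewrite ge0_integral_normal_prob//; last by move=> x; rewrite lee_fin sqr_ge0.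
rewrite -[leRHS]mule1 -(integral_normal_pdf 0 (2 * s)) -ge0_integralZl_EFin//.
- apply: ge0_le_integral => //.
  + by move=> x _; rewrite mule_ge0 ?lee_fin ?sqr_ge0 ?normal_pdf_ge0.
  + apply: emeasurable_funM => //.
    by apply/measurable_EFinP; exact: measurable_normal_pdf.
  + apply: emeasurable_funM => //.
    by apply/measurable_EFinP; exact: measurable_normal_pdf.
  + by move=> x _; rewrite -!EFinM lee_fin; exact: sqr_normal_pdf_le.
- by move=> x _; rewrite lee_fin normal_pdf_ge0.
- by apply/measurable_EFinP; exact: measurable_normal_pdf.
- by rewrite mulr_ge0 ?sqr_ge0.
Qed.

End normal_second_moment.

(** * Second moments of affine functions of independent symmetric variables *)

Section iid_second_moment.
Variables (R : realType) (g : probability (measurableTypeR R) R).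
Variables (nu : probability (noise R) R) (s : R).
Hypothesis nug : iid g nu.
Hypothesis gN : forall A : set R, measurable A -> g (-%R @^-1` A) = g A.
Hypothesis gs : (\int[g]_x (x ^+ 2)%:E <= s%:E)%E.

Let flip n (e : noise R) : noise R := fun k => if k == n then - e k else e k.

Let measurable_flip n : measurable_fun setT (flip n).
Proof.
apply: measurable_noiseP => k; rewrite /flip; case: eqP => _.
  by apply: measurableT_comp => //; exact: measurable_coord.
exact: measurable_coord.
Qed.

(** The preimage of a cylinder under [flip n] is the cylinder with its [n]-th side reflected, which
    has the same mass by [gN]. *)
Let ge0_integral_flip n (f : noise R -> \bar R) : measurable_fun setT f ->
  (forall e, 0 <= f e)%E -> (\int[nu]_e f (flip n e) = \int[nu]_e f e)%E.
Proof.
move=> mf f0.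
rewrite -[LHS](@ge0_integral_pushforward _ _ _ _ _ _ (measurable_flip n) nu setT f)//.
pose pf := [the {measure set (noise R) -> \bar R} of pushforward nu (flip n)].
have pfE X : measurable X -> pf (measurable_flip n) X = nu X.
  apply: noise_measure_unique.
    apply: (@le_lt_trans _ _ 1%E); last exact: ltry.
    by apply: probability_le1; rewrite preimage_setT.
  move=> m A mA; rewrite /pf/= /pushforward.
  pose A' k := if k == n then -%R @^-1` (A k) else A k.
  have mA' k : measurable (A' k).
    rewrite /A'; case: eqP => // _.
    by rewrite -[_ @^-1` _]setTI; exact: oppr_measurable.
  have -> : flip n @^-1` cylinder m A = cylinder m A'.
    apply/seteqP; split=> e /= h k km; have := h k km; rewrite /flip /A';
      by case: ifP.
  apply: etrans (nug m mA') _; apply: etrans _ (esym (nug m mA)).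
  by apply: eq_bigr => k _; rewrite /A'; case: eqP => // _; exact: gN.
by apply: eq_measure_integral => X mX _; exact: pfE.
Qed.

Let integral_coord_sqr k : (\int[nu]_e (e k ^+ 2)%:E <= s%:E)%E.
Proof.
have mk : measurable_fun setT (fun e : noise R => e k : measurableTypeR R).
  exact: measurable_coord.
have mf : measurable_fun setT (fun x : measurableTypeR R => (x ^+ 2)%:E).
  exact/measurable_EFinP/measurable_funX.
apply: le_trans gs; rewrite -[leLHS](@ge0_integral_pushforward _ _ _ _ _ _ mk
  nu setT (fun x : measurableTypeR R => (x ^+ 2)%:E))//; last first.
  by move=> x _; rewrite lee_fin sqr_ge0.
rewrite le_eqVlt; apply/orP; left; apply/eqP; apply: eq_measure_integral => X mX _.
exact: iid_coord nug mX.
Qed.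

Lemma measurable_affine n b (c : nat -> R) :
  measurable_fun setT (fun e : noise R => b + \sum_(k < n) c k * e k).
Proof.
apply: measurable_funD => //.
apply: measurable_sum => k.
by apply: measurable_funM => //; exact: measurable_coord.
Qed.

(* Flipping the sign of the last coordinate leaves [nu] invariant, so the cross
   term disappears by the parallelogram law. *)
Lemma iid_second_moment n b (c : nat -> R) :
  (\int[nu]_e ((b + \sum_(k < n) c k * e k) ^+ 2)%:E
   <= (b ^+ 2 + s * \sum_(k < n) c k ^+ 2)%:E)%E.
Proof.
have s0 : 0 <= s.
  rewrite -lee_fin; apply: le_trans (integral_coord_sqr 0).
  by apply: integral_ge0 => e _; rewrite lee_fin sqr_ge0.
have msq (f : noise R -> R) : measurable_fun setT f ->
    measurable_fun setT (fun e => (f e ^+ 2)%:E).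
  by move=> mf; exact/measurable_EFinP/measurable_funX.
elim: n => [|n IH].
  rewrite (eq_integral (fun=> (b ^+ 2)%:E)).
    by rewrite integral_cst//= probability_setT mule1 big_ord0 mulr0 addr0.
  by move=> e _; rewrite big_ord0 addr0.
pose Y (e : noise R) := b + \sum_(k < n) c k * e k.
pose y (e : noise R) := c n * e n.
have mY : measurable_fun setT Y by exact: measurable_affine.
have my : measurable_fun setT y.
  by apply: measurable_funM => //; exact: measurable_coord.
set I := (X in (X <= _)%E).
have IE : I = (\int[nu]_e ((Y e + y e) ^+ 2)%:E)%E.
  by apply: eq_integral => e _; rewrite big_ord_recr/= addrA.
have IE' : I = (\int[nu]_e ((Y e - y e) ^+ 2)%:E)%E.
  rewrite IE -(ge0_integral_flip n (f := fun e => ((Y e + y e) ^+ 2)%:E)).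
  - apply: eq_integral => e _; congr ((_ ^+ 2)%:E).
    rewrite /Y /y /flip eqxx mulrN; congr (b + _ - _).
    by apply: eq_bigr => k _; rewrite ltn_eqF.
  - by apply: msq; exact: measurable_funD.
  - by move=> e; rewrite lee_fin sqr_ge0.
have II : (I + I = 2%:E * (\int[nu]_e (Y e ^+ 2)%:E) +
    (2 * c n ^+ 2)%:E * \int[nu]_e (e n ^+ 2)%:E)%E.
  rewrite {1}IE IE' -ge0_integralD//.
  - rewrite -!ge0_integralZl_EFin//.
    + rewrite -ge0_integralD//.
      * apply: eq_integral => e _; rewrite -!EFinM -!EFinD /y; congr _%:E; ring.
      * by move=> e _; rewrite mule_ge0 ?lee_fin ?sqr_ge0.
      * by apply: emeasurable_funM => //; exact: msq.
      * by move=> e _; rewrite mule_ge0// lee_fin ?sqr_ge0// mulr_ge0 ?sqr_ge0.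
      * by apply: emeasurable_funM => //; apply: msq; exact: measurable_coord.
    + by move=> e _; rewrite lee_fin sqr_ge0.
    + by apply: msq; exact: measurable_coord.
    + by rewrite mulr_ge0 ?sqr_ge0.
    + by move=> e _; rewrite lee_fin sqr_ge0.
    + exact: msq.
  - by move=> e _; rewrite lee_fin sqr_ge0.
  - by apply: msq; exact: measurable_funD.
  - by move=> e _; rewrite lee_fin sqr_ge0.
  - by apply: msq; exact: measurable_funB.
have I0 : (0 <= I)%E by apply: integral_ge0 => e _; rewrite lee_fin sqr_ge0.
have : (I + I <= 2%:E * (b ^+ 2 + s * \sum_(k < n) c k ^+ 2)%:E +
    (2 * c n ^+ 2)%:E * s%:E)%E.
  rewrite II; apply: leeD; first by apply: lee_wpmul2l IH.
  apply: lee_wpmul2l (integral_coord_sqr n).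
  by rewrite lee_fin mulr_ge0 ?sqr_ge0.
rewrite big_ord_recr/=; move: I0; case: I {IE IE' II} => [r|//|//] _.
rewrite -!EFinM -!EFinD !lee_fin => h.
by rewrite -(ler_pM2l (_ : 0 < 2))//; lra.
Qed.

End iid_second_moment.

(** * Almost sure convergence from geometric second moment bounds *)

Section ae_convergence.
Context d (T : measurableType d) (R : realType).
Variable mu : {measure set T -> \bar R}.

Lemma le_limn_einf (u v : (\bar R)^nat) : (forall n, u n <= v n)%E ->
  (limn_einf u <= limn_einf v)%E.
Proof.
move=> uv; rewrite !limn_einf_lim; apply: lee_lim; do ?exact: is_cvg_einfs.
apply: nearW => n; apply: le_ereal_inf_tmp => _ [m /= nm <-].
by apply: le_trans (uv m); apply: ereal_inf_lbound; exists m.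
Qed.

Lemma measurable_limn_einf D (f : nat -> T -> \bar R) :
  (forall n, measurable_fun D (f n)) ->
  measurable_fun D (fun x => limn_einf (f ^~ x)).
Proof.
move=> mf; apply: measurableT_comp => //; apply: measurable_fun_limn_esup => n.
exact: measurableT_comp.
Qed.

Lemma limn_einf_ge0 (u : (\bar R)^nat) : (forall n, 0 <= u n)%E ->
  (0 <= limn_einf u)%E.
Proof.
move=> u0; rewrite limn_einf_lim; apply: lime_ge; first exact: is_cvg_einfs.
by apply: nearW => n; apply: le_ereal_inf_tmp => _ [m _ <-].
Qed.

(** The tool for passing second moment bounds to almost sure limits: [f] agrees almost everywhere
    with the lower limit of the [f_ n], to which Fatou's lemma applies. *)
Lemma fatou_le (f_ : nat -> T -> R) (f : T -> R) (c : (\bar R)^nat) l :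
  (forall n, measurable_fun setT (f_ n)) -> measurable_fun setT f ->
  (forall n x, 0 <= f_ n x) -> (forall x, 0 <= f x) ->
  {ae mu, forall x, f_ ^~ x @ \oo --> f x} ->
  (forall n, \int[mu]_x (f_ n x)%:E <= c n)%E -> c @ \oo --> l ->
  (\int[mu]_x (f x)%:E <= l)%E.
Proof.
move=> mf_ mf f_0 f0 f_f f_c cl.
have mEf_ n : measurable_fun setT (fun x => (f_ n x)%:E).
  exact/measurable_EFinP.
have mEf : measurable_fun setT (fun x => (f x)%:E) by exact/measurable_EFinP.
have -> : (\int[mu]_x (f x)%:E = \int[mu]_x limn_einf (fun n => (f_ n x)%:E))%E.
  apply: ge0_ae_eq_integral => //.
  - exact: measurable_limn_einf.
  - by move=> x _; rewrite lee_fin.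
  - by move=> x _; apply: limn_einf_ge0 => n; rewrite lee_fin.
  - apply: filterS f_f => x fx _; apply/esym.
    have /cvg_limn_einf_sup[] : (fun n => (f_ n x)%:E) @ \oo --> (f x)%:E.
      apply: cvg_EFin => //; exact: nearW.
    by [].
apply: le_trans (fatou mu measurableT mEf_ _) _.
  by move=> n x _; rewrite lee_fin.
by rewrite -(cvg_limn_einf_sup cl).1; exact: le_limn_einf.
Qed.

(* By AM-GM, |y| <= (y^2 / b + b) / 2 with b = a^n: geometric decay of the second
   moments gives geometric decay of the first ones. *)
Lemma ae_cvg_series_of_l2_geometric (Y : nat -> T -> R) (C a : R) :
  (mu setT <= 1)%E -> 0 < a < 1 -> 0 <= C ->
  (forall n, measurable_fun setT (Y n)) ->
  (forall n, \int[mu]_x (Y n x ^+ 2)%:E <= (C * (a ^+ n) ^+ 2)%:E)%E ->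
  {ae mu, forall x, cvgn (series (fun n => `|Y n x|))}.
Proof.
move=> mu1 /andP[a0 a1] C0 mY hY.
have an n : 0 < a ^+ n by rewrite exprn_gt0.
have mnY n : measurable_fun setT (fun x => (`|Y n x|)%:E).
  by apply/measurable_EFinP; exact: measurableT_comp.
have msq n : measurable_fun setT (fun x => (Y n x ^+ 2)%:E).
  exact/measurable_EFinP/measurable_funX.
have L1 n : (\int[mu]_x (`|Y n x|)%:E <= ((C + 1) / 2 * a ^+ n)%:E)%E.
  apply: (@le_trans _ _ (\int[mu]_x
      (((2 * a ^+ n)^-1)%:E * (Y n x ^+ 2)%:E + (a ^+ n / 2)%:E))%E).
    apply: ge0_le_integral => //.
    - apply: emeasurable_funD => //; exact: emeasurable_funM.
    - move=> x _; rewrite -EFinM -EFinD lee_fin.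
      rewrite -[Y n x ^+ 2]real_normK ?num_real// -subr_ge0.
      move: (`|Y n x|) (a ^+ n) (an n) => y b b0.
      have -> : (2 * b)^-1 * y ^+ 2 + b / 2 - y = (2 * b)^-1 * (y - b) ^+ 2.
        by field; rewrite gt_eqF.
      by rewrite mulr_ge0 ?sqr_ge0// invr_ge0 mulr_ge0// ltW.
  rewrite ge0_integralD//; last 3 first.
  - move=> x _; rewrite mule_ge0// lee_fin ?sqr_ge0// invr_ge0.
    by rewrite mulr_ge0// ltW.
  - exact: emeasurable_funM.
  - by move=> x _; rewrite lee_fin divr_ge0// ltW.
  rewrite ge0_integralZl_EFin//; last 2 first.
  - by move=> x _; rewrite lee_fin sqr_ge0.
  - by rewrite invr_ge0 mulr_ge0// ltW.
  rewrite integral_cst//.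
  apply: (@le_trans _ _ (((2 * a ^+ n)^-1)%:E * (C * (a ^+ n) ^+ 2)%:E +
      (a ^+ n / 2)%:E)%E).
    apply: leeD.
      by apply: lee_wpmul2l (hY n); rewrite lee_fin invr_ge0 mulr_ge0// ltW.
    rewrite -[leRHS]mule1; apply: lee_wpmul2l => //.
    by rewrite lee_fin divr_ge0// ltW.
  rewrite -EFinM -EFinD lee_fin le_eqVlt; apply/orP; left; apply/eqP.
  by field; rewrite gt_eqF.
pose S x := (\sum_(n <oo) (`|Y n x|)%:E)%E.
have S0 x : (0 <= S x)%E by apply: nneseries_ge0 => n _ _; rewrite lee_fin.
have mS : measurable_fun setT S.
  by apply: ge0_emeasurable_sum => // n x _ _; rewrite lee_fin.
have iS : (\int[mu]_x S x < +oo)%E.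
  rewrite integral_nneseries//.
  apply: (@le_lt_trans _ _ (((C + 1) / 2 * (1 - a)^-1)%:E)); last exact: ltry.
  apply: lime_le.
    apply: is_cvg_nneseries => n _ _.
    by apply: integral_ge0 => x _; rewrite lee_fin.
  apply: nearW => n.
  apply: (@le_trans _ _ (\sum_(0 <= i < n) ((C + 1) / 2 * a ^+ i)%:E)%E).
    by apply: lee_sum => i _; exact: L1.
  rewrite sumEFin lee_fin.
  have h : 0 <= (C + 1) / 2 by rewrite divr_ge0// addr_ge0.
  have a1' : `|a| < 1 by rewrite ger0_norm// ltW.
  by have := geometric_le_lim n h a0 a1'; rewrite seriesEnat.
have Sint : mu.-integrable setT S.
  apply/integrableP; split=> //.
  by under eq_integral do rewrite gee0_abs//.
apply: filterS (integrable_ae measurableT Sint) => x /(_ I) Sfin.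
apply: nondecreasing_is_cvgn.
  by apply: nondecreasing_series => n _ _.
exists (fine (S x)) => _ [n _ <-].
rewrite -lee_fin fineK// seriesEnat/= -sumEFin.
by apply: nneseries_lim_ge => i _; rewrite lee_fin.
Qed.

Lemma ae_cvg0_of_l2_geometric (Y : nat -> T -> R) (C a : R) :
  (mu setT <= 1)%E -> 0 < a < 1 -> 0 <= C ->
  (forall n, measurable_fun setT (Y n)) ->
  (forall n, \int[mu]_x (Y n x ^+ 2)%:E <= (C * (a ^+ n) ^+ 2)%:E)%E ->
  {ae mu, forall x, Y ^~ x @ \oo --> 0}.
Proof.
move=> mu1 a01 C0 mY hY.
apply: filterS (ae_cvg_series_of_l2_geometric mu1 a01 C0 mY hY) => x.
by move=> /cvg_series_cvg_0 /norm_cvg0P.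
Qed.

Lemma ae_cvg_of_l2_geometric (X : nat -> T -> R) (C a : R) :
  (mu setT <= 1)%E -> 0 < a < 1 -> 0 <= C ->
  (forall n, measurable_fun setT (X n)) ->
  (forall n, \int[mu]_x ((X n.+1 x - X n x) ^+ 2)%:E
             <= (C * (a ^+ n) ^+ 2)%:E)%E ->
  {ae mu, forall x, cvgn (X ^~ x)}.
Proof.
move=> mu1 a01 C0 mX hX.
have mY n : measurable_fun setT (fun x => X n.+1 x - X n x).
  exact: measurable_funB.
apply: filterS (ae_cvg_series_of_l2_geometric mu1 a01 C0 mY hX) => x.
move=> /normed_cvg cY.
rewrite (_ : X ^~ x = fun n => X 0 x + series (telescope (X ^~ x)) n).
  by apply: is_cvgD => //; exact: is_cvg_cst.
by apply/funext => n; rewrite telescopeK/= addrCA subrr addr0.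
Qed.

(** A total and measurable stand-in for the limit: it agrees with the limit wherever a finite one
    exists, and [fine] keeps it real elsewhere. *)
Definition limsup_fun (X : nat -> T -> R) (x : T) : R :=
  fine (limn_esup (fun n => (X n x)%:E)).

Lemma measurable_limsup_fun X : (forall n, measurable_fun setT (X n)) ->
  measurable_fun setT (limsup_fun X).
Proof.
move=> mX; apply: (measurableT_comp (f := fine)) => //.
by apply: measurable_fun_limn_esup => n; exact/measurable_EFinP.
Qed.

Lemma limsup_fun_cvg X x l : X ^~ x @ \oo --> l -> limsup_fun X x = l.
Proof.
move=> Xl; rewrite /limsup_fun.
have /cvg_limn_einf_sup[_ ->//] : (fun n => (X n x)%:E) @ \oo --> l%:E.
apply: cvg_EFin => //; exact: nearW.
Qed.

End ae_convergence.

(** * Weighted squared distances on the Galerkin space *)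

Section weighted_distance.
Variables (R : realType) (N : nat) (w : 'I_N.+1 -> R).
Hypothesis w0 : forall j, 0 < w j.

(** With the weights [weight] introduced later this is the squared [H^{-1}] distance; being squared,
    it satisfies a triangle inequality only up to factors. *)
Definition wdist (x y : HN R N) : R :=
  \sum_(j < N.+1) w j * (tnth x j - tnth y j) ^+ 2.

Lemma wdist_ge0 x y : 0 <= wdist x y.
Proof. by apply: sumr_ge0 => j _; rewrite mulr_ge0 ?sqr_ge0// ltW. Qed.

Lemma sqr_le_wdist x y j : w j * (tnth x j - tnth y j) ^+ 2 <= wdist x y.
Proof.
rewrite /wdist (bigD1 j)//= lerDl; apply: sumr_ge0 => i _.
by rewrite mulr_ge0 ?sqr_ge0// ltW.
Qed.

Lemma wdist_eq0 x y : wdist x y = 0 -> x = y.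
Proof.
move=> xy0; apply: eq_from_tnth => j; apply/eqP; rewrite -subr_eq0 -sqrf_eq0.
apply/eqP/le_anti; rewrite sqr_ge0 andbT.
by have := sqr_le_wdist x y j; rewrite xy0 pmulr_rle0.
Qed.

(** Young's inequality: coordinatewise the gap between the two sides is a multiple of a square. A
    small [a] keeps the first factor near 1, so that a contraction survives it. *)
Lemma wdist_triangle a x y z : 0 < a ->
  wdist x z <= (1 + a) * wdist y z + (1 + a^-1) * wdist x y.
Proof.
move=> a0; rewrite !mulr_sumr -big_split/=; apply: ler_sum => j _.
rewrite ![(1 + _) * (w j * _)]mulrCA -mulrDr ler_pM2l// -subr_ge0.
set p := tnth x j; set q := tnth y j; set r := tnth z j.
have -> : (1 + a) * (q - r) ^+ 2 + (1 + a^-1) * (p - q) ^+ 2 - (p - r) ^+ 2 =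
    a^-1 * (a * (q - r) - (p - q)) ^+ 2 by field; rewrite gt_eqF.
by rewrite mulr_ge0 ?sqr_ge0// invr_ge0 ltW.
Qed.

Lemma measurable_wdist d (T : measurableType d) (A B : T -> HN R N) :
  measurable_fun setT A -> measurable_fun setT B ->
  measurable_fun setT (fun t => wdist (A t) (B t)).
Proof.
move=> mA mB; apply: measurable_sum => j; apply: measurable_funM => //.
apply: measurable_funX; apply: measurable_funB.
  exact: (measurableT_comp (measurable_tnth j) mA).
exact: (measurableT_comp (measurable_tnth j) mB).
Qed.

End weighted_distance.

(** * Random iteration: backward convergence and the invariant law *)

Section iterated_maps.
Variables (R : realType) (N : nat) (w : 'I_N.+1 -> R).
Hypothesis w0 : forall j, 0 < w j.
Variables (g : probability (measurableTypeR R) R) (nu : probability (noise R) R).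
Hypothesis nug : iid g nu.
Variables (Phi : HN R N * noise R -> HN R N) (alpha rho : R).
Hypothesis mPhi : measurable_fun setT Phi.
Hypothesis Phi_mean : forall u e, tnth (Phi (u, e)) ord0 = tnth u ord0.
Hypothesis rho01 : 0 < rho < 1.
Hypothesis Phi_contraction : forall u v : HN R N,
  tnth u ord0 = alpha -> tnth v ord0 = alpha ->
  (\int[nu]_e (wdist w (Phi (u, e)) (Phi (v, e)))%:E
   <= (rho * wdist w u v)%:E)%E.
Hypothesis Phi_moment : forall u,
  (\int[nu]_e (wdist w u (Phi (u, e)))%:E < +oo)%E.

Local Notation D := (wdist w).
Let D0 := wdist_ge0 w0.
Let rho0 : 0 < rho. Proof. by case/andP: rho01. Qed.

(* The noise is split into two independent halves: the even coordinates drive the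
   last step and the odd ones all the previous steps.  For fixed [e], the [n]-th
   iterate is thus a composition of random maps in backward order, which
   converges almost surely although the forward orbits do not. *)
Fixpoint iterate (n : nat) (u : HN R N) (e : noise R) : HN R N :=
  if n is m.+1 then Phi (iterate m u (odds e), evens e) else u.

Lemma iterate_mean n u e : tnth (iterate n u e) ord0 = tnth u ord0.
Proof. by elim: n e => //= n IH e; rewrite Phi_mean IH. Qed.

Lemma measurable_iterate n :
  measurable_fun setT (fun z : HN R N * noise R => iterate n z.1 z.2).
Proof.
elim: n => [|n IH] /=; first exact: measurable_fst.
have modds : measurable_fun setT (fun z : HN R N * noise R => odds z.2).
  by apply: measurableT_comp; [exact: measurable_odds|exact: measurable_snd].
have mevens : measurable_fun setT (fun z : HN R N * noise R => evens z.2).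
  by apply: measurableT_comp; [exact: measurable_evens|exact: measurable_snd].
apply: (measurableT_comp mPhi); apply: measurable_fun_pair => //.
apply: (measurableT_comp IH
  (g := fun z : HN R N * noise R => (z.1, odds z.2))).
by apply: measurable_fun_pair.
Qed.

Let measurable_iterate_at n u : measurable_fun setT (iterate n u).
Proof. exact: measurable_fun_pair2 (measurable_iterate n). Qed.

Let measurable_step (A : noise R -> HN R N) : measurable_fun setT A ->
  measurable_fun setT (fun z : noise R * noise R => Phi (A z.2, z.1)).
Proof.
move=> mA; apply: (measurableT_comp mPhi); apply: measurable_fun_pair => //.
exact: measurableT_comp.
Qed.

(** For a frozen odd half, [A (odds e)] and [B (odds e)] are fixed points of the slice and the even
    half is fresh noise, so [Phi_contraction] applies to the inner integral; the odd half again has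
    law [nu]. *)
Lemma contraction_step (A B : noise R -> HN R N) :
  measurable_fun setT A -> measurable_fun setT B ->
  (forall e, tnth (A e) ord0 = alpha) -> (forall e, tnth (B e) ord0 = alpha) ->
  (\int[nu]_e (D (Phi (A (odds e), evens e)) (Phi (B (odds e), evens e)))%:E
   <= rho%:E * \int[nu]_e (D (A e) (B e))%:E)%E.
Proof.
move=> mA mB Aa Ba.
pose f (z : noise R * noise R) :=
  (D (Phi (A z.2, z.1)) (Phi (B z.2, z.1)))%:E.
have mf : measurable_fun setT f.
  by apply/measurable_EFinP; apply: measurable_wdist; exact: measurable_step.
have mAB : measurable_fun setT (fun e => (D (A e) (B e))%:E).
  by apply/measurable_EFinP; exact: measurable_wdist.
rewrite (ge0_integral_halves (f := f) nug)//; last by move=> z; rewrite lee_fin.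
rewrite -ge0_integralZl_EFin//; last 2 first.
- by move=> e _; rewrite lee_fin.
- exact: ltW.
apply: ge0_le_integral => //.
- by move=> b _; apply: integral_ge0 => a _; rewrite lee_fin.
- apply: (@measurable_fun_fubini_tonelli_G _ _ _ _ _ nu f) => // z.
  by rewrite lee_fin.
- exact: emeasurable_funM.
- by move=> b _; have := Phi_contraction (Aa b) (Ba b); rewrite EFinM.
Qed.

(** In backward order both iterates end with the same [n] random maps; peeling them off leaves [u]
    against [k] steps from [v]. The case [k = 1] controls successive iterates, [k = 0] the effect of
    the starting point, and large [k] the distance to the limit. *)
Lemma iterate_contraction n k u v :
  tnth u ord0 = alpha -> tnth v ord0 = alpha ->
  (\int[nu]_e (D (iterate n u e) (iterate (n + k) v e))%:E
   <= (rho ^+ n)%:E * \int[nu]_e (D u (iterate k v e))%:E)%E.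
Proof.
move=> ua va; elim: n => [|n IH]; first by rewrite expr0 mul1e.
rewrite addSn/=.
apply: le_trans (contraction_step (A := iterate n u) (B := iterate (n + k) v)
  _ _ _ _) _ => //.
- by move=> e; rewrite iterate_mean.
- by move=> e; rewrite iterate_mean.
- by rewrite exprS EFinM -muleA; apply: lee_wpmul2l => //; rewrite lee_fin ltW.
Qed.

Lemma iterate_moment u : tnth u ord0 = alpha ->
  exists2 M, 0 <= M & forall k, (\int[nu]_e (D u (iterate k u e))%:E <= M%:E)%E.
Proof.
(* [a] is chosen so that [q = (1 + a) * rho] equals [(1 + rho) / 2], still below 1. *)
move=> ua; pose a := (1 - rho) / (2 * rho).
have rho1 : rho < 1 by case/andP: rho01.
have a0 : 0 < a by rewrite divr_gt0 ?subr_gt0// mulr_gt0.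
have fA : (\int[nu]_e (D u (Phi (u, e)))%:E)%E \is a fin_num.
  rewrite ge0_fin_numE//; apply: integral_ge0 => e _; by rewrite lee_fin.
pose A := fine (\int[nu]_e (D u (Phi (u, e)))%:E)%E.
have A0 : 0 <= A by apply: fine_ge0; apply: integral_ge0 => e _; rewrite lee_fin.
pose q := (1 + a) * rho.
have q1 : 1 - q = (1 - rho) / 2 by rewrite /q /a; field; rewrite gt_eqF.
have q10 : 0 < 1 - q by rewrite q1 divr_gt0// subr_gt0.
(* [M] is the fixed point of [x |-> q * x + (1 + a^-1) * A], the recursion that the moments
   satisfy. *)
pose M := (1 + a^-1) * A / (1 - q).
have ai : 0 <= 1 + a^-1 by rewrite addr_ge0// invr_ge0 ltW.
have M0 : 0 <= M by rewrite divr_ge0 ?(ltW q10)// mulr_ge0.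
exists M => // k; elim: k => [|k IH].
  rewrite (eq_integral (cst 0%E)) ?integral0//= => e _.
  by rewrite /wdist big1// => j _; rewrite subrr expr0n mulr0.
have mu_ : measurable_fun setT (fun _ : noise R => u) by exact: measurable_cst.
have mPe : measurable_fun setT (fun e : noise R => Phi (u, e)).
  exact: measurable_fun_pair2 mPhi.
have mPeven : measurable_fun setT (fun e : noise R => Phi (u, evens e)).
  exact: measurableT_comp mPe (@measurable_evens R).
have mit1 := measurable_iterate_at k.+1 u.
pose f1 (e : noise R) := (D (Phi (u, evens e)) (iterate k.+1 u e))%:E.
pose f2 (e : noise R) := (D u (Phi (u, evens e)))%:E.
have mf1 : measurable_fun setT f1.
  by apply/measurable_EFinP; exact: measurable_wdist.
have mf2 : measurable_fun setT f2.
  by apply/measurable_EFinP; exact: measurable_wdist.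
have a1 : 0 <= 1 + a by rewrite addr_ge0// ltW.
(* The intermediate point of the triangle inequality is one step from [u], driven by the same even
   half as the last step of the iterate. *)
apply: (@le_trans _ _ (\int[nu]_e ((1 + a)%:E * f1 e + (1 + a^-1)%:E * f2 e))%E).
  apply: ge0_le_integral => //.
  - by move=> e _; rewrite lee_fin.
  - by apply/measurable_EFinP; exact: measurable_wdist.
  - by apply: emeasurable_funD; exact: emeasurable_funM.
  - by move=> e _; rewrite -!EFinM -EFinD lee_fin; exact: wdist_triangle.
rewrite ge0_integralD//; last 4 first.
- by move=> e _; rewrite mule_ge0// lee_fin.
- exact: emeasurable_funM.
- by move=> e _; rewrite mule_ge0// lee_fin.
- exact: emeasurable_funM.
rewrite !ge0_integralZl_EFin//; last 2 first.
- by move=> e _; rewrite lee_fin.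
- by move=> e _; rewrite lee_fin.
have I1 : (\int[nu]_e f1 e <= (rho * M)%:E)%E.
  apply: le_trans (contraction_step (A := fun=> u) (B := iterate k u)
    _ _ _ _) _ => //.
    by move=> e; rewrite iterate_mean.
  by rewrite EFinM; apply: lee_wpmul2l IH; rewrite lee_fin ltW.
have I2 : (\int[nu]_e f2 e = A%:E)%E.
  rewrite (ge0_integral_halves (f := fun z => (D u (Phi (u, z.1)))%:E) nug).
  - rewrite (eq_integral (cst A%:E)); last by move=> b _; rewrite /A fineK.
    by rewrite integral_cst//= probability_setT mule1.
  - apply/measurable_EFinP; apply: measurable_wdist => //.
    exact: measurableT_comp mPe _.
  - by move=> z; rewrite lee_fin.
rewrite I2; apply: (@le_trans _ _ ((1 + a)%:E * (rho * M)%:E +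
    (1 + a^-1)%:E * A%:E)%E).
  by apply: leeD => //; apply: lee_wpmul2l => //; rewrite lee_fin.
rewrite -!EFinM -EFinD lee_fin le_eqVlt; apply/orP; left; apply/eqP.
have -> : (1 + a^-1) * A = (1 - q) * M by rewrite /M [RHS]mulrC divfK// gt_eqF.
by rewrite /q; ring.
Qed.

Let sqr_coord_le (A B : noise R -> HN R N) j :
  measurable_fun setT A -> measurable_fun setT B ->
  (\int[nu]_e ((tnth (A e) j - tnth (B e) j) ^+ 2)%:E
   <= ((w j)^-1)%:E * \int[nu]_e (D (A e) (B e))%:E)%E.
Proof.
move=> mA mB.
have mD : measurable_fun setT (fun e => (D (A e) (B e))%:E).
  by apply/measurable_EFinP; exact: measurable_wdist.
rewrite -ge0_integralZl_EFin//; last 2 first.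
- by move=> e _; rewrite lee_fin.
- by rewrite invr_ge0 ltW.
apply: ge0_le_integral => //.
- by move=> e _; rewrite lee_fin sqr_ge0.
- apply/measurable_EFinP; apply: measurable_funX; apply: measurable_funB.
    exact: (measurableT_comp (measurable_tnth j) mA).
  exact: (measurableT_comp (measurable_tnth j) mB).
- exact: emeasurable_funM.
- by move=> e _; rewrite -EFinM lee_fin ler_pdivlMl// sqr_le_wdist.
Qed.

Let nu1 : (nu setT <= 1)%E.
Proof. by apply: probability_le1. Qed.

(** The convergence lemmas expect second moments of order [(a ^+ n) ^+ 2], whereas [rho] acts on
    squared distances. *)
Let a := Num.sqrt rho.
Let a01 : 0 < a < 1.
Proof.
have /andP[r0 r1] := rho01.
by rewrite sqrtr_gt0 r0/= -sqrtr1 ltr_sqrt.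
Qed.
Let a2 n : (a ^+ n) ^+ 2 = rho ^+ n.
Proof. by rewrite exprAC sqr_sqrtr// ltW. Qed.

Definition limit_map (u : HN R N) (e : noise R) : HN R N :=
  [tuple limsup_fun (fun n e => tnth (iterate n u e) j) e | j < N.+1].

Lemma measurable_limit_map u : measurable_fun setT (limit_map u).
Proof.
apply/measurable_fun_tnthP => j.
rewrite (_ : _ \o _ = limsup_fun (fun n e => tnth (iterate n u e) j)).
  apply: measurable_limsup_fun => n.
  exact: (measurableT_comp (measurable_tnth j) (measurable_iterate_at n u)).
by apply/funext => e /=; rewrite tnth_mktuple.
Qed.

Let measurable_coord_iterate n u j :
  measurable_fun setT (fun e => tnth (iterate n u e) j : R).
Proof.
exact: (measurableT_comp (measurable_tnth j) (measurable_iterate_at n u)).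
Qed.

Lemma iterate_cvg u : tnth u ord0 = alpha ->
  {ae nu, forall e, forall j,
    (fun n => tnth (iterate n u e) j) @ \oo --> tnth (limit_map u e) j}.
Proof.
move=> ua; have [M M0 hM] := iterate_moment ua.
apply: filter_forall => j.
have : {ae nu, forall e, cvgn (fun n => tnth (iterate n u e) j : R)}.
  apply: (@ae_cvg_of_l2_geometric _ _ _ _ _ ((w j)^-1 * M) a) => //.
    by rewrite mulr_ge0// invr_ge0 ltW.
  move=> n; under eq_integral do rewrite -sqrrN opprB.
  apply: le_trans (sqr_coord_le j (measurable_iterate_at n u)
    (measurable_iterate_at n.+1 u)) _.
  rewrite -mulrA EFinM; apply: lee_wpmul2l.
    by rewrite lee_fin invr_ge0 ltW.
  rewrite a2 -addn1 mulrC EFinM; apply: le_trans (iterate_contraction _ _ _ _) _ => //.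
  by apply: lee_wpmul2l (hM 1%N); rewrite lee_fin exprn_ge0// ltW.
apply: filterS => e /cvg_ex[l hl].
by rewrite tnth_mktuple (limsup_fun_cvg hl).
Qed.

(** One limit serves the whole slice: the iterates from [u] and [v] undergo the same maps, so their
    mean squared distance decays like [rho ^+ n]. *)
Lemma iterate_cvg_from u v : tnth u ord0 = alpha -> tnth v ord0 = alpha ->
  {ae nu, forall e, forall j,
    (fun n => tnth (iterate n v e) j) @ \oo --> tnth (limit_map u e) j}.
Proof.
move=> ua va.
have h : {ae nu, forall e, forall j : 'I_N.+1,
    (fun n => tnth (iterate n v e) j - tnth (iterate n u e) j : R) @ \oo --> 0}.
  apply: filter_forall => j.
  apply: (@ae_cvg0_of_l2_geometric _ _ _ _ _ ((w j)^-1 * D v u) a) => //.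
  - by rewrite mulr_ge0// invr_ge0 ltW.
  - by move=> n; exact: measurable_funB.
  move=> n; apply: le_trans (sqr_coord_le j (measurable_iterate_at n v)
    (measurable_iterate_at n u)) _.
  rewrite -mulrA EFinM; apply: lee_wpmul2l.
    by rewrite lee_fin invr_ge0 ltW.
  rewrite a2 mulrC EFinM.
  have := iterate_contraction n 0 va ua; rewrite addn0 => /le_trans; apply.
  apply: lee_wpmul2l; first by rewrite lee_fin exprn_ge0// ltW.
  by rewrite /= integral_cst//= probability_setT mule1.
have := iterate_cvg ua; apply: filterS2 h => e h1 h2 j.
rewrite -[X in _ --> X]add0r.
rewrite (_ : (fun n => tnth (iterate n v e) j) =
    (fun n => (tnth (iterate n v e) j - tnth (iterate n u e) j) +
              tnth (iterate n u e) j)); last by apply/funext => n; rewrite subrK.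
by apply: cvgD; [exact: h1|exact: h2].
Qed.

Let cvg_wdist (y : HN R N) (x_ : nat -> HN R N) (l : HN R N) :
  (forall j, (fun n => tnth (x_ n) j : R) @ \oo --> (tnth l j : R)) ->
  (fun n => D y (x_ n)) @ \oo --> D y l.
Proof.
move=> xl; apply: cvg_big => [|j _]; first exact: add_continuous.
apply: cvgM; first exact: cvg_cst.
rewrite expr2; apply: cvgM; apply: cvgB; do ?exact: cvg_cst; exact: xl.
Qed.

(** In [iterate_contraction] with [v = u], Fatou's lemma lets [k] tend to infinity, since the bound
    of [iterate_moment] is uniform in [k]. *)
Lemma iterate_limit_map u : tnth u ord0 = alpha ->
  exists2 M, 0 <= M & forall n,
    (\int[nu]_e (D (iterate n u e) (limit_map u e))%:E <= (M * rho ^+ n)%:E)%E.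
Proof.
move=> ua; have [M M0 hM] := iterate_moment ua; exists M => // n.
apply: (@fatou_le _ _ _ nu (fun k e => D (iterate n u e) (iterate (n + k) u e))
  _ (fun=> (M * rho ^+ n)%:E)) => //.
- by move=> k; exact: measurable_wdist.
- by apply: measurable_wdist => //; exact: measurable_limit_map.
- apply: filterS (iterate_cvg ua) => e he; apply: cvg_wdist => j.
  exact: (cvg_comp (fun k => n + k)%N (fun k => tnth (iterate k u e) j)
    (cvg_addnl n) (he j)).
- move=> k; apply: le_trans (iterate_contraction n k ua ua) _.
  rewrite mulrC EFinM; apply: lee_wpmul2l (hM k).
  by rewrite lee_fin exprn_ge0// ltW.
- exact: cvg_cst.
Qed.

Lemma limit_map_mean u e : tnth u ord0 = alpha ->
  tnth (limit_map u e) ord0 = alpha.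
Proof.
move=> ua; rewrite tnth_mktuple; apply: limsup_fun_cvg.
rewrite (_ : (fun n => _) = (fun=> alpha)); first exact: cvg_cst.
by apply/funext => n; rewrite iterate_mean.
Qed.

(** The recursion of the iterates, in the limit. [Phi] is not assumed continuous in its first
    argument, so both sides are compared in mean square with [iterate n.+1]; their distance is below
    a multiple of [rho ^+ n.+1] for every [n]. *)
Lemma limit_map_fixed u : tnth u ord0 = alpha ->
  {ae nu, forall e, Phi (limit_map u (odds e), evens e) = limit_map u e}.
Proof.
move=> ua; have [M M0 hM] := iterate_limit_map ua.
have mL := measurable_limit_map u.
have mPL : measurable_fun setT
    (fun e : noise R => Phi (limit_map u (odds e), evens e)).
  apply: (measurableT_comp mPhi); apply: measurable_fun_pair.
    exact: measurableT_comp mL (@measurable_odds R).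
  exact: measurable_evens.
pose f e := (D (limit_map u e) (Phi (limit_map u (odds e), evens e)))%:E.
have mf : measurable_fun setT f.
  by apply/measurable_EFinP; exact: measurable_wdist.
have hI n : (\int[nu]_e f e <= (4 * M * rho ^+ n.+1)%:E)%E.
  have mit := measurable_iterate_at n.+1 u.
  pose f1 (e : noise R) :=
    (D (iterate n.+1 u e) (Phi (limit_map u (odds e), evens e)))%:E.
  pose f2 (e : noise R) := (D (iterate n.+1 u e) (limit_map u e))%:E.
  have mf1 : measurable_fun setT f1.
    by apply/measurable_EFinP; exact: measurable_wdist.
  have mf2 : measurable_fun setT f2.
    by apply/measurable_EFinP; exact: measurable_wdist.
  apply: (@le_trans _ _ (\int[nu]_e (2%:E * f1 e + 2%:E * f2 e))%E).
    apply: ge0_le_integral => //.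
    - by move=> e _; rewrite lee_fin.
    - by apply: emeasurable_funD; exact: emeasurable_funM.
    - move=> e _; rewrite -!EFinM -EFinD lee_fin.
      have := wdist_triangle w0 (limit_map u e) (iterate n.+1 u e)
        (Phi (limit_map u (odds e), evens e)) ltr01.
      rewrite invr1 -[1 + 1]/(2 : R) => /le_trans; apply.
      rewrite lerD2l le_eqVlt; apply/orP; left; apply/eqP; congr (_ * _).
      by apply: eq_bigr => j _; rewrite -sqrrN opprB.
  rewrite ge0_integralD//; last 4 first.
  - by move=> e _; rewrite mule_ge0// lee_fin.
  - exact: emeasurable_funM.
  - by move=> e _; rewrite mule_ge0// lee_fin.
  - exact: emeasurable_funM.
  rewrite !ge0_integralZl_EFin//; last 2 first.
  - by move=> e _; rewrite lee_fin.
  - by move=> e _; rewrite lee_fin.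
  have I1 : (\int[nu]_e f1 e <= (M * rho ^+ n.+1)%:E)%E.
    apply: le_trans (contraction_step (A := iterate n u) (B := limit_map u)
      _ _ _ _) _ => //.
    - by move=> e; rewrite iterate_mean.
    - by move=> e; exact: limit_map_mean.
    - rewrite exprS mulrCA EFinM; apply: lee_wpmul2l (hM n).
      by rewrite lee_fin ltW.
  apply: (@le_trans _ _ (2%:E * (M * rho ^+ n.+1)%:E +
      2%:E * (M * rho ^+ n.+1)%:E)%E).
    have two0 : (0 <= 2%:E :> \bar R)%E by rewrite lee_fin.
    by apply: leeD; [exact: lee_wpmul2l I1|exact: lee_wpmul2l (hM n.+1)].
  by rewrite -!EFinM -EFinD lee_fin le_eqVlt; apply/orP; left; apply/eqP; ring.
have I0 : (\int[nu]_e f e = 0)%E.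
  apply/eqP; rewrite eq_le; apply/andP; split; last first.
    by apply: integral_ge0 => e _; rewrite lee_fin.
  have lim0 : (4 * M * rho ^+ n.+1)%:E @[n --> \oo] --> 0%E.
    apply: cvg_EFin; first exact: nearW.
    have /andP[r0 r1] := rho01.
    rewrite (_ : fine \o _ = fun n => geometric (4 * M) rho n.+1)//.
    rewrite cvg_shiftS; apply: cvg_geometric.
    by rewrite ger0_norm// ltW.
  by apply: (cvge_to_ge lim0); exact: nearW.
have If0 : (\int[nu]_e `|f e| = 0)%E.
  by under eq_integral do rewrite gee0_abs ?lee_fin//.
have := (ae_eq_integral_abs nu measurableT mf).1 If0.
apply: filterS => e /(_ I) [] fe0; apply/esym; exact: wdist_eq0 fe0.
Qed.

Definition stationary (mu : probability (HN R N) R) : Prop :=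
  forall B, measurable B ->
    (\int[mu]_u nu [set e | B (Phi (u, e))] = mu B)%E.

Lemma ge0_integral_stationary mu (f : HN R N -> \bar R) : stationary mu ->
  measurable_fun setT f -> (forall x, 0 <= f x)%E ->
  (\int[mu]_u \int[nu]_e f (Phi (u, e)) = \int[mu]_u f u)%E.
Proof.
move=> smu mf f0.
have mfP : measurable_fun setT (f \o Phi) by exact: measurableT_comp.
rewrite -(@fubini_tonelli1 _ _ _ _ _ mu nu (f \o Phi))//; last first.
  by move=> z; exact: f0.
rewrite -(@ge0_integral_pushforward _ _ _ _ _ _ mPhi (mu \x nu)%E setT f)//.
apply: eq_measure_integral => B mB _.
rewrite /pushforward /= -[RHS]smu//; apply: eq_integral => u _ /=.
by congr (nu _); apply/seteqP; split=> e /=; rewrite /xsection/= inE.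
Qed.

(** For a single [n], backward and forward compositions have the same law. The outermost step,
    driven by the even half, turns [f] into [fubini_F nu (f \o Phi)], the transition operator
    applied to [f], and the induction hypothesis is used for that function. *)
Lemma iterate_stationary mu n (f : HN R N -> \bar R) : stationary mu ->
  measurable_fun setT f -> (forall x, 0 <= f x)%E ->
  (\int[mu]_u \int[nu]_e f (iterate n u e) = \int[mu]_u f u)%E.
Proof.
move=> smu; elim: n f => [|n IH] f mf f0.
  apply: eq_integral => u _ /=.
  by rewrite integral_cst//= probability_setT mule1.
have mfP : measurable_fun setT (f \o Phi) by exact: measurableT_comp.
have fP0 z : (0 <= (f \o Phi) z)%E by exact: f0.
rewrite -(ge0_integral_stationary smu mf f0).
rewrite -(IH (fubini_F nu (f \o Phi))); last 2 first.
- exact: measurable_fun_fubini_tonelli_F.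
- by move=> x; apply: integral_ge0.
apply: eq_integral => u _ /=.
rewrite (ge0_integral_halves (f := fun z => f (Phi (iterate n u z.2, z.1))) nug)//.
by apply: measurableT_comp mf _; exact: measurable_step.
Qed.

(** Openness is tested along coordinatewise convergent sequences, the mode in which the iterates
    converge. *)
Let seq_open (U : set (HN R N)) := forall (x_ : nat -> HN R N) l, U l ->
  (forall j, (fun n => tnth (x_ n) j : R) @ \oo --> (tnth l j : R)) ->
  \forall n \near \oo, U (x_ n).

Let measurable_mean : measurable (HN_mean alpha : set (HN R N)).
Proof.
rewrite (_ : HN_mean alpha = (fun c : HN R N => tnth c ord0) @^-1` [set alpha])//.
by rewrite -[_ @^-1` _]setTI; apply: measurable_tnth => //; exact: measurable_set1.
Qed.

(** Iterates started from [mu] all have law [mu], while from each point of the slice they converge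
    to [limit_map u]. The indicator of an open set is lower semicontinuous, so Fatou's lemma, first
    in the noise and then in the starting point, gives the inequality. *)
Let portmanteau mu u U : stationary mu -> mu (HN_mean alpha) = 1%E ->
  tnth u ord0 = alpha -> measurable U -> seq_open U ->
  (nu (limit_map u @^-1` U) <= mu U)%E.
Proof.
move=> smu mu1 ua mU oU.
have mi : measurable_fun setT (fun x : HN R N => (\1_U x)%:E : \bar R).
  exact/measurable_EFinP/measurable_indic.
have i0 x : (0 <= (\1_U x)%:E :> \bar R)%E by rewrite lee_fin.
pose p n v : \bar R := (\int[nu]_e (\1_U (iterate n v e))%:E)%E.
have mp n : measurable_fun setT (p n).
  apply: (@measurable_fun_fubini_tonelli_F _ _ _ _ _ nu
    (fun z : HN R N * noise R => (\1_U (iterate n z.1 z.2))%:E)).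
    exact: measurableT_comp mi (measurable_iterate n).
  by move=> z.
have p0 n v : (0 <= p n v)%E by exact: integral_ge0.
have mL := measurable_limit_map u.
have mLU : measurable (limit_map u @^-1` U).
  by rewrite -[_ @^-1` _]setTI; exact: mL.
set c := nu _.
have inner v : tnth v ord0 = alpha -> (c <= limn_einf (p ^~ v))%E.
  move=> va.
  have mn n : measurable_fun setT (fun e => (\1_U (iterate n v e))%:E : \bar R).
    exact: measurableT_comp mi (measurable_iterate_at n v).
  apply: le_trans (fatou nu measurableT mn _); last by [].
  rewrite (_ : c = \int[nu]_e (\1_U (limit_map u e))%:E)%E; last first.
    by rewrite (integral_indic nu measurableT mLU) setIT.
  apply: ae_ge0_le_integral => //.
  - exact: measurableT_comp mi mL.
  - by move=> e _; exact: limn_einf_ge0.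
  - exact: measurable_limn_einf.
  - apply: filterS (iterate_cvg_from ua va) => e he _.
    have [UL|UL] := pselect (U (limit_map u e)); last first.
      by rewrite indicE memNset//; exact: limn_einf_ge0.
    rewrite indicE mem_set//.
    have nU := oU _ _ UL he.
    have h : (fun n => (\1_U (iterate n v e))%:E : \bar R) @ \oo --> 1%:E.
      apply: cvg_EFin; first exact: nearW.
      apply: cvg_near_cst; apply: filterS nU => n Un /=.
      by rewrite indicE mem_set.
    by rewrite (cvg_limn_einf_sup h).1.
pose S : set (HN R N) := HN_mean alpha.
have mpS n : measurable_fun S (p n) by exact: measurable_funTS.
have cE : (\int[mu]_(v in S) c = c)%E by rewrite integral_cst//= mu1 mule1.
rewrite -cE.
apply: (@le_trans _ _ (\int[mu]_(v in S) limn_einf (p ^~ v))%E).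
  apply: ge0_le_integral => //.
    by move=> v _; exact: measure_ge0.
  exact: measurable_limn_einf.
apply: le_trans (fatou mu _ mpS _) _ => //.
apply: (@le_trans _ _ (limn_einf (fun n : nat => mu U))).
  apply: le_limn_einf => n.
  apply: (@le_trans _ _ (\int[mu]_v p n v)%E); first exact: ge0_subset_integral.
  by rewrite /p (iterate_stationary n smu mi)// (integral_indic mu measurableT mU) setIT.
by rewrite (cvg_limn_einf_sup (cvg_cst _)).1.
Qed.

(** Open lower orthants form a generating pi-system; [portmanteau] bounds [mu] below on them and,
    through complements, above on the closed ones. *)
Let obox (c : 'I_N.+1 -> R) : set (HN R N) := [set x | forall j, tnth x j < c j].
Let cbox (c : 'I_N.+1 -> R) : set (HN R N) := [set x | forall j, tnth x j <= c j].

Let measurable_box (A : 'I_N.+1 -> set R) : (forall j, measurable (A j)) ->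
  measurable [set x : HN R N | forall j, A j (tnth x j)].
Proof.
move=> mA; rewrite (_ : [set x | _] =
    \bigcap_(j in [set: 'I_N.+1]) ((fun x : HN R N => tnth x j) @^-1` A j)).
  apply: fin_bigcap_measurable => // j _; rewrite -[_ @^-1` _]setTI.
  by apply: measurable_tnth => //; exact: mA.
by apply/seteqP; split=> x /= h j => [_|]; exact: h.
Qed.

Let measurable_obox c : measurable (obox c).
Proof.
apply: (@measurable_box (fun j => `]-oo, c j[%classic)) => j.
exact: measurable_itv.
Qed.

Let measurable_cbox c : measurable (cbox c).
Proof.
apply: (@measurable_box (fun j => `]-oo, c j]%classic)) => j.
exact: measurable_itv.
Qed.

Let obox_generate : (measurable : set (set (HN R N))) = <<s range obox >>.
Proof.
apply/seteqP; split; last first.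
  by apply: smallest_sub; [exact: sigma_algebra_measurable|move=> _ [c _ <-]].
apply: smallest_sub; first exact: smallest_sigma_algebra.
rewrite -bigcup_mkord_ord; apply: bigcup_sub => i iN _ [A mA <-].
set j := inord i.
have mj : measurable_fun setT
    (fun x : g_sigma_algebraType (range obox) => tnth x j : R).
  apply: (measurability _ (RGenInftyO.measurableE R)) => _ [_ [r ->] <-].
  (* A half-line in coordinate [j] is the union of the orthants whose other bounds are [n]; an
     integer above the sum of the absolute coordinates of a point bounds them all. *)
  rewrite setTI (_ : _ @^-1` _ =
      \bigcup_n obox (fun k => if k == j then r else n%:R)).
    by apply: bigcup_measurable => n _; apply: sub_sigma_algebra; eexists.
  apply/seteqP; split=> x /=.
    rewrite in_itv/= => xr.
    pose b := \sum_(k < N.+1) `|tnth x k|.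
    exists (Num.truncn b).+1 => // k; case: eqP => [->//|_].
    apply: le_lt_trans (truncnS_gt _); apply: le_trans (ler_norm _) _.
    by rewrite /b (bigD1 k)//= lerDl sumr_ge0.
  by move=> [n _ /(_ j)]; rewrite eqxx in_itv/=.
by have := mj measurableT A mA.
Qed.

(** Equality on open orthants suffices: one inequality is [portmanteau], the other comes from the
    closed orthants that exhaust an open one from inside. *)
Lemma stationary_law mu u : stationary mu -> mu (HN_mean alpha) = 1%E ->
  tnth u ord0 = alpha ->
  forall B, measurable B -> mu B = nu (limit_map u @^-1` B).
Proof.
move=> smu mu1 ua.
have mL := measurable_limit_map u.
have mpre B : measurable B -> measurable (limit_map u @^-1` B).
  by move=> mB; rewrite -[_ @^-1` _]setTI; exact: mL.
have oo c : seq_open (obox c).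
  move=> x_ l /= lc xl; apply: filter_forall => j.
  exact: cvgr_lt (xl j) _ (lc j).
have oc c : seq_open (~` cbox c).
  move=> x_ l /= /existsNP[j] /negP; rewrite -ltNge => lc xl.
  apply: filterS (cvgr_gt _ (xl j) _ lc) => n cx /(_ j).
  by apply/negP; rewrite -ltNge.
have cle c : (mu (cbox c) <= nu (limit_map u @^-1` cbox c))%E.
  have := portmanteau smu mu1 ua (measurableC (measurable_cbox c)) (oc c).
  rewrite -preimage_setC probability_setC ?probability_setC//; last exact: mpre.
  rewrite -(fineK (fin_num_measure mu _ (measurable_cbox c))).
  rewrite -(fineK (fin_num_measure nu _ (mpre _ (measurable_cbox c)))).
  by rewrite -!EFinB !lee_fin; lra.
pose pm := [the {measure set (HN R N) -> \bar R} of
  pushforward nu (limit_map u)].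
have H : forall B, measurable B -> mu B = pm mL B.
  apply: (measure_unique (range obox) (fun n => obox (fun=> n%:R))).
  - exact: obox_generate.
  - move=> _ _ [c _ <-] [c' _ <-]; exists (fun j => Num.min (c j) (c' j)) => //.
    apply/seteqP; split=> x /=.
      by move=> h; split=> j; have := h j; rewrite lt_min => /andP[].
    by move=> [h h'] j; rewrite lt_min h h'.
  - by move=> n; eexists.
  - apply/seteqP; split=> // x _.
    pose b := \sum_(k < N.+1) `|tnth x k|.
    exists (Num.truncn b).+1 => //= k.
    apply: le_lt_trans (truncnS_gt _); apply: le_trans (ler_norm _) _.
    by rewrite /b (bigD1 k)//= lerDl sumr_ge0.
  - move=> _ [c _ <-]; apply/eqP; rewrite eq_le; apply/andP; split; last first.
      exact: portmanteau.
    pose C k := cbox (fun j => c j - k.+1%:R^-1).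
    have mC k : measurable (C k) by exact: measurable_cbox.
    have CE : obox c = \bigcup_k C k.
      apply/seteqP; split=> x /=; last first.
        move=> [k _ Ck] j; apply: le_lt_trans (Ck j) _.
        by rewrite ltrBlDr ltrDl invr_gt0.
      move=> xc; have : \forall k \near \oo, forall j : 'I_N.+1,
          k.+1%:R^-1 < c j - tnth x j.
        apply: filter_forall => j.
        have := @cvg_harmonic R; move/cvgr_lt; apply.
        by rewrite subr_gt0.
      move=> [k _ hk]; exists k => // j.
      by rewrite lerBrDr -lerBrDl ltW// hk//=.
    have ndC : nondecreasing_seq C.
      move=> k m km; apply/subsetPset => x Cx j; apply: le_trans (Cx j) _.
      by rewrite lerD2l lerN2 lef_pV2 ?posrE// ler_nat.
    have mUC : measurable (\bigcup_k C k) by exact: bigcup_measurable.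
    have := nondecreasing_cvg_mu (mu := mu) mC mUC ndC.
    move=> /cvge_to_le; rewrite CE; apply; apply: nearW => k /=.
    apply: le_trans (cle _) _; apply: le_measure; rewrite ?inE.
    + exact: mpre.
    + by apply: mpre.
    + by move=> e Ce; exists k.
  - by move=> k; rewrite (@le_lt_trans _ _ 1%E) ?ltry// probability_le1.
exact: H.
Qed.

Lemma stationary_unique mu mu' :
  stationary mu -> mu (HN_mean alpha) = 1%E ->
  stationary mu' -> mu' (HN_mean alpha) = 1%E ->
  forall B, measurable B -> mu' B = mu B.
Proof.
move=> smu mu1 smu' mu1' B mB.
have ua : tnth ([tuple alpha | j < N.+1] : HN R N) ord0 = alpha.
  by rewrite tnth_mktuple.
by rewrite (stationary_law smu mu1 ua)// (stationary_law smu' mu1' ua).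
Qed.

(** The law of [limit_map u] is invariant: [limit_map u (odds e)] has this law and is independent of
    [evens e], so one step from it is [Phi (limit_map u (odds e), evens e)], almost surely equal to
    [limit_map u e]. *)
Lemma stationary_exists :
  exists2 mu : probability (HN R N) R, mu (HN_mean alpha) = 1%E & stationary mu.
Proof.
pose u : HN R N := [tuple alpha | j < N.+1].
have ua : tnth u ord0 = alpha by rewrite tnth_mktuple.
have mL := measurable_limit_map u.
pose L : {mfun noise R >-> HN R N} :=
  HB.pack (limit_map u) (isMeasurableFun.Build _ _ _ _ _ mL).
pose mu : probability (HN R N) R := distribution nu L.
have muE B : mu B = nu (limit_map u @^-1` B) by [].
exists mu.
  rewrite muE (_ : _ @^-1` _ = setT) ?probability_setT//.
  by apply/seteqP; split=> // e _; exact: limit_map_mean.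
move=> B mB; rewrite muE.
have mi : measurable_fun setT (fun x : HN R N => (\1_B x)%:E : \bar R).
  exact/measurable_EFinP/measurable_indic.
have mPB : measurable_fun setT (fun z => (\1_B (Phi z))%:E : \bar R).
  exact: measurableT_comp mi mPhi.
have nuE v : (nu [set e | B (Phi (v, e))] =
    fubini_F nu (fun z => (\1_B (Phi z))%:E) v)%E.
  have mB' : measurable [set e : noise R | B (Phi (v, e))].
    rewrite -[[set e | _]]setTI.
    by have := measurable_fun_pair2 v mPhi; apply.
  by rewrite /fubini_F (integral_indic nu measurableT mB') setIT.
under eq_integral do rewrite nuE.
rewrite (@ge0_integral_pushforward _ _ _ _ _ _ mL nu setT)//; last 2 first.
- by apply: measurable_fun_fubini_tonelli_F => // z; rewrite lee_fin.
- by move=> v _; apply: integral_ge0 => e _; rewrite lee_fin.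
have mLB : measurable (limit_map u @^-1` B).
  by rewrite -[_ @^-1` _]setTI; exact: (mL).
pose f (z : noise R * noise R) : \bar R := (\1_B (Phi (limit_map u z.2, z.1)))%:E.
have mf : measurable_fun setT f.
  exact: measurableT_comp mi (measurable_step mL).
have := ge0_integral_halves (f := f) nug mf.
move=> /(_ (fun z => _)) <-; last by move=> z; rewrite lee_fin.
transitivity (\int[nu]_e (\1_B (limit_map u e))%:E)%E; last first.
  by rewrite (integral_indic nu measurableT mLB) setIT.
apply: ge0_ae_eq_integral => //.
- exact: measurableT_comp mf (@measurable_halves R).
- exact: measurableT_comp mi mL.
- by move=> e _; rewrite lee_fin.
- apply: filterS (limit_map_fixed ua) => e he _.
  by rewrite /f/= he.
Qed.

End iterated_maps.

(** * The four-linear integral form on functions with integrable fourth power *)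

Section quartic_form.
Context d (T : measurableType d) (R : realType).
Variable mu : probability T R.

Lemma integrable_axpy (c : R) (f g : T -> R) :
  mu.-integrable setT (EFin \o f) -> mu.-integrable setT (EFin \o g) ->
  mu.-integrable setT (EFin \o (fun x => f x + c * g x)).
Proof. by move=> if_ ig; exact: integrableD if_ (integrableZl _ _ ig). Qed.

Lemma Rintegral_axpy (c : R) (f g : T -> R) :
  mu.-integrable setT (EFin \o f) -> mu.-integrable setT (EFin \o g) ->
  \int[mu]_x (f x + c * g x) = \int[mu]_x f x + c * \int[mu]_x g x.
Proof.
by move=> if_ ig; rewrite RintegralD ?RintegralZl//; exact: integrableZl ig.
Qed.

Definition integrable4 (f : T -> R) : Prop :=
  measurable_fun setT f /\ mu.-integrable setT (fun x => (f x ^+ 4)%:E).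

Lemma pow4_ge0 (x : R) : 0 <= x ^+ 4.
Proof. by rewrite (exprM x 2 2) sqr_ge0. Qed.

(** The absolute product is at most the sum of the four fourth powers; the sum of squares in the
    proof certifies this inequality. *)
Lemma integrable4_mul f g h k :
  integrable4 f -> integrable4 g -> integrable4 h -> integrable4 k ->
  mu.-integrable setT (EFin \o (fun x => f x * g x * h x * k x)).
Proof.
move=> [mf if_] [mg ig] [mh ih] [mk ik].
have I : mu.-integrable setT
    (fun x => (f x ^+ 4 + g x ^+ 4 + (h x ^+ 4 + k x ^+ 4))%:E) :=
  integrableD measurableT (integrableD measurableT if_ ig)
    (integrableD measurableT ih ik).
apply: le_integrable I => //.
  by apply/measurable_EFinP; do !apply: measurable_funM.
move=> x _ /=; rewrite lee_fin.
rewrite (ger0_norm (_ : 0 <= f x ^+ 4 + g x ^+ 4 + (h x ^+ 4 + k x ^+ 4))); last first.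
  by rewrite !addr_ge0 ?pow4_ge0.
rewrite !normrM.
have e4 (y : R) : y ^+ 4 = (`|y| ^+ 2) ^+ 2.
  by rewrite real_normK ?num_real// -exprM.
rewrite !e4; move: (`|f x|) (`|g x|) (`|h x|) (`|k x|) => a b c e.
rewrite -subr_ge0.
have -> : (a ^+ 2) ^+ 2 + (b ^+ 2) ^+ 2 + ((c ^+ 2) ^+ 2 + (e ^+ 2) ^+ 2) -
    a * b * c * e =
  2^-1 * (a * b - c * e) ^+ 2 + 4^-1 * (a ^+ 2 - b ^+ 2) ^+ 2 +
  4^-1 * (c ^+ 2 - e ^+ 2) ^+ 2 + 3 / 4 * ((a ^+ 2) ^+ 2 + (b ^+ 2) ^+ 2 +
    (c ^+ 2) ^+ 2 + (e ^+ 2) ^+ 2) by field.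
by rewrite !addr_ge0// mulr_ge0 ?sqr_ge0// !addr_ge0 ?sqr_ge0.
Qed.

Lemma integrable4_cst (c : R) : integrable4 (fun=> c).
Proof.
split=> //; apply/integrableP; split=> //.
by rewrite integral_cst//= probability_setT mule1 ltry.
Qed.

Lemma integrable4D f g : integrable4 f -> integrable4 g ->
  integrable4 (fun x => f x + g x).
Proof.
move=> [mf if_] [mg ig]; split; first exact: measurable_funD.
have I : mu.-integrable setT (fun x => (8 * (f x ^+ 4 + g x ^+ 4))%:E) :=
  integrableZl measurableT 8 (integrableD measurableT if_ ig).
apply: le_integrable I => //.
  by apply/measurable_EFinP; apply: measurable_funX; exact: measurable_funD.
move=> x _ /=; rewrite lee_fin.
rewrite (ger0_norm (pow4_ge0 _)) ger0_norm; last first.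
  by rewrite mulr_ge0 ?addr_ge0 ?pow4_ge0.
move: (f x) (g x) => a b.
have -> : 8 * (a ^+ 4 + b ^+ 4) = (a + b) ^+ 4 +
    (a - b) ^+ 2 * (6 * (a + b) ^+ 2 + (a - b) ^+ 2) by ring.
rewrite lerDl mulr_ge0 ?sqr_ge0// addr_ge0 ?sqr_ge0//.
by rewrite mulr_ge0 ?sqr_ge0.
Qed.

Lemma integrable4Z (c : R) f : integrable4 f -> integrable4 (fun x => c * f x).
Proof.
move=> [mf if_]; split; first exact: measurable_funM.
have := integrableZl measurableT (c ^+ 4) if_.
by under eq_fun do rewrite -EFinM -exprMn.
Qed.

Lemma integrable4_sum n (V : 'I_n -> R) (phi : 'I_n -> T -> R) :
  (forall k, integrable4 (phi k)) ->
  integrable4 (fun x => \sum_(k < n) V k * phi k x).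
Proof.
elim: n V phi => [|n IH] V phi Hphi.
  by under eq_fun do rewrite big_ord0; exact: integrable4_cst.
under eq_fun do rewrite big_ord_recr/=.
by apply: integrable4D; [exact: IH|exact: integrable4Z].
Qed.

(** The cubic term, the quartic energy and, with two factors equal to 1, the linear term of the
    scheme are all values of this form, so integrability and linearity are settled once. *)
Definition quart (f g h k : T -> R) : R := \int[mu]_x (f x * g x * h x * k x).

Lemma quart_suml n (V : 'I_n -> R) (phi : 'I_n -> T -> R) g h k :
  (forall i, integrable4 (phi i)) ->
  integrable4 g -> integrable4 h -> integrable4 k ->
  quart (fun x => \sum_(i < n) V i * phi i x) g h k =
  \sum_(i < n) V i * quart (phi i) g h k.
Proof.
move=> Hphi Hg Hh Hk; elim: n V phi Hphi => [|n IH] V phi Hphi.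
  rewrite big_ord0 /quart; under eq_Rintegral do rewrite big_ord0 !mul0r.
  by rewrite Rintegral_cst// mul0r.
rewrite big_ord_recr/= -IH//.
have Hs := integrable4_sum (fun i => V (widen_ord (leqnSn n) i))
  (fun i => Hphi (widen_ord (leqnSn n) i)).
rewrite /quart -RintegralZl//; last exact: integrable4_mul.
rewrite -RintegralD//.
- by apply: eq_Rintegral => x _; rewrite big_ord_recr/=; ring.
- exact: (integrable4_mul Hs Hg Hh Hk).
- have := integrable4_mul (integrable4Z (V ord_max) (Hphi ord_max)) Hg Hh Hk.
  by congr (integrable _ _ _); apply/funext => x /=; congr _%:E; ring.
Qed.

Lemma quart_perm f g h k f' g' h' k' :
  (forall x, f x * g x * h x * k x = f' x * g' x * h' x * k' x) ->
  quart f g h k = quart f' g' h' k'.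
Proof. by move=> e; apply: eq_Rintegral => x _. Qed.

End quartic_form.

(** * The cubic nonlinearity on the Galerkin space: monotonicity and potential *)

Section galerkin.
Context d (T : measurableType d) (R : realType).
Variables (mu : probability T R) (n : nat) (phi : 'I_n -> T -> R).
Hypothesis phi4 : forall k, integrable4 mu (phi k).

Definition synth (V : 'rV[R]_n) (x : T) : R := \sum_(k < n) V ord0 k * phi k x.

Lemma synth4 V : integrable4 mu (synth V).
Proof. exact: integrable4_sum. Qed.

(** The [j]-th coefficient of the cube of [synth V], and a quarter of the partial derivative of
    [quartic] in direction [j]. *)
Definition cubic (V : 'rV[R]_n) (j : 'I_n) : R :=
  quart mu (synth V) (synth V) (synth V) (phi j).

Definition quartic (V : 'rV[R]_n) : R :=
  quart mu (synth V) (synth V) (synth V) (synth V).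

Lemma cubic_pairing (V Z : 'rV[R]_n) : \sum_(j < n) Z ord0 j * cubic V j =
  quart mu (synth V) (synth V) (synth V) (synth Z).
Proof.
rewrite (quart_perm mu (f' := synth Z) (g' := synth V) (h' := synth V)
  (k' := synth V)); last by move=> x; ring.
rewrite quart_suml//; try exact: synth4.
by apply: eq_bigr => j _; congr (_ * _); apply: quart_perm => x; ring.
Qed.

Lemma quartic_ge0 V : 0 <= quartic V.
Proof.
apply: Rintegral_ge0 => x _.
have -> : synth V x * synth V x * synth V x * synth V x = synth V x ^+ 4 by ring.
exact: pow4_ge0.
Qed.

Lemma continuous_coord (i : 'I_n) : continuous (fun V : 'rV[R]_n => V ord0 i : R).
Proof. exact: coord_continuous. Qed.

Lemma continuous_sum_coord m (F : 'I_m -> 'rV[R]_n -> R) :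
  (forall i, continuous (F i)) -> continuous (fun V => \sum_(i < m) F i V).
Proof.
move=> cF; apply: continuous_big => [|i _]; first exact: add_continuous.
exact: cF.
Qed.

Lemma continuous_mul (F G : 'rV[R]_n -> R) :
  continuous F -> continuous G -> continuous (fun V => F V * G V).
Proof. by move=> cF cG V; exact: (cvgM (cF V) (cG V)). Qed.

(** Expanding the three copies of [synth V] gives a polynomial in the coordinates; each copy is
    moved in turn to the first slot, where [quart_suml] acts. *)
Lemma continuous_cubic j : continuous (fun V => cubic V j).
Proof.
have -> : (fun V => cubic V j) = (fun V => \sum_(a < n) V ord0 a *
    \sum_(b < n) V ord0 b * \sum_(c < n) V ord0 c *
      quart mu (phi c) (phi b) (phi a) (phi j)).
  apply/funext => V; have V4 := synth4 V.
  rewrite /cubic quart_suml//; apply: eq_bigr => a _; congr (_ * _).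
  rewrite (quart_perm mu (f' := synth V) (g' := synth V) (h' := phi a)
    (k' := phi j)); last by move=> x; ring.
  rewrite quart_suml//; apply: eq_bigr => b _; congr (_ * _).
  rewrite (quart_perm mu (f' := synth V) (g' := phi b) (h' := phi a)
    (k' := phi j)); last by move=> x; ring.
  by rewrite quart_suml.
apply: continuous_sum_coord => a; apply: continuous_mul.
  exact: continuous_coord.
apply: continuous_sum_coord => b; apply: continuous_mul.
  exact: continuous_coord.
apply: continuous_sum_coord => c; apply: continuous_mul.
  exact: continuous_coord.
exact: cst_continuous.
Qed.

Lemma continuous_quartic : continuous quartic.
Proof.
have -> : quartic = (fun V => \sum_(j < n) V ord0 j * cubic V j).
  by apply/funext => V; rewrite cubic_pairing.
apply: continuous_sum_coord => j; apply: continuous_mul.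
  exact: continuous_coord.
exact: continuous_cubic.
Qed.

(** The pairing is the integral of [(a - b) * (a ^+ 3 - b ^+ 3)], which is nonnegative pointwise. *)
Lemma cubic_monotone (V Z : 'rV[R]_n) :
  0 <= \sum_(j < n) (V ord0 j - Z ord0 j) * (cubic V j - cubic Z j).
Proof.
have -> : \sum_(j < n) (V ord0 j - Z ord0 j) * (cubic V j - cubic Z j) =
    (\sum_(j < n) V ord0 j * cubic V j - \sum_(j < n) V ord0 j * cubic Z j) -
    (\sum_(j < n) Z ord0 j * cubic V j - \sum_(j < n) Z ord0 j * cubic Z j).
  by rewrite -!sumrB; apply: eq_bigr => j _; ring.
rewrite !cubic_pairing.
have V4 := synth4 V; have Z4 := synth4 Z.
have -> : quart mu (synth V) (synth V) (synth V) (synth V) -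
    quart mu (synth Z) (synth Z) (synth Z) (synth V) -
    (quart mu (synth V) (synth V) (synth V) (synth Z) -
     quart mu (synth Z) (synth Z) (synth Z) (synth Z)) =
  quart mu (synth V) (synth V) (synth V) (synth V) +
    -1 * quart mu (synth Z) (synth Z) (synth Z) (synth V) +
    -1 * quart mu (synth V) (synth V) (synth V) (synth Z) +
    1 * quart mu (synth Z) (synth Z) (synth Z) (synth Z) by ring.
rewrite /quart; do !rewrite -Rintegral_axpy;
  do ?apply: integrable_axpy; do ?exact: integrable4_mul.
apply: Rintegral_ge0 => x _; move: (synth V x) (synth Z x) => a b.
have -> : a * a * a * a + -1 * (b * b * b * a) + -1 * (a * a * a * b) +
    1 * (b * b * b * b) =
  (a - b) ^+ 2 * ((a ^+ 2 + b ^+ 2 + (a + b) ^+ 2) / 2) by field.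
by rewrite mulr_ge0 ?sqr_ge0// divr_ge0// !addr_ge0 ?sqr_ge0.
Qed.

(** A second order expansion in place of derivatives: the coefficient of [t] is exact, and on the
    unit interval the higher powers are absorbed into [t ^+ 2 * c]. *)
Lemma quartic_increment (V Z : 'rV[R]_n) : exists c, forall t : R, `|t| <= 1 ->
  quartic (V + t *: Z) <=
  quartic V + 4 * t * (\sum_(j < n) Z ord0 j * cubic V j) + t ^+ 2 * c.
Proof.
have V4 := synth4 V; have Z4 := synth4 Z; have C4 := integrable4_cst mu 1.
pose A := synth V; pose B := synth Z.
exists (6 * quart mu A A B B + 4 * `|quart mu A B B B| + quartic Z) => t t1.
rewrite cubic_pairing.
have -> : quartic (V + t *: Z) = quartic V + 4 * t * quart mu A A A B +
    6 * t ^+ 2 * quart mu A A B B + 4 * t ^+ 3 * quart mu A B B B +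
    t ^+ 4 * quartic Z.
  rewrite /quartic -/A -/B /quart; do !rewrite -Rintegral_axpy;
    do ?apply: integrable_axpy; do ?exact: integrable4_mul.
  apply: eq_Rintegral => x _.
  have -> : synth (V + t *: Z) x = A x + t * B x.
    rewrite /A /B /synth mulr_sumr -big_split/=; apply: eq_bigr => k _.
    by rewrite !mxE; ring.
  by ring.
rewrite -/A -/B -!addrA lerD2l lerD2l.
have t2 : t ^+ 2 <= 1 by rewrite -real_normK ?num_real// expr_le1.
have h1 : t ^+ 3 * quart mu A B B B <= t ^+ 2 * `|quart mu A B B B|.
  rewrite exprSr -mulrA; apply: ler_wpM2l; first exact: sqr_ge0.
  apply: le_trans (ler_norm _) _; rewrite normrM.
  by rewrite -[leRHS]mul1r; apply: ler_wpM2r.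
have h2 : t ^+ 4 * quartic Z <= t ^+ 2 * quartic Z.
  apply: ler_wpM2r; first exact: quartic_ge0.
  by rewrite (exprM t 2 2) expr2 -[leRHS]mul1r; apply: ler_wpM2r => //; exact: sqr_ge0.
by lra.
Qed.

End galerkin.

(** * Borel sets of row vectors seen on tuples *)

Section tuple_topology.
Variables (R : realType) (n : nat).

Definition row_of_tuple (c : n.-tuple (measurableTypeR R)) : 'rV[R]_n :=
  \row_j tnth c j.
Definition tuple_of_row (V : 'rV[R]_n) : n.-tuple (measurableTypeR R) :=
  [tuple V ord0 j | j < n].

Lemma row_of_tupleK : cancel row_of_tuple tuple_of_row.
Proof.
by move=> c; apply: eq_from_tnth => j; rewrite tnth_mktuple mxE.
Qed.

Lemma tuple_of_rowK : cancel tuple_of_row row_of_tuple.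
Proof. by move=> V; apply/rowP => j; rewrite mxE tnth_mktuple. Qed.

Let box (p : 'rV[rat]_n * nat) : set 'rV[R]_n :=
  [set V | forall j, `|V ord0 j - ratr (p.1 ord0 j)| < p.2.+1%:R^-1].

Let measurable_box p : measurable (row_of_tuple @^-1` box p).
Proof.
rewrite (_ : _ @^-1` _ = \bigcap_(j in [set: 'I_n])
    ((fun c : n.-tuple (measurableTypeR R) => tnth c j) @^-1`
      `](ratr (p.1 ord0 j) - p.2.+1%:R^-1), (ratr (p.1 ord0 j) + p.2.+1%:R^-1)[)).
  apply: fin_bigcap_measurable => // j _; rewrite -[_ @^-1` _]setTI.
  by apply: measurable_tnth => //; exact: measurable_itv.
apply/seteqP; split=> c /= h j => [_|].
  by have := h j; rewrite mxE ltr_distl /= in_itv.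
by have := h j I; rewrite /= in_itv/= mxE ltr_distl.
Qed.

(** The topology is taken on row vectors and the sigma-algebra on tuples. An open set is the union
    of the rational boxes inside it, which are countably many and measurable. *)
Lemma measurable_open_rows (U : set 'rV[R]_n) : open U ->
  measurable (row_of_tuple @^-1` U).
Proof.
move=> oU; pose F (m : nat) : set 'rV[R]_n :=
  if unpickle m is Some p then (if `[< box p `<=` U >] then box p else set0)
  else set0.
have -> : U = \bigcup_m F m.
  apply/seteqP; split=> V; last first.
    move=> [m _]; rewrite /F; case: (unpickle m) => // p.
    by case: asboolP => // + Vp; apply.
  move=> UV; have : nbhs V U by exact: open_nbhs_nbhs.
  move=> /nbhs_ballP[e /= e0 VU].
  have [k ke] : exists k : nat, k.+1%:R^-1 < e / 2.
    have := @cvg_harmonic R; move/cvgr_lt => /(_ (e / 2)).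
    by rewrite divr_gt0// => /(_ isT)[k _ /(_ k (leqnn k))]; exists k.
  have H (j : 'I_n) : exists r : rat, `|V ord0 j - ratr r| < k.+1%:R^-1.
    have lt : V ord0 j - k.+1%:R^-1 < V ord0 j + k.+1%:R^-1.
      by rewrite ltrD2l gt0_cp// invr_gt0.
    have [r] := rat_in_itvoo lt; rewrite in_itv/= => /andP[h1 h2].
    by exists r; rewrite ltr_distlC h1 h2.
  pose p : 'rV[rat]_n * nat := (\row_j sval (cid (H j)), k).
  have pU : box p `<=` U.
    move=> Z Zp; apply: VU; split=> // i j; rewrite (ord1 i).
    rewrite /ball/= /ball_.
    have := Zp j; rewrite /p/= mxE; case: (cid (H j)) => r /= hr hZ.
    have -> : V ord0 j - Z ord0 j = (V ord0 j - ratr r) - (Z ord0 j - ratr r).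
      by ring.
    apply: le_lt_trans (ler_normB _ _) _; rewrite (splitr e).
    by apply: ltrD; apply: lt_trans ke.
  exists (pickle p) => //; rewrite /F pickleK; case: asboolP => // _ j.
  by rewrite /p/= mxE; case: (cid (H j)).
rewrite preimage_bigcup; apply: bigcup_measurable => m _.
rewrite /F; case: (unpickle m) => [p|]; last by rewrite preimage_set0.
by case: asboolP => _; rewrite ?preimage_set0//; exact: measurable_box.
Qed.

Lemma measurable_closed_rows (A : set 'rV[R]_n) : closed A ->
  measurable (row_of_tuple @^-1` A).
Proof.
move=> cA; rewrite -[A]setCK -preimage_setC; apply: measurableC.
by apply: measurable_open_rows; exact: closed_openC.
Qed.

End tuple_topology.

Lemma quadratic_ge0_linear0 (R : realFieldType) (l c : R) :
  (forall t, `|t| <= 1 -> 0 <= t * l + t ^+ 2 * c) -> l = 0.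
Proof.
move=> h; apply/eqP/negPn/negP => l0.
(* The test point is [t = - l / m]: [m] exceeds the modulus of [l], which puts [t] in the allowed
   range, and that of [c], which makes the linear term win. *)
pose m := `|c| + `|l| + 1.
have m0 : 0 < m by rewrite ltr_wpDl// addr_ge0.
have := h (- l / m); rewrite normrM normrN normfV (gtr0_norm m0).
have -> : `|l| / m <= 1.
  by rewrite ler_pdivrMr// mul1r /m -addrA addrCA lerDl addr_ge0.
move=> /(_ isT).
have -> : - l / m * l + (- l / m) ^+ 2 * c = (l ^+ 2 / m ^+ 2) * (c - m).
  by field; rewrite gt_eqF.
have lm : 0 < l ^+ 2 / m ^+ 2.
  by apply: divr_gt0; [rewrite exprn_even_gt0|exact: exprn_gt0].
rewrite (pmulr_rge0 _ lm).
apply/negP; rewrite -ltNge subr_lt0 /m.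
by have := ler_norm c; have := normr_ge0 l; lra.
Qed.

(** Twice the modulus of [x - y] is at most [(x - y) ^+ 2 + 1]; the resulting bound [1 + b] does
    without a square root. *)
Lemma near_of_sqr_le (R : realFieldType) (x y b : R) : (x - y) ^+ 2 <= b ->
  y - (1 + b) <= x <= y + (1 + b).
Proof.
move=> sq; have := sqr_ge0 (x - y - 1); have := sqr_ge0 (x - y + 1).
rewrite (_ : (x - y + 1) ^+ 2 = (x - y) ^+ 2 + 2 * (x - y) + 1); last by ring.
rewrite (_ : (x - y - 1) ^+ 2 = (x - y) ^+ 2 - 2 * (x - y) + 1); last by ring.
have := sqr_ge0 (x - y); move: sq; move: ((x - y) ^+ 2) => s.
by move=> *; apply/andP; split; lra.
Qed.

(** * Unique solvability of the implicit step and measurability of its solution *)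

Section implicit_step.
Context d (T : measurableType d) (R : realType).
Variables (mu : probability T R) (N : nat) (phi : 'I_N.+1 -> T -> R).
Hypothesis phi4 : forall k, integrable4 mu (phi k).
Variables (lam : 'I_N.+1 -> R) (l1 tau : R).
Hypothesis lam0 : lam ord0 = 0.
Hypothesis lam_ge : forall j, j != ord0 -> l1 <= lam j.
Hypothesis l1_gt1 : 1 < l1.
Hypothesis tau0 : 0 < tau.

(** The implicit side of the scheme, which reads [resid V = u + noise]; [cubic - V] collects the
    coefficients of the nonlinearity. *)
Definition resid (V : 'rV[R]_N.+1) (j : 'I_N.+1) : R :=
  V ord0 j + tau * lam j ^+ 2 * V ord0 j
  + tau * lam j * (cubic mu phi V j - V ord0 j).

Definition weight (j : 'I_N.+1) : R := if j == ord0 then 1 else (lam j)^-1.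

Let lam_gt1 j : j != ord0 -> 1 < lam j.
Proof. by move=> /lam_ge; exact: lt_le_trans. Qed.

Let lam_gt0 j : j != ord0 -> 0 < lam j.
Proof. by move=> /lam_gt1; apply: lt_trans. Qed.

Lemma weight_gt0 j : 0 < weight j.
Proof. by rewrite /weight; case: eqVneq => // /lam_gt0 ?; rewrite invr_gt0. Qed.

Lemma resid0 V : resid V ord0 = V ord0 ord0.
Proof. by rewrite /resid lam0 expr0n/= !mulr0 !mul0r !addr0. Qed.

(* Testing the difference of two steps with itself in H^{-1}: the cubic term is
   monotone, and the loss from -u is absorbed by the H^1 norm because
   lam_j (lam_j - 1) >= l1 (l1 - 1) for all nonzero modes. *)
Lemma resid_expansive (V Z : 'rV[R]_N.+1) : V ord0 ord0 = Z ord0 ord0 ->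
  (1 + 2 * tau * (l1 * (l1 - 1))) *
    (\sum_(j < N.+1) weight j * (V ord0 j - Z ord0 j) ^+ 2) <=
  \sum_(j < N.+1) weight j * (resid V j - resid Z j) ^+ 2.
Proof.
move=> VZ0; rewrite -subr_ge0 mulr_sumr -sumrB.
have := cubic_monotone phi4 V Z => mono.
apply: (@le_trans _ _ (2 * tau * \sum_(j < N.+1)
    (V ord0 j - Z ord0 j) * (cubic mu phi V j - cubic mu phi Z j))).
  by rewrite !mulr_ge0// ltW.
rewrite mulr_sumr; apply: ler_sum => j _.
rewrite /weight; case: eqVneq => [->|j0].
  by rewrite VZ0 !resid0 VZ0 subrr expr0n/= !mulr0 mul0r mulr0 subrr.
have L0 := lam_gt0 j0; have L1 := lam_ge j0.
rewrite /resid; move: (V ord0 j : R) (Z ord0 j : R) => v z.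
move: (cubic mu phi V j) (cubic mu phi Z j) => a b; move: L0 L1.
move: (lam j) => l L0 L1; rewrite -subr_ge0.
(* The residual difference is [(v - z) + tau * r]. The square of [tau * r] stays as a nonnegative
   remainder; the cross term yields the cubic pairing and the gap [l * (l - 1) - l1 * (l1 - 1)],
   which factors. *)
pose r := (l ^+ 2 * (v - z) + l * (a - b - (v - z))).
have -> : l^-1 * (v + tau * l ^+ 2 * v + tau * l * (a - v) -
     (z + tau * l ^+ 2 * z + tau * l * (b - z))) ^+ 2 -
   (1 + 2 * tau * (l1 * (l1 - 1))) * (l^-1 * (v - z) ^+ 2) -
   2 * tau * ((v - z) * (a - b)) =
   l^-1 * (tau * r) ^+ 2 +
   2 * tau * l^-1 * ((l - l1) * (l + l1 - 1)) * (v - z) ^+ 2.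
  by rewrite /r; field; rewrite gt_eqF.
have li : 0 <= l^-1 by rewrite invr_ge0 ltW.
apply: addr_ge0; first by rewrite mulr_ge0 ?sqr_ge0.
apply: mulr_ge0; last exact: sqr_ge0.
apply: mulr_ge0; first by rewrite !mulr_ge0// ltW.
by rewrite mulr_ge0 ?subr_ge0// ler_wpDl// ltW.
Qed.

Lemma resid_inj V Z : (forall j, resid V j = resid Z j) -> V = Z.
Proof.
move=> h; have VZ0 : V ord0 ord0 = Z ord0 ord0 by rewrite -!resid0.
have := resid_expansive VZ0.
rewrite [X in _ <= X]big1; last by move=> j _; rewrite h subrr expr0n mulr0.
have k0 : 0 < 1 + 2 * tau * (l1 * (l1 - 1)).
  have l10 : 0 <= l1 by apply: ltW; exact: lt_trans l1_gt1.
  by rewrite ltr_wpDr// !mulr_ge0// ?subr_ge0; exact: ltW.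
rewrite (pmulr_rle0 _ k0) => s0; apply/rowP => j; apply/eqP.
rewrite -subr_eq0 -sqrf_eq0 -(mulrI_eq0 _ (lregP (lt0r_neq0 (weight_gt0 j)))).
have pos i : 0 <= weight i * (V ord0 i - Z ord0 i) ^+ 2.
  by rewrite mulr_ge0 ?sqr_ge0// ltW// weight_gt0.
rewrite eq_le pos andbT; apply: le_trans s0.
by rewrite (bigD1 j)//= lerDl sumr_ge0.
Qed.

(** One mode of the minimizing movement: up to a constant, half the squared [H^{-1}] distance to
    [eta] plus [tau] times the quadratic part of the double-well energy, [lam j - 1] joining the
    Dirichlet term and the concave one. The zero mode is prescribed and contributes nothing. *)
Let energy1 (eta : 'rV[R]_N.+1) (j : 'I_N.+1) (x : R) : R :=
  if j == ord0 then 0 else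
  (lam j)^-1 * 2^-1 * x ^+ 2 + tau / 2 * (lam j - 1) * x ^+ 2 -
  eta ord0 j / lam j * x.

Let energy eta (V : 'rV[R]_N.+1) : R :=
  \sum_(j < N.+1) energy1 eta j (V ord0 j) + tau / 4 * quartic mu phi V.

Let continuous_energy eta : continuous (energy eta).
Proof.
have cst (c : R) : continuous (fun _ : 'rV[R]_N.+1 => c).
  exact: cst_continuous.
have cD (F G : 'rV[R]_N.+1 -> R) :
  continuous F -> continuous G -> continuous (fun V => F V + G V).
  by move=> cF cG V; exact: (cvgD (cF V) (cG V)).
have cc i : continuous (fun V : 'rV[R]_N.+1 => V ord0 i).
  exact: continuous_coord.
have sq i : continuous (fun V : 'rV[R]_N.+1 => V ord0 i ^+ 2).
  have -> : (fun V : 'rV[R]_N.+1 => V ord0 i ^+ 2) =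
      (fun V => V ord0 i * V ord0 i) by apply/funext => V; rewrite expr2.
  exact: continuous_mul.
apply: (cD); last by apply: continuous_mul => //; exact: (continuous_quartic phi4).
apply: continuous_sum_coord => i; rewrite /energy1.
case: (i == ord0); first exact: cst.
pose c1 := (lam i)^-1 * 2^-1 + tau / 2 * (lam i - 1).
pose c2 := - (eta ord0 i / lam i).
have -> : (fun V : 'rV[R]_N.+1 => (lam i)^-1 * 2^-1 * V ord0 i ^+ 2 +
     tau / 2 * (lam i - 1) * V ord0 i ^+ 2 - eta ord0 i / lam i * V ord0 i) =
   (fun V => c1 * V ord0 i ^+ 2 + c2 * V ord0 i).
  by apply/funext => V; move: (V ord0 i : R) => x; rewrite /c1 /c2; ring.
exact: (cD (fun V => c1 * V ord0 i ^+ 2) (fun V => c2 * V ord0 i)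
  (continuous_mul (cst c1) (sq i)) (continuous_mul (cst c2) (cc i))).
Qed.

(** Completing the square leaves [tau / 2 * (lam j - 1) * x ^+ 2], nonnegative because
    [lam j > 1]. *)
Let energy1_ge (eta : 'rV[R]_N.+1) (j : 'I_N.+1) (x : R) : j != ord0 ->
  (lam j)^-1 * 2^-1 * (x - eta ord0 j) ^+ 2 -
  (lam j)^-1 * 2^-1 * eta ord0 j ^+ 2 <= energy1 eta j x.
Proof.
move=> j0; rewrite /energy1 (negbTE j0) -subr_ge0.
have L0 := lam_gt0 j0; have L1 := lam_gt1 j0.
rewrite (_ : _ - _ = tau / 2 * (lam j - 1) * x ^+ 2); last first.
  by field; rewrite gt_eqF.
rewrite mulr_ge0 ?sqr_ge0// mulr_ge0 ?subr_ge0; [by []| |exact: ltW].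
by rewrite divr_ge0// ltW.
Qed.

Let half_sqr_ge0 j (x : R) : j != ord0 -> 0 <= (lam j)^-1 * 2^-1 * x ^+ 2.
Proof.
move=> /lam_gt0 L0; apply: mulr_ge0; last exact: sqr_ge0.
by apply: mulr_ge0; rewrite invr_ge0// ltW.
Qed.

(** Direct method: the energy attains its minimum among rows with the mean of [eta], and its first
    variation along a nonzero mode [j] is [(resid V j - eta ord0 j) / lam j]. *)
Lemma resid_surj (eta : 'rV[R]_N.+1) :
  exists V, forall j, resid V j = eta ord0 j.
Proof.
pose slice : set 'rV[R]_N.+1 := [set V | V ord0 ord0 = eta ord0 ord0].
pose E0 := energy eta eta.
pose K : set 'rV[R]_N.+1 := slice `&` [set V | energy eta V <= E0].
have clK : closed K.
  apply: closedI.
    have := @closed_comp _ _ (fun V : 'rV[R]_N.+1 => V ord0 ord0)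
      [set x : R | x = eta ord0 ord0].
    by apply; [move=> V _; exact: continuous_coord|exact: closed_eq].
  have := @closed_comp _ _ (energy eta) [set x : R | x <= E0].
  by apply; [move=> V _; exact: continuous_energy|exact: closed_le].
pose e0 i := if i == ord0 then 0 else (lam i)^-1 * 2^-1 * eta ord0 i ^+ 2.
have e00 i : 0 <= e0 i.
  by rewrite /e0; case: eqVneq => // i0; exact: half_sqr_ge0.
(* Every other mode has energy at least [- e0 i], so the square in mode [j] is controlled by the
   level plus all the [e0 i]; the factor [2 * lam j] undoes its coefficient. *)
pose a j := 2 * lam j * (E0 + \sum_i e0 i).
have bd V j : K V -> (eta ord0 j - (1 + a j)) <= V ord0 j <= eta ord0 j + (1 + a j).
  move=> [Vs VE]; have [->|j0] := eqVneq j ord0.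
    by rewrite Vs /a lam0 mulr0 mul0r addr0; apply/andP; split; lra.
  have L0 := lam_gt0 j0.
  have sq : (V ord0 j - eta ord0 j) ^+ 2 <= a j.
    rewrite /a -ler_pdivrMl; last by rewrite mulr_gt0.
    rewrite invfM mulrC -mulrA.
    have : energy eta V + \sum_i e0 i <= E0 + \sum_i e0 i by rewrite lerD2r.
    apply: le_trans; rewrite /energy addrAC -big_split/=.
    rewrite (bigD1 j)//= -!addrA.
    have h1 := energy1_ge eta (V ord0 j) j0.
    have h2 : 0 <= \sum_(i < N.+1 | i != j) (energy1 eta i (V ord0 i) + e0 i).
      apply: sumr_ge0 => i _; have [i0|i0] := eqVneq i ord0.
        by rewrite /energy1 i0 eqxx add0r.
      have := energy1_ge eta (V ord0 i) i0; rewrite /e0 (negbTE i0).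
      have := half_sqr_ge0 (V ord0 i - eta ord0 i) i0.
      move: (_ * _ * (_ - _) ^+ 2) (energy1 _ _ _) => p q p0 h.
      by rewrite -lerBlDr sub0r; apply: le_trans h; rewrite -lerBlDr opprK addNr.
    have h3 : 0 <= tau / 4 * quartic mu phi V.
      by rewrite mulr_ge0 ?quartic_ge0// divr_ge0// ltW.
    move: h1 h2 h3; rewrite /e0 (negbTE j0) -/e0.
    by lra.
  exact: near_of_sqr_le sq.
have cK : compact K.
  apply: (subclosed_compact clK (B := [set V : 'rV[R]_N.+1 | forall j,
    `[eta ord0 j - (1 + a j), eta ord0 j + (1 + a j)]%classic (V ord0 j)])).
    apply: (@rV_compact _ _ (fun j =>
      `[eta ord0 j - (1 + a j), eta ord0 j + (1 + a j)]%classic)) => j.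
    exact: segment_compact.
  by move=> V KV j /=; rewrite in_itv/=; exact: bd.
have Keta : K eta by split=> //; exact: lexx.
have [V /set_mem[Vs VE0] VminK] :
    exists2 V, V \in K & forall Z, Z \in K -> energy eta V <= energy eta Z.
  apply: compact_EVT_min => //; first by exists eta.
  by apply: continuous_subspaceT; exact: continuous_energy.
have Vmin Z : slice Z -> energy eta V <= energy eta Z.
  move=> Zs; have [ZE|ZE] := leP (energy eta Z) E0.
    by apply: VminK; apply: mem_set; split.
  exact: le_trans VE0 (ltW ZE).
exists V => j; have [->|j0] := eqVneq j ord0; first by rewrite resid0.
(* A variation along a nonzero mode keeps the mean, hence stays in the slice where [V] is
   minimal. *)
have [c hc] := quartic_increment phi4 V (delta_mx ord0 j).
have L0 := lam_gt0 j0.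
pose l := (lam j)^-1 * V ord0 j + tau * (lam j - 1) * V ord0 j -
  eta ord0 j / lam j + tau * cubic mu phi V j.
have l0 : l = 0.
  apply: (@quadratic_ge0_linear0 _ _
    ((lam j)^-1 * 2^-1 + tau / 2 * (lam j - 1) + tau / 4 * c)) => t t1.
  have := hc t t1; set V' := V + _.
  have -> : \sum_(k < N.+1) (delta_mx ord0 j : 'rV[R]_N.+1) ord0 k *
      cubic mu phi V k = cubic mu phi V j.
    rewrite (bigD1 j)//= mxE !eqxx mul1r big1 ?addr0// => k kj.
    by rewrite mxE (negbTE kj) andbF mul0r.
  have V'k k : V' ord0 k = if k == j then V ord0 j + t else V ord0 k.
    rewrite !mxE eqxx/=; case: eqVneq => [->|_]; first by rewrite mulr1.
    by rewrite mulr0 addr0.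
  have le : energy eta V <= energy eta V'.
    apply: Vmin; rewrite /slice/= V'k eq_sym (negbTE j0); exact: Vs.
  pose s := \sum_(k < N.+1 | k != j) energy1 eta k (V ord0 k).
  have EV : energy eta V =
      energy1 eta j (V ord0 j) + s + tau / 4 * quartic mu phi V.
    by rewrite /energy (bigD1 j).
  have EV' : energy eta V' =
      energy1 eta j (V ord0 j + t) + s + tau / 4 * quartic mu phi V'.
    rewrite /energy (bigD1 j)//= V'k eqxx; congr (_ + _ + _).
    by apply: eq_bigr => k kj; rewrite V'k (negbTE kj).
  move: le; rewrite EV EV' /energy1 (negbTE j0) /l.
  have t4 : 0 <= tau / 4 by rewrite divr_ge0// ltW.
  move: (V ord0 j : R) (eta ord0 j : R) => x y {EV EV'}.
  move: (quartic _ _ V') (quartic _ _ V) (cubic _ _ _ _) s (lam j) (lam j)^-1.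
  move=> q' q b s L Li h1 /(ler_wpM2l t4) h2.
  rewrite -subr_ge0 in h1; rewrite -subr_ge0 in h2.
  apply: le_trans (addr_ge0 h1 h2) _.
  rewrite le_eqVlt; apply/orP; left; apply/eqP.
  by field.
have : lam j * l = 0 by rewrite l0 mulr0.
rewrite /l /resid => h; apply/eqP; rewrite -subr_eq0 -h; apply/eqP.
move: (V ord0 j : R) (eta ord0 j : R) => x y.
by field; rewrite gt_eqF.
Qed.

Let continuous_resid j : continuous (fun V => resid V j).
Proof.
have cst (c : R) : continuous (fun _ : 'rV[R]_N.+1 => c).
  exact: cst_continuous.
have cc : continuous (fun V : 'rV[R]_N.+1 => V ord0 j).
  exact: continuous_coord.
have -> : (fun V => resid V j) = (fun V : 'rV[R]_N.+1 =>
    (1 + tau * lam j ^+ 2 - tau * lam j) * V ord0 j +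
    tau * lam j * cubic mu phi V j).
  apply/funext => V; rewrite /resid; move: (V ord0 j : R) => x; ring.
pose F (V : 'rV[R]_N.+1) := (1 + tau * lam j ^+ 2 - tau * lam j) * V ord0 j.
pose G V := tau * lam j * cubic mu phi V j.
have cF : continuous F := continuous_mul (cst _) cc.
have cG : continuous G := continuous_mul (cst _) (@continuous_cubic _ _ _ _ _ _ phi4 j).
by move=> V; exact: (cvgD (cF V) (cG V)).
Qed.

Let residmx (V : 'rV[R]_N.+1) : 'rV[R]_N.+1 := \row_j resid V j.

Let continuous_residmx : continuous residmx.
Proof.
have -> : residmx = (fun V => \sum_(j < N.+1) resid V j *: delta_mx ord0 j).
  apply/funext => V; rewrite [LHS]row_sum_delta.
  by apply: eq_bigr => j _; rewrite mxE.
apply: continuous_big => [|j _]; first exact: add_continuous.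
have cr := @continuous_resid j.
move=> V; have := cr V; apply: cvgZr_tmp.
exact: nbhs_filter.
Qed.

Definition solve (eta : HN R N) : HN R N :=
  tuple_of_row (sval (cid (resid_surj (row_of_tuple eta)))).

Lemma resid_solve eta j : resid (row_of_tuple (solve eta)) j = tnth eta j.
Proof.
by rewrite /solve tuple_of_rowK; case: cid => V /= ->; rewrite mxE.
Qed.

Lemma solve_unique (eta V : HN R N) :
  (forall j, resid (row_of_tuple V) j = tnth eta j) -> V = solve eta.
Proof.
move=> h; apply: (can_inj (@row_of_tupleK R N.+1)); apply: resid_inj => j.
by rewrite h resid_solve.
Qed.

(** [resid_expansive] compares only rows of equal mean, so another route is taken: the data whose
    solution has [j]-th coordinate at least [r] form a countable union of images of compact sets
    under the continuous [residmx], hence of closed sets. *)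
Lemma measurable_solve : measurable_fun setT solve.
Proof.
apply/measurable_fun_tnthP => j.
apply: (measurability _ (RGenCInfty.measurableE R)) => _ [_ [r ->] <-].
rewrite setTI.
pose K (m : nat) : set 'rV[R]_N.+1 :=
  [set V | forall i, `[- m%:R, m%:R]%classic (V ord0 i)] `&`
  [set V | r <= V ord0 j].
have cK m : compact (K m).
  apply: compact_closedI.
    have cA (i : 'I_N.+1) : compact (`[- m%:R, m%:R]%classic : set R).
      exact: segment_compact.
    exact: rV_compact cA.
  have := @closed_comp _ _ (fun V : 'rV[R]_N.+1 => V ord0 j) [set x : R | r <= x].
  by apply; [move=> V _; exact: continuous_coord|exact: closed_ge].
have clK m : closed (residmx @` K m).
  apply: compact_closed; first exact: norm_hausdorff.
  apply: continuous_compact => //; apply: continuous_subspaceT.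
  exact: continuous_residmx.
rewrite (_ : _ @^-1` _ = \bigcup_m (@row_of_tuple R N.+1 @^-1` (residmx @` K m))).
  by apply: bigcup_measurable => m _; exact: measurable_closed_rows.
apply/seteqP; split=> eta /=.
  rewrite in_itv/= andbT => rj.
  pose b := \sum_(k < N.+1) `|tnth (solve eta) k|.
  exists (Num.truncn b).+1 => //; exists (row_of_tuple (solve eta)).
    split=> /= [i|]; last by rewrite mxE.
    rewrite in_itv/= -ler_norml mxE; apply: ltW.
    apply: le_lt_trans (truncnS_gt b).
    by rewrite /b (bigD1 i)//= lerDl sumr_ge0.
  by apply/rowP => i; rewrite !mxE resid_solve.
move=> [m _ [V [_ /= rV] Veta]]; rewrite in_itv/= andbT.
have -> : solve eta = tuple_of_row V; last by rewrite tnth_mktuple.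
apply/esym/solve_unique => i; rewrite tuple_of_rowK.
by have /rowP/(_ i) := Veta; rewrite !mxE.
Qed.

End implicit_step.

Lemma measurable_fun_nat_index d (T : measurableType d) d' (T' : measurableType d')
    (m : T -> nat) (F : nat -> T -> T') :
  (forall n, measurable (m @^-1` [set n])) ->
  (forall n, measurable_fun setT (F n)) ->
  measurable_fun setT (fun x => F (m x) x).
Proof.
move=> mm mF _ B mB; rewrite setTI.
rewrite (_ : _ @^-1` B = \bigcup_n (m @^-1` [set n] `&` F n @^-1` B)).
  apply: bigcup_measurable => n _; apply: measurableI => //.
  by rewrite -[_ @^-1` _]setTI; exact: mF.
apply/seteqP; split=> x /=; first by move=> Bx; exists (m x).
by move=> [n _ [-> ]].
Qed.

(** * Infinite linear combinations of the noise as measurable functions *)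

Section noise_integral.
Variables (R : realType) (nu : probability (noise R) R) (s : R).
Hypothesis s0 : 0 <= s.
Hypothesis second_moment : forall n b (c : nat -> R),
  (\int[nu]_e ((b + \sum_(k < n) c k * e k) ^+ 2)%:E
   <= (b ^+ 2 + s * \sum_(k < n) c k ^+ 2)%:E)%E.
Implicit Types (a : nat -> R) (e : noise R).

Definition tail a n : \bar R := (\sum_(n <= k <oo) (a k ^+ 2)%:E)%E.

Let psum a n e := \sum_(k < n) a k * e k.

Lemma tail_ge0 a n : (0 <= tail a n)%E.
Proof. by apply: nneseries_ge0 => k _ _; rewrite lee_fin sqr_ge0. Qed.

Let sum_le_tail a m n : ((\sum_(m <= k < n) a k ^+ 2)%:E <= tail a m)%E.
Proof.
by rewrite -sumEFin; apply: nneseries_lim_ge => k _ _; rewrite lee_fin sqr_ge0.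
Qed.

Lemma tail_anti a m n : (m <= n)%N -> (tail a n <= tail a m)%E.
Proof.
move=> mn; have p0 k : (0 <= (a k ^+ 2)%:E)%E by rewrite lee_fin sqr_ge0.
have := @nneseries_split _ (fun k => (a k ^+ 2)%:E) m (n - m) (fun k _ => p0 k).
rewrite /tail subnKC// => ->; apply: leeDr.
by rewrite sume_ge0.
Qed.

Let measurable_psum a n : measurable_fun setT (psum a n).
Proof.
apply: measurable_sum => k.
by apply: measurable_funM => //; exact: measurable_coord.
Qed.

Let psum_diff_le a m n : (m <= n)%N ->
  (\int[nu]_e ((psum a n e - psum a m e) ^+ 2)%:E <= s%:E * tail a m)%E.
Proof.
move=> mn; pose c k := if (k < m)%N then 0 else a k.
have split (F : nat -> R) :
    \sum_(k < n) F k = \sum_(k < m) F k + \sum_(m <= k < n) F k.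
  by rewrite -!(big_mkord xpredT F) -big_cat_nat.
have cE (F : R -> nat -> R) : (forall k, F 0 k = 0) ->
    \sum_(k < n) F (c k) k = \sum_(m <= k < n) F (a k) k.
  move=> F0; rewrite (split (fun k => F (c k) k)) big1 ?add0r.
    apply: eq_big_nat => k /andP[mk _]; by rewrite /c ltnNge mk.
  by move=> [k km] _ /=; rewrite /c km F0.
have := second_moment n 0 c.
rewrite expr0n/= add0r (cE (fun x _ => x ^+ 2)); last by move=> _; rewrite expr0n.
rewrite (eq_integral (fun e => ((psum a n e - psum a m e) ^+ 2)%:E)); last first.
  move=> e _; rewrite add0r (cE (fun x k => x * e k)); last by move=> k; rewrite mul0r.
  by rewrite /psum (split (fun k => a k * e k)) addrC addKr.
move=> /le_trans; apply; rewrite EFinM.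
by apply: lee_wpmul2l => //; exact: sum_le_tail.
Qed.

Let psum_dist_le a m n : (\int[nu]_e ((psum a n e - psum a m e) ^+ 2)%:E
  <= s%:E * (tail a m + tail a n))%E.
Proof.
have [mn|nm] := leqP m n.
  apply: le_trans (psum_diff_le a mn) _; apply: lee_wpmul2l => //.
  by rewrite leeDl// tail_ge0.
rewrite (eq_integral (fun e => ((psum a m e - psum a n e) ^+ 2)%:E)).
  apply: le_trans (psum_diff_le a (ltnW nm)) _; apply: lee_wpmul2l => //.
  by rewrite leeDr// tail_ge0.
by move=> e _; rewrite -sqrrN opprB.
Qed.

Definition tail_small a i n : bool := (tail a n <= (4^-1 ^+ i)%:E)%E.

(** The default 0 is reached only if no tail is small, which [l2] excludes; it keeps the index total
    for arbitrary coefficients. *)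
Definition trunc_index a i : nat :=
  if pselect (exists n, tail_small a i n) is left h then ex_minn h else 0.

(* The partial sums converge only in L^2; along the indices at which the tail of
   the squares drops below 4^-i they converge almost surely, and the indices
   depend measurably on the coefficients. *)
Definition wint a (e : noise R) : R :=
  limsup_fun (fun i e => psum a (trunc_index a i) e) e.

Definition l2 a := (tail a 0 < +oo)%E.

Let tail_trunc_index a i : l2 a -> (tail a (trunc_index a i) <= (4^-1 ^+ i)%:E)%E.
Proof.
move=> la; rewrite /trunc_index; case: pselect => [h|[]].
  by case: ex_minnP.
have p0 k : xpredT k -> (0 <= (a k ^+ 2)%:E)%E by rewrite lee_fin sqr_ge0.
have ct : tail a n @[n --> \oo] --> 0%E := nneseries_tail_cvg la p0.
have /fine_cvgP[fin c] := ct.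
have i0 : 0 < 4^-1 ^+ i :> R by rewrite exprn_gt0.
have [n _ hn] := filterI fin (cvgr_lt _ c _ i0).
have [f1 f2] := hn n (leqnn n).
by exists n; rewrite /tail_small -(fineK f1) lee_fin ltW.
Qed.

Let h4 i : (2^-1 ^+ i) ^+ 2 = 4^-1 ^+ i :> R.
Proof. by rewrite exprAC; congr (_ ^+ _); field. Qed.

Let half01 : 0 < (2^-1 : R) < 1.
Proof. by apply/andP; split; [rewrite invr_gt0|rewrite invf_lt1// ltr1n]. Qed.

Let nu1 : (nu setT <= 1)%E.
Proof. exact: probability_le1. Qed.

Lemma measurable_wint a : measurable_fun setT (wint a).
Proof. by apply: measurable_limsup_fun => i. Qed.

Let wint_cvg a : l2 a ->
  {ae nu, forall e, (fun i => psum a (trunc_index a i) e) @ \oo --> wint a e}.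
Proof.
move=> la; pose X i e := psum a (trunc_index a i) e.
have : {ae nu, forall e, cvgn (X ^~ e)}.
  apply: (@ae_cvg_of_l2_geometric _ _ _ nu X (2 * s) 2^-1) => //.
  - by rewrite mulr_ge0.
  - by move=> i; exact: measurable_psum.
  move=> i; apply: le_trans
    (psum_dist_le a (trunc_index a i) (trunc_index a i.+1)) _.
  rewrite h4 (_ : 2 * s * _ = s * (2 * 4^-1 ^+ i)); last by ring.
  rewrite EFinM; apply: lee_wpmul2l => //.
  apply: (@le_trans _ _ ((4^-1 ^+ i)%:E + (4^-1 ^+ i)%:E)%E).
    apply: leeD; first exact: tail_trunc_index.
    apply: le_trans (tail_trunc_index _ la) _; rewrite lee_fin exprS.
    rewrite -[leRHS]mul1r; apply: ler_wpM2r; first by rewrite exprn_ge0.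
    by rewrite invf_le1// ler1n.
  by rewrite -EFinD lee_fin mulr_natl mulr2n.
by apply: filterS => e /cvg_ex[l hl]; rewrite /wint (limsup_fun_cvg hl).
Qed.

(** The mean squared distance of the [n]-th partial sum to the one at the [i]-th truncation index is
    at most [s] times [tail a n] plus [4^-1 ^+ i]; then [i] tends to infinity by Fatou's lemma. *)
Lemma wint_psum_le a n : l2 a ->
  (\int[nu]_e ((wint a e - \sum_(k < n) a k * e k) ^+ 2)%:E
   <= s%:E * tail a n)%E.
Proof.
move=> la; have tfin : tail a n \is a fin_num.
  rewrite ge0_fin_numE ?tail_ge0//; apply: le_lt_trans la; exact: tail_anti.
apply: (@fatou_le _ _ _ nu
  (fun i e => (psum a (trunc_index a i) e - psum a n e) ^+ 2) _
  (fun i => s%:E * (tail a n + (4^-1 ^+ i)%:E))%E).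
- by move=> i; apply: measurable_funX; exact: measurable_funB.
- by apply: measurable_funX; apply: measurable_funB;
    [exact: measurable_wint|exact: measurable_psum].
- by move=> i e; exact: sqr_ge0.
- by move=> e; exact: sqr_ge0.
- apply: filterS (wint_cvg la) => e he; rewrite expr2.
  rewrite (_ : (fun i => _) = (fun i =>
    (psum a (trunc_index a i) e - psum a n e) *
    (psum a (trunc_index a i) e - psum a n e))); last first.
    by apply/funext => i; rewrite expr2.
  by apply: cvgM; apply: cvgB => //; exact: cvg_cst.
- move=> i; apply: le_trans (psum_dist_le _ _ _) _; apply: lee_wpmul2l => //.
  by apply: leeD => //; exact: tail_trunc_index.
- rewrite -[X in _ --> X]adde0 -(mule0 s%:E).
  rewrite (_ : (fun i => _) =
      (fun i => s%:E * tail a n + (s * 4^-1 ^+ i)%:E)%E); last first.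
    by apply/funext => i; rewrite -(fineK tfin) -EFinD -!EFinM -EFinD mulrDr.
  rewrite mule0; apply: cvgeD => //; [|exact: cvg_cst|].
    by rewrite fin_num_adde_defl.
  apply: cvg_EFin; first exact: nearW.
  rewrite (_ : fine \o _ = geometric s 4^-1)//; apply: cvg_geometric.
  by rewrite ger0_norm// invf_lt1// ltr1n.
Qed.

(** Different coefficient sequences have different truncation indices; convergence along larger
    indices permits a common choice. *)
Let wint_cvg_along a (m : nat -> nat) : l2 a ->
  (forall i, (trunc_index a i <= m i)%N) ->
  {ae nu, forall e, (fun i => psum a (m i) e) @ \oo --> wint a e}.
Proof.
move=> la hm.
have : {ae nu, forall e, (fun i => wint a e - psum a (m i) e) @ \oo --> 0}.
  apply: (@ae_cvg0_of_l2_geometric _ _ _ nu _ s 2^-1) => //.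
    by move=> i; apply: measurable_funB;
    [exact: measurable_wint|exact: measurable_psum].
  move=> i; apply: le_trans (wint_psum_le _ la) _.
  rewrite h4 EFinM; apply: lee_wpmul2l => //.
  apply: le_trans (tail_trunc_index i la); exact: tail_anti.
apply: filterS => e he.
rewrite (_ : (fun i => _) = (fun i => wint a e - (wint a e - psum a (m i) e))).
  rewrite -[X in _ --> X]subr0; apply: cvgB => //; exact: cvg_cst.
by apply/funext => i; rewrite subKr.
Qed.

(** [wint] is not linear by construction. At the maximum of both truncation indices, the difference
    of the partial sums is the partial sum of [a - a'], to which [second_moment] applies before
    Fatou's lemma. *)
Lemma wint_second_moment b a a' : l2 a -> l2 a' ->
  (\int[nu]_e ((b + wint a e - wint a' e) ^+ 2)%:E
   <= (b ^+ 2)%:E + s%:E * \sum_(k <oo) ((a k - a' k) ^+ 2)%:E)%E.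
Proof.
move=> la la'; pose m i := maxn (trunc_index a i) (trunc_index a' i).
have c1 : {ae nu, forall e, (fun i => psum a (m i) e) @ \oo --> wint a e}.
  by apply: wint_cvg_along => // i; exact: leq_maxl.
have c2 : {ae nu, forall e, (fun i => psum a' (m i) e) @ \oo --> wint a' e}.
  by apply: wint_cvg_along => // i; exact: leq_maxr.
apply: (@fatou_le _ _ _ nu
  (fun i e => (b + psum a (m i) e - psum a' (m i) e) ^+ 2) _
  (fun=> (b ^+ 2)%:E + s%:E * \sum_(k <oo) ((a k - a' k) ^+ 2)%:E)%E).
- move=> i; apply: measurable_funX; apply: measurable_funB => //.
  exact: measurable_funD.
- apply: measurable_funX; apply: measurable_funB; last exact: measurable_wint.
  by apply: measurable_funD => //; exact: measurable_wint.
- by move=> i e; exact: sqr_ge0.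
- by move=> e; exact: sqr_ge0.
- apply: filterS2 c1 c2 => e h1 h2; rewrite expr2.
  rewrite (_ : (fun i => _) = (fun i =>
    (b + psum a (m i) e - psum a' (m i) e) *
    (b + psum a (m i) e - psum a' (m i) e))); last first.
    by apply/funext => i; rewrite expr2.
  have h3 : (fun i => b + psum a (m i) e - psum a' (m i) e) @ \oo -->
      b + wint a e - wint a' e.
    exact: (cvgB (cvgD (cvg_cst b) h1) h2).
  exact: cvgM.
- move=> i; have := second_moment (m i) b (fun k => a k - a' k).
  rewrite (eq_integral (fun e => ((b + psum a (m i) e - psum a' (m i) e) ^+ 2)%:E)).
    move=> /le_trans; apply; rewrite EFinD (EFinM s); apply: leeD => //.
    apply: lee_wpmul2l => //.
    rewrite -(big_mkord xpredT (fun k => (a k - a' k) ^+ 2)) -sumEFin.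
    by apply: nneseries_lim_ge => k _ _; rewrite lee_fin sqr_ge0.
  move=> e _; rewrite /psum -addrA -sumrB; congr ((b + _) ^+ 2)%:E.
  by apply: eq_bigr => k _; rewrite mulrBl.
- exact: cvg_cst.
Qed.

(** The truncation index varies with the coefficients, but it has countably many values, each taken
    on a measurable set, and for a fixed index the partial sum is jointly measurable. *)
Lemma measurable_wint_comp d (T : measurableType d) (a : T -> nat -> R) :
  (forall k, measurable_fun setT (fun u => a u k)) ->
  measurable_fun setT (fun z : T * noise R => wint (a z.1) z.2).
Proof.
move=> ma; pose X i (z : T * noise R) := psum (a z.1) (trunc_index (a z.1) i) z.2.
have mX i : measurable_fun setT (X i).
  apply: (@measurable_fun_nat_index _ _ _ _ (fun z : T * noise R =>
    trunc_index (a z.1) i) (fun n z => psum (a z.1) n z.2)); last first.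
    move=> n; apply: measurable_sum => k; apply: measurable_funM.
      exact: (measurableT_comp (ma k) measurable_fst).
    exact: (measurableT_comp (measurable_coord k) measurable_snd).
  move=> n; pose S m := [set u : T | tail_small (a u) i m].
  have mS m : measurable (S m).
    have mt : measurable_fun setT (fun u => tail (a u) m).
      rewrite (_ : (fun u => _) =
          (fun u => \sum_(k <oo) (a u (k + m)%N ^+ 2)%:E)%E); last first.
        apply/funext => u.
        rewrite (@nneseries_addn _ (fun k => (a u k ^+ 2)%:E) m)// => k.
        by rewrite lee_fin sqr_ge0.
      apply: ge0_emeasurable_sum => [k u _ _|k _].
        by rewrite lee_fin sqr_ge0.
      by apply/measurable_EFinP; exact: measurable_funX.
    rewrite (_ : S m = (fun u => tail (a u) m) @^-1` `]-oo, (4^-1 ^+ i)%:E]%classic).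
      by rewrite -[_ @^-1` _]setTI; apply: mt => //; exact: emeasurable_itv.
    by apply/seteqP; split=> u /=; rewrite in_itv.
  (* The event that the index is [n]: either [n] is the first level with a small tail, or [n] is the
     default 0 and no tail is small. *)
  pose B := (S n `&` \bigcap_(m in `I_n) ~` S m) `|`
    (if n == 0%N then \bigcap_m ~` S m else set0).
  have mB : measurable B.
    apply: measurableU.
      apply: measurableI => //; apply: bigcap_measurableType => m _.
      exact: measurableC.
    case: ifP => // _; apply: bigcap_measurableType => m _; exact: measurableC.
  rewrite (_ : _ @^-1` _ = fst @^-1` B).
    by rewrite -[_ @^-1` _]setTI; exact: measurable_fst.
  apply/seteqP; split=> -[u e] /=; rewrite /trunc_index.
    case: pselect => [h|h] /=.
      case: ex_minnP => m Sm hm mn; rewrite /B -mn; left; split=> // k /= km Sk.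
      by have := hm _ Sk; rewrite leqNgt km.
    by move=> n0; rewrite /B -n0; right; rewrite eqxx => m _ Sm; apply: h; exists m.
  move=> [[Sn hn]|].
    case: pselect => [h|[]]; last by exists n.
    case: ex_minnP => m Sm /(_ _ Sn); rewrite leq_eqVlt => /orP[/eqP//|mn].
    by have := hn m mn.
  case: eqP => // -> hn; case: pselect => // h.
  by case: ex_minnP => m Sm _; have := hn m I.
apply: measurable_limsup_fun => i; exact: mX.
Qed.

End noise_integral.

(** * The law of the Brownian increments over one time step *)

Section brownian_increments.
Variables (R : realType) (dO : measure_display) (Omega : measurableType dO).
Variables (P : probability Omega R) (F : R -> set (set Omega)).
Variables (beta : nat -> R -> Omega -> R).
Hypothesis filtF : filtration F.
Hypothesis hbeta : brownian_family P F beta.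
Variables (tau : R) (m : nat).
Hypothesis tau0 : 0 < tau.

(* [noise] is indexed from 0, the Brownian motions from 1. *)
Definition increments (w : Omega) : noise R :=
  fun k => beta k.+1 (m.+1%:R * tau) w - beta k.+1 (m%:R * tau) w.

Let t0 i : 0 <= i%:R * tau.
Proof. by rewrite mulr_ge0// ltW. Qed.

Let measurable_beta k t : 0 <= t -> measurable_fun setT (beta k.+1 t).
Proof.
move=> t_ge0 _ A mA; rewrite setTI; have [_ sF _] := filtF.
by apply: (sF t) => //; apply: (bm_adapted (bf_bm hbeta _)).
Qed.

Lemma measurable_increments : measurable_fun setT increments.
Proof.
by apply: measurable_noiseP => k; apply: measurable_funB; exact: measurable_beta.
Qed.

Let generated_increment k (A : set R) : measurable A ->
  generated_by [set t | 0 <= t] (beta k.+1) ((fun w => increments w k) @^-1` A).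
Proof.
move=> mA.
pose gen := [set B | exists i A, [/\ [set t | 0 <= t] i, measurable A &
  B = beta k.+1 i @^-1` A]].
have mb t : 0 <= t ->
    measurable_fun setT (beta k.+1 t : g_sigma_algebraType gen -> R).
  move=> t_ge0 _ B mB; rewrite setTI; apply: sub_sigma_algebra.
  by exists t, B.
have := measurable_funB (mb _ (t0 m.+1)) (mb _ (t0 m)).
by move=> /(_ measurableT A mA); rewrite setTI.
Qed.

(** Independence of the Brownian motions gives the product and [bm_gaussian] its factors; [m] enters
    only through an interval length, which is always [tau]. *)
Lemma iid_increments (nu : probability (noise R) R) :
  (forall B, measurable B -> nu B = P (increments @^-1` B)) ->
  iid (normal_prob 0 (Num.sqrt tau)) nu.
Proof.
move=> nuE n A mA; rewrite nuE; last exact: measurable_cylinder.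
pose B k := (fun w => increments w k.-1) @^-1` A k.-1.
have := bf_indep hbeta (J := iota 1 n) (B := B) (iota_uniq _ _).
have -> : \big[setI/setT]_(k <- iota 1 n) B k = increments @^-1` cylinder n A.
  rewrite -bigcap_seq; apply/seteqP; split=> w /= h.
    by move=> k kn; apply: (h k.+1); rewrite /= mem_iota add1n ltnS.
  by move=> [|k] /=; rewrite mem_iota// add1n ltnS => kn; exact: h.
have -> : (\prod_(k <- iota 1 n) P (B k) =
    \prod_(k < n) normal_prob 0 (Num.sqrt tau) (A k))%E.
  rewrite (iotaDl 1 0) big_map -(big_mkord xpredT (fun k =>
    normal_prob 0 (Num.sqrt tau) (A k))) /index_iota subn0.
  apply: eq_bigr => k _; rewrite add1n /B/=.
  have lt : m%:R * tau < m.+1%:R * tau by rewrite ltr_pM2r// ltr_nat.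
  have := bm_gaussian (bf_bm hbeta (ltn0Sn k)) (t0 m) lt (mA k).
  rewrite (_ : m.+1%:R * tau - m%:R * tau = tau); first by [].
  by rewrite -mulrBl -natrB// subSnn mul1r.
apply; first by apply/allP => k; rewrite mem_iota => /andP[].
move=> [|k]; rewrite mem_iota// => _; exact: generated_increment.
Qed.

End brownian_increments.

(** * Eigenfunctions in [L^4] and the Galerkin form of the nonlinearity *)

Section neumann_galerkin.
Variables (R : realType) (d : nat).
Variables (phi : nat -> d.-tuple (measurableTypeR R) -> R) (lam : nat -> R).
Hypothesis hphi : neumann_eigenbasis phi lam.
Variable C : R.
Hypothesis hC : sobolev_constant phi lam C.

Local Notation mu := (cube_measure R d).

Lemma nneseries_finite_support (f : nat -> R) m n : (forall k, 0 <= f k) ->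
  (forall k, (n <= k)%N -> f k = 0) -> (\sum_(m <= k <oo) (f k)%:E < +oo)%E.
Proof.
move=> f0 fn; apply: (@le_lt_trans _ _ (\sum_(k < n) f k)%:E); last exact: ltry.
apply: lime_le.
  by apply: is_cvg_nneseries => k _ _; rewrite lee_fin.
apply: nearW => p; rewrite sumEFin lee_fin.
apply: (@le_trans _ _ (\sum_(0 <= k < p) f k)).
  have [mp|pm] := leqP m p; last first.
    by rewrite big_geq 1?ltnW// sumr_ge0.
  by rewrite [leRHS](big_cat_nat (leq0n m) mp)/= lerDr sumr_ge0.
rewrite -(big_mkord xpredT f); have [pn|np] := leqP p n.
  by rewrite [leRHS](big_cat_nat (leq0n p) pn)/= lerDl sumr_ge0.
have z : \sum_(n <= k < p) f k = 0.
  by rewrite big_nat_cond big1// => k /andP[/andP[nk _] _]; exact: fn.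
by rewrite [leLHS](big_cat_nat (leq0n n) (ltnW np))/= z addr0.
Qed.

Lemma inH_finite_support b (c : nat -> R) n :
  (forall k, (n <= k)%N -> c k = 0) -> inH lam b c.
Proof.
move=> cn; rewrite /inH /sqnorm lte_add_pinfty ?ltry//.
apply: (@nneseries_finite_support (fun j => lam j `^ b * c j ^+ 2) 1 n) => k.
  by rewrite mulr_ge0 ?powR_ge0 ?sqr_ge0.
by move=> nk; rewrite cn// expr0n mulr0.
Qed.

(** An eigenfunction has a single nonzero coefficient, so it lies in [H^{d/4}], and the Sobolev
    embedding puts it in [L^4]. *)
Lemma integrable4_eigenfunction k : integrable4 mu (phi k).
Proof.
have L2 := basis_L2 hphi k.
have mphi : measurable_fun setT (phi k).
  by have := L2; rewrite /inL2 => /sub_Lfun_mfun; rewrite inE.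
split=> //; apply/integrableP; split.
  by apply/measurable_EFinP; exact: measurable_funX.
have fk : fourier phi (phi k) = unit_seq R k.
  by apply/funext => j; rewrite /fourier (basis_orthonormal hphi) eq_sym.
have ik : inH lam (d%:R / 4) (fourier phi (phi k)).
  rewrite fk; apply: (@inH_finite_support _ _ k.+1) => j kj.
  by rewrite /unit_seq gtn_eqF.
have n4 : (normL4 (phi k) < +oo)%E.
  apply: le_lt_trans (hC L2 ik) _.
  have sfin : sqnorm lam (d%:R / 4) (fourier phi (phi k)) \is a fin_num.
    rewrite ge0_fin_numE//; apply: adde_ge0; last by rewrite lee_fin sqr_ge0.
    by apply: nneseries_ge0 => j _ _; rewrite lee_fin mulr_ge0 ?powR_ge0 ?sqr_ge0.
  by rewrite ltey_eq fin_numM// fin_num_poweR.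
have := poweR_lty 4 n4; rewrite /normL4 poweR_Lnorm//.
apply: le_lt_trans.
rewrite le_eqVlt; apply/orP; left; apply/eqP; apply: eq_integral => x _ /=.
by rewrite (powR_mulrn 4 (normr_ge0 _)) normrX.
Qed.

Variable N : nat.

Let phiN (k : 'I_N.+1) : d.-tuple (measurableTypeR R) -> R := phi k.

Let phiN4 k : integrable4 mu (phiN k).
Proof. exact: integrable4_eigenfunction. Qed.

(** The linear coefficient, evaluated by orthonormality, is written as [quart] with two constant
    factors, so that integrability of both terms comes from [integrable4_mul]. *)
Lemma fourier_nonlin (V : HN R N) (j : 'I_N.+1) :
  fourier phi (nonlin (fun_of phi V)) j =
  cubic mu (fun k : 'I_N.+1 => phi k) (row_of_tuple V) j - tnth V j.
Proof.
have fE : fun_of phi V = synth phiN (row_of_tuple V).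
  by apply/funext => x; apply: eq_bigr => k _; rewrite mxE.
have V4 := synth4 phiN4 (row_of_tuple V).
have C4 := integrable4_cst mu 1.
have -> : tnth V j = quart mu (synth phiN (row_of_tuple V)) (phiN j)
    (fun=> 1) (fun=> 1).
  rewrite quart_suml// (bigD1 j)//= big1 => [|k kj].
    rewrite mxE /quart.
    have := basis_orthonormal hphi j j; rewrite eqxx /inner => ho.
    under eq_Rintegral do rewrite !mulr1.
    by rewrite ho mulr1 addr0.
  have := basis_orthonormal hphi k j; rewrite /inner (_ : (_ == _) = false) => [ho|].
    rewrite /quart; under eq_Rintegral do rewrite !mulr1.
    by rewrite ho mulr0.
  exact/negbTE.
rewrite -mulN1r /cubic /quart -Rintegral_axpy.
- rewrite /fourier /inner fE; apply: eq_Rintegral => x _; rewrite /nonlin.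
  by rewrite /phiN; ring.
- exact: (integrable4_mul V4 V4 V4 (phiN4 j)).
- exact: (integrable4_mul V4 (phiN4 j) C4 C4).
Qed.

End neumann_galerkin.

(** * Hilbert-Schmidt operators as matrices acting on the noise *)

Section noise_coefficients.
Variables (R : realType) (lam q : nat -> R).
Hypothesis lam_gt0 : forall j, 0 < lam j.+1.
Implicit Types T : (nat -> R) -> nat -> R.

(** The matrix of [T]; column [k] belongs to the basis vector [k.+1], since the noise is indexed
    from 0. *)
Definition coef T (j k : nat) : R := T (sqrtQ q (unit_seq R k.+1)) j.

Lemma sqnorm_dotE (c : nat -> R) :
  sqnorm_dot lam (-1) c = (\sum_(j <oo) ((lam j.+1)^-1 * c j.+1 ^+ 2)%:E)%E.
Proof.
rewrite /sqnorm_dot -(@nneseries_addn _ (fun j => (lam j `^ (-1) * c j ^+ 2)%:E) 1).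
  by apply: eq_eseriesr => j _; rewrite addn1 powR_inv1// ltW.
by move=> j; rewrite lee_fin mulr_ge0 ?powR_ge0 ?sqr_ge0.
Qed.

Let term_ge0 (x : R) j : 0 <= (lam j.+1)^-1 * x ^+ 2.
Proof. by rewrite mulr_ge0 ?sqr_ge0// invr_ge0 ltW. Qed.

Lemma sqnorm_HS_cols T : sqnorm_HS lam q (-1) T =
  (\sum_(k <oo) \sum_(j <oo) ((lam j.+1)^-1 * coef T j.+1 k ^+ 2)%:E)%E.
Proof.
rewrite /sqnorm_HS
  -(@nneseries_addn _ (fun k => sqnorm_dot lam (-1) (T (sqrtQ q (unit_seq R k)))) 1).
  by apply: eq_eseriesr => k _; rewrite addn1 sqnorm_dotE.
move=> k; rewrite sqnorm_dotE; apply: nneseries_ge0 => j _ _.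
by rewrite lee_fin.
Qed.

(** Hilbert-Schmidt norms are summed by columns, whereas the random series are built row by row;
    Tonelli exchanges the two. *)
Lemma cols_rows (a : nat -> nat -> R) :
  (\sum_(k <oo) \sum_(j <oo) ((lam j.+1)^-1 * a j k ^+ 2)%:E =
   \sum_(j <oo) ((lam j.+1)^-1)%:E * \sum_(k <oo) (a j k ^+ 2)%:E)%E.
Proof.
rewrite (@nneseries_interchange _ (fun k j => ((lam j.+1)^-1 * a j k ^+ 2)%:E)).
  apply: eq_eseriesr => j _; rewrite -nneseriesZl// => k _.
  by rewrite lee_fin sqr_ge0.
by move=> k j; rewrite lee_fin.
Qed.

Section fixed_operator.
Variable T : (nat -> R) -> nat -> R.
Hypothesis HT : hilbert_schmidt lam q (-1) T.

Let U0_finite_support n (h : nat -> R) : (forall k, (n <= k)%N -> h k = 0) ->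
  h 0%N = 0 -> U0 lam q (sqrtQ q h).
Proof.
by move=> hn h0; exists h => //; split=> //; exact: inH_finite_support hn.
Qed.

Let U0_unit k : U0 lam q (sqrtQ q (unit_seq R k.+1)).
Proof.
apply: (@U0_finite_support k.+2) => // j kj.
by rewrite /unit_seq gtn_eqF.
Qed.

Lemma coef0 k : coef T 0 k = 0.
Proof. by have [] := HS_range HT (U0_unit k). Qed.

Lemma HS_truncate n (h : nat -> R) :
  T (truncate n (fun k => if k == 0%N then 0 else Num.sqrt (q k) * h k.-1)) =
  (fun j => \sum_(k < n) coef T j k * h k).
Proof.
pose trunc n : nat -> R :=
  truncate n (fun k => if k == 0%N then 0 else Num.sqrt (q k) * h k.-1).
have Utrunc m : U0 lam q (trunc m).
  rewrite (_ : trunc m = sqrtQ q (fun k => if (k == 0%N) || (m < k)%N then 0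
      else h k.-1)).
    by apply: (@U0_finite_support m.+1) => // k mk; rewrite mk orbT.
  apply/funext => k; rewrite /trunc /truncate /sqrtQ leqNgt.
  by case: eqP => [->|_]; case: ltnP => //= _; rewrite mulr0.
rewrite -/(trunc n); elim: n => [|n IH].
  (* The truncation at 0 is the zero sequence; linearity applied to it twice gives
     [T 0 = T 0 + T 0], hence [T 0 = 0]. *)
  have := HS_linear HT 1 (Utrunc 0%N) (Utrunc 0%N).
  have -> : (fun k => 1 * trunc 0%N k + trunc 0%N k) = trunc 0%N.
    by apply/funext => -[|k]; rewrite /trunc /truncate/= mulr0 addr0.
  move=> e; apply/funext => j; rewrite big_ord0.
  by have := congr1 (@^~ j) e; rewrite /= mul1r => ?; lra.
have -> : trunc n.+1 = (fun k => h n * sqrtQ q (unit_seq R n.+1) k + trunc n k).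
  apply/funext => k; rewrite /trunc /truncate /sqrtQ /unit_seq.
  case: (ltngtP k n.+1) => [kn|kn|->].
  - by rewrite -ltnS kn !mulr0 add0r.
  - by rewrite leqNgt (ltn_trans _ kn)//= !mulr0 add0r.
  - by rewrite ltnn /= mulr1 addr0 mulrC.
rewrite (HS_linear HT _ (U0_unit n) (Utrunc n)) IH.
by apply/funext => j; rewrite big_ord_recr/= addrC mulrC.
Qed.

Lemma l2_coef j : l2 (coef T j.+1).
Proof.
have := HS_finite HT; rewrite sqnorm_HS_cols (cols_rows (fun j => coef T j.+1)).
move=> fin; rewrite /l2 /tail.
have Li : 0 < (lam j.+1)^-1 by rewrite invr_gt0.
have rows0 i : (0 <= ((lam i.+1)^-1)%:E * \sum_(k <oo) (coef T i.+1 k ^+ 2)%:E)%E.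
  apply: mule_ge0; first by rewrite lee_fin invr_ge0 ltW.
  by apply: nneseries_ge0 => k _ _; rewrite lee_fin sqr_ge0.
have : (((lam j.+1)^-1)%:E * \sum_(k <oo) (coef T j.+1 k ^+ 2)%:E < +oo)%E.
  apply: le_lt_trans fin; apply: le_trans (nneseries_lim_ge j.+1 _) => //.
  by rewrite big_nat_recr//= leeDr// sume_ge0.
by apply: contraTT; rewrite -!leNgt !leye_eq => /eqP ->; rewrite gt0_muley.
Qed.

End fixed_operator.

Variables (nu : probability (noise R) R) (s : R).
Hypothesis s0 : 0 <= s.
Hypothesis second_moment : forall n b (c : nat -> R),
  (\int[nu]_e ((b + \sum_(k < n) c k * e k) ^+ 2)%:E
   <= (b ^+ 2 + s * \sum_(k < n) c k ^+ 2)%:E)%E.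

Definition noise_term T (e : noise R) (j : nat) : R :=
  if j == 0%N then 0 else wint (coef T j) e.

Lemma measurable_noise_term T j :
  measurable_fun setT (fun e => noise_term T e j).
Proof.
by rewrite /noise_term; case: eqP => // _; exact: measurable_wint.
Qed.

Definition partial_noise T n (e : noise R) (j : nat) : R :=
  \sum_(k < n) coef T j k * e k.

Lemma measurable_partial_noise T n j :
  measurable_fun setT (fun e => partial_noise T n e j).
Proof.
apply: measurable_sum => k.
by apply: measurable_funM => //; exact: measurable_coord.
Qed.

Lemma measurable_sqnorm d (Y : measurableType d) (X : Y -> nat -> R) :
  (forall j, measurable_fun setT (fun y => X y j)) ->
  measurable_fun setT (fun y => sqnorm lam (-1) (X y)).
Proof.
move=> mX; apply: emeasurable_funD; last first.
  by apply/measurable_EFinP; exact: measurable_funX.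
under eq_fun do rewrite sqnorm_dotE.
apply: ge0_emeasurable_sum => [j y _ _|j _]; first by rewrite lee_fin.
by apply/measurable_EFinP; apply: measurable_funM => //; exact: measurable_funX.
Qed.

Lemma sqnorm_ge0 (c : nat -> R) : (0 <= sqnorm lam (-1) c)%E.
Proof.
rewrite /sqnorm sqnorm_dotE; apply: adde_ge0; last by rewrite lee_fin sqr_ge0.
by apply: nneseries_ge0 => j _ _; rewrite lee_fin.
Qed.

(** In each row the error is at most [s] times a tail; recombined by Tonelli, the rows give the tail
    of the convergent series of squared column norms. *)
Lemma noise_term_cvg T : hilbert_schmidt lam q (-1) T ->
  (\int[nu]_e sqnorm lam (-1) (seqB (noise_term T e) (partial_noise T n e)))%E
    @[n --> \oo] --> 0%E.
Proof.
move=> HT.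
pose g k : \bar R := (\sum_(j <oo) ((lam j.+1)^-1 * coef T j.+1 k ^+ 2)%:E)%E.
have g0 k : xpredT k -> (0 <= g k)%E.
  by move=> _; apply: nneseries_ge0 => j _ _; rewrite lee_fin.
have gfin : (\sum_(k <oo) g k < +oo)%E.
  by have := HS_finite HT; rewrite sqnorm_HS_cols.
have bound n : (\int[nu]_e sqnorm lam (-1)
    (seqB (noise_term T e) (partial_noise T n e)) <=
    s%:E * \sum_(n <= k <oo) g k)%E.
  pose f j e := ((lam j.+1)^-1 * (wint (coef T j.+1) e -
    \sum_(k < n) coef T j.+1 k * e k) ^+ 2)%:E.
  have mf j : measurable_fun setT (f j).
    apply/measurable_EFinP; apply: measurable_funM => //; apply: measurable_funX.
    by apply: measurable_funB; [exact: measurable_wint|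
      exact: (measurable_partial_noise T n j.+1)].
  rewrite (eq_integral (fun e => \sum_(j <oo) f j e)%E); last first.
    move=> e _; rewrite /sqnorm sqnorm_dotE /seqB /noise_term eqxx.
    rewrite /partial_noise big1 ?subrr ?expr0n ?adde0//.
    by move=> k _; rewrite (coef0 HT) mul0r.
  rewrite integral_nneseries//; last by move=> j e _; rewrite lee_fin.
  apply: (@le_trans _ _ (\sum_(j <oo)
      ((lam j.+1)^-1)%:E * (s%:E * tail (coef T j.+1) n))%E).
    apply: lee_nneseries => [j _ _|j _].
      by apply: integral_ge0 => e _; rewrite lee_fin.
    have Li : 0 <= (lam j.+1)^-1 by rewrite invr_ge0 ltW.
    under eq_integral do rewrite /f EFinM.
    rewrite ge0_integralZl_EFin//; last 2 first.
    - by move=> e _; rewrite lee_fin sqr_ge0.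
    - apply/measurable_EFinP; apply: measurable_funX.
      by apply: measurable_funB; [exact: measurable_wint|
        exact: (measurable_partial_noise T n j.+1)].
    apply: lee_wpmul2l; first by rewrite lee_fin.
    exact: (wint_psum_le s0 second_moment n (l2_coef HT j)).
  have -> : (\sum_(n <= k <oo) g k = \sum_(j <oo)
      ((lam j.+1)^-1)%:E * tail (coef T j.+1) n)%E.
    rewrite -(@nneseries_addn _ g n); last by move=> k; exact: g0.
    rewrite (cols_rows (fun j k => coef T j.+1 (k + n)%N)).
    apply: eq_eseriesr => j _; congr (_ * _)%E; rewrite /tail.
    rewrite (@nneseries_addn _ (fun k => (coef T j.+1 k ^+ 2)%:E) n)// => k.
    by rewrite lee_fin sqr_ge0.
  rewrite -nneseriesZl//; last first.
    move=> j _; apply: mule_ge0; last exact: tail_ge0.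
    by rewrite lee_fin invr_ge0 ltW.
  by apply: lee_nneseries => [j _ _|j _]; rewrite muleCA//;
    rewrite !mule_ge0 ?tail_ge0 ?lee_fin ?invr_ge0 ?(ltW (lam_gt0 j)).
have lim0 : (s%:E * \sum_(n <= k <oo) g k)%E @[n --> \oo] --> 0%E.
  rewrite -[X in _ --> X](mule0 s%:E); apply: cvgeZl => //.
  exact: (@nneseries_tail_cvg R g xpredT gfin g0).
apply: (@squeeze_cvge _ _ _ _ (cst 0%E) _
  (fun n => s%:E * \sum_(n <= k <oo) g k)%E) => //; last exact: cvg_cst.
apply: nearW => n; rewrite bound andbT; apply: integral_ge0 => e _.
exact: sqnorm_ge0.
Qed.

(** The Ito isometry as an inequality on finitely many modes: [wint_second_moment] in each row, then
    the rows are summed into the Hilbert-Schmidt norm. *)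
Lemma noise_term_second_moment T T' (b : nat -> R) n :
  hilbert_schmidt lam q (-1) T -> hilbert_schmidt lam q (-1) T' ->
  (\sum_(j < n) ((lam j.+1)^-1)%:E *
     \int[nu]_e ((b j.+1 + noise_term T e j.+1 - noise_term T' e j.+1) ^+ 2)%:E
   <= (\sum_(j < n) (lam j.+1)^-1 * b j.+1 ^+ 2)%:E +
      s%:E * sqnorm_HS lam q (-1) (opB T T'))%E.
Proof.
move=> HT HT'.
pose A j : \bar R := (\sum_(k <oo) ((coef T j.+1 k - coef T' j.+1 k) ^+ 2)%:E)%E.
have A0 j : (0 <= A j)%E.
  by apply: nneseries_ge0 => k _ _; rewrite lee_fin sqr_ge0.
have Li j : (0 <= ((lam j.+1)^-1)%:E)%E by rewrite lee_fin invr_ge0 ltW.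
apply: (@le_trans _ _ (\sum_(j < n) (((lam j.+1)^-1 * b j.+1 ^+ 2)%:E +
    s%:E * (((lam j.+1)^-1)%:E * A j)))%E).
  apply: lee_sum => j _.
  apply: (@le_trans _ _ (((lam j.+1)^-1)%:E * ((b j.+1 ^+ 2)%:E + s%:E * A j))%E).
    apply: lee_wpmul2l => //.
    exact: (wint_second_moment s0 second_moment _ (l2_coef HT j) (l2_coef HT' j)).
  rewrite ge0_muleDr ?lee_fin ?sqr_ge0 ?mule_ge0 ?lee_fin//.
  by rewrite -EFinM [X in (_ + X <= _)%E]muleCA.
rewrite big_split/= sumEFin; apply: leeD => //.
rewrite -ge0_sume_distrr; last by move=> j _; exact: mule_ge0.
apply: lee_wpmul2l; first by rewrite lee_fin.
rewrite sqnorm_HS_cols (cols_rows (fun j => coef (opB T T') j.+1)).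
rewrite -(big_mkord xpredT (fun j => ((lam j.+1)^-1)%:E * A j)%E).
by apply: nneseries_lim_ge => j _ _; exact: mule_ge0.
Qed.

End noise_coefficients.

Lemma nneseries_finite_sum (R : realType) (f : nat -> R) n :
  (forall k, 0 <= f k) -> (forall k, (n <= k)%N -> f k = 0) ->
  (\sum_(k <oo) (f k)%:E = (\sum_(k < n) f k)%:E)%E.
Proof.
move=> f0 fn; rewrite (nneseries_split 0 n) => [|k _]; last by rewrite lee_fin.
rewrite add0n eseries0 ?adde0; last by move=> k nk _; rewrite fn.
by rewrite big_mkord sumEFin.
Qed.

Lemma measurable_wdist_lipschitz (R : realType) N (w : 'I_N.+1 -> R) (c : R)
    (f : HN R N -> R) :
  (forall u v, (f u - f v) ^+ 2 <= c * wdist w u v) -> measurable_fun setT f.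
Proof.
move=> flip; apply: (measurability _ (RGenOInfty.measurableE R)) => _ [_ [r ->] <-].
rewrite setTI.
pose h (V : 'rV[R]_N.+1) := f (tuple_of_row V).
have -> : f = h \o (@row_of_tuple R N.+1).
  by apply/funext => u; rewrite /h /= row_of_tupleK.
rewrite comp_preimage; apply: measurable_open_rows.
have cd V : continuous (fun Z : 'rV[R]_N.+1 =>
    c * wdist w (tuple_of_row V) (tuple_of_row Z)).
  have -> : (fun Z => c * wdist w (tuple_of_row V) (tuple_of_row Z)) =
      (fun Z : 'rV[R]_N.+1 => c * \sum_(j < N.+1) w j * (V ord0 j - Z ord0 j) ^+ 2).
    apply/funext => Z; congr (_ * _); apply: eq_bigr => j _.
    by rewrite !tnth_mktuple.
  have cst (a : R) : continuous (fun _ : 'rV[R]_N.+1 => a) by exact: cst_continuous.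
  apply: continuous_mul; first exact: cst.
  apply: continuous_sum_coord => j; apply: continuous_mul; first exact: cst.
  pose D (Z : 'rV[R]_N.+1) := V ord0 j - Z ord0 j.
  have cD : continuous D.
    have cc : continuous (fun Z : 'rV[R]_N.+1 => Z ord0 j : R).
      exact: continuous_coord.
    by move=> Z; exact: (cvgB (cst (V ord0 j : R) Z) (cc Z)).
  exact: (continuous_mul cD cD).
have ch : continuous h.
  move=> V; apply/(@cvgrPdist_lt _ _ _ (nbhs V) (nbhs_filter V)) => e e0.
  have cV0 : c * wdist w (tuple_of_row V) (tuple_of_row V) = 0.
    by rewrite /wdist big1 ?mulr0// => j _; rewrite subrr expr0n mulr0.
  have := cd V V; rewrite /continuous_at cV0.
  move=> /(@cvgrPdist_lt _ _ _ (nbhs V) (nbhs_filter V))/(_ (e ^+ 2)).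
  rewrite exprn_gt0// => /(_ isT).
  apply: (@filterS _ (nbhs V) (nbhs_filter V)) => Z; rewrite sub0r normrN => Ve.
  rewrite -(@ltr_pXn2r _ 2)// ?nnegrE// ?ltW// real_normK ?num_real//.
  by apply: le_lt_trans (flip _ _) _; apply: le_lt_trans (ler_norm _) Ve.
apply: open_comp; last by rewrite set_itvE; exact: open_gt.
by move=> V _; exact: ch.
Qed.

(** * The random map of one step: measurability, contraction, moment *)

Section one_step.
Variables (d : measure_display) (T : measurableType d) (R : realType).
Variables (mu : probability T R) (N : nat) (phi : 'I_N.+1 -> T -> R).
Hypothesis phi4 : forall k, integrable4 mu (phi k).
Variables (lam q : nat -> R) (tau : R).
Hypothesis lam0 : lam 0%N = 0.
Hypothesis lam_le : forall j, lam 1%N <= lam j.+1.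
Hypothesis lam1_gt1 : 1 < lam 1%N.
Hypothesis tau0 : 0 < tau.
Variable G : (nat -> R) -> (nat -> R) -> nat -> R.
Hypothesis G_HS : forall u, inH lam (-1) u -> hilbert_schmidt lam q (-1) (G u).
Variable L : R.
Hypothesis L0 : 0 <= L.
Hypothesis G_lip : forall u v, inH lam (-1) u -> inH lam (-1) v ->
  (sqnorm_HS lam q (-1) (opB (G u) (G v)) <= L%:E * sqnorm lam (-1) (seqB u v))%E.
Variables (nu : probability (noise R) R) (s : R).
Hypothesis s0 : 0 <= s.
Hypothesis second_moment : forall n b (c : nat -> R),
  (\int[nu]_e ((b + \sum_(k < n) c k * e k) ^+ 2)%:E
   <= (b ^+ 2 + s * \sum_(k < n) c k ^+ 2)%:E)%E.

Let lamN (j : 'I_N.+1) := lam j.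

Let lam_gt0 j : 0 < lam j.+1.
Proof. by apply: lt_le_trans (lam_le j); apply: lt_trans lam1_gt1. Qed.

Let lamN0 : lamN ord0 = 0. Proof. exact: lam0. Qed.

Let lamN_ge (j : 'I_N.+1) : j != ord0 -> lam 1%N <= lamN j.
Proof. by case: j => -[|j] jN //= _; exact: lam_le. Qed.

Local Notation w := (weight lamN).

Let w_gt0 j : 0 < w j.
Proof. exact: (weight_gt0 lamN_ge lam1_gt1). Qed.

Lemma inH_seq_of (u : HN R N) : inH lam (-1) (seq_of u).
Proof.
apply: (@inH_finite_support _ _ _ _ N.+1) => k Nk.
by rewrite /seq_of nth_default// size_tuple.
Qed.

Lemma seq_ofE (u : HN R N) (j : 'I_N.+1) : seq_of u j = tnth u j.
Proof. by rewrite /seq_of (tnth_nth 0). Qed.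

Lemma sqnorm_seq_of (u v : HN R N) :
  sqnorm lam (-1) (seqB (seq_of u) (seq_of v)) = (wdist w u v)%:E.
Proof.
rewrite /sqnorm sqnorm_dotE// (@nneseries_finite_sum _ _ N).
- rewrite -EFinD /wdist big_ord_recl addrC /seqB -!seq_ofE; congr (_ + _)%:E.
    by rewrite /weight eqxx mul1r.
  by apply: eq_bigr => j _; rewrite -!seq_ofE.
- by move=> k; rewrite mulr_ge0 ?sqr_ge0 ?invr_ge0 ?ltW.
- move=> k Nk; rewrite /seqB /seq_of !nth_default ?size_tuple//.
  by rewrite subrr expr0n mulr0.
Qed.

(** One matrix entry is dominated by the Hilbert-Schmidt norm, so it inherits the Lipschitz
    condition; this is the source of measurability in [u]. *)
Let coef_lip (u v : HN R N) j k :
  (coef q (G (seq_of u)) j.+1 k - coef q (G (seq_of v)) j.+1 k) ^+ 2 <=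
  lam j.+1 * L * wdist w u v.
Proof.
have := G_lip (inH_seq_of u) (inH_seq_of v); rewrite sqnorm_seq_of -EFinM.
rewrite sqnorm_HS_cols// => le.
rewrite -mulrA mulrC -ler_pdivrMr// mulrC -lee_fin; apply: le_trans le.
have t0 i l : (0 <= ((lam i.+1)^-1 *
    coef q (opB (G (seq_of u)) (G (seq_of v))) i.+1 l ^+ 2)%:E)%E.
  by rewrite lee_fin mulr_ge0 ?sqr_ge0 ?invr_ge0 ?ltW.
apply: le_trans (nneseries_lim_ge k.+1 _); last first.
  by move=> l _ _; apply: nneseries_ge0.
rewrite big_nat_recr//=; apply: le_trans; last first.
  by apply: leeDr; apply: sume_ge0 => l _; apply: nneseries_ge0.
apply: le_trans (nneseries_lim_ge j.+1 _); last by move=> *.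
by rewrite big_nat_recr//= leeDr// sume_ge0.
Qed.

Lemma measurable_noise_term_comp j :
  measurable_fun setT (fun z : HN R N * noise R => noise_term q (G (seq_of z.1)) z.2 j).
Proof.
case: j => [|j]; first exact: measurable_cst.
rewrite /noise_term /=.
apply: (measurable_wint_comp (a := fun u => coef q (G (seq_of u)) j.+1)) => k.
by apply: measurable_wdist_lipschitz => u v; exact: coef_lip.
Qed.

Definition forcing (u : HN R N) e : HN R N :=
  [tuple tnth u j + noise_term q (G (seq_of u)) e j | j < N.+1].

Definition step (z : HN R N * noise R) : HN R N :=
  solve phi4 lamN0 lamN_ge lam1_gt1 tau0 (forcing z.1 z.2).

Lemma measurable_step : measurable_fun setT step.
Proof.
apply: measurableT_comp; first exact: measurable_solve.
apply/measurable_fun_tnthP => j.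
rewrite (_ : _ \o _ = (fun z : HN R N * noise R =>
    tnth z.1 j + noise_term q (G (seq_of z.1)) z.2 j)).
  apply: measurable_funD; last exact: measurable_noise_term_comp.
  exact: (measurableT_comp (measurable_tnth j)).
by apply/funext => z; rewrite /= tnth_mktuple.
Qed.

Lemma resid_step u e (j : 'I_N.+1) :
  resid mu phi lamN tau (row_of_tuple (step (u, e))) j =
  tnth u j + noise_term q (G (seq_of u)) e j.
Proof. by rewrite resid_solve tnth_mktuple. Qed.

Lemma step_mean u e : tnth (step (u, e)) ord0 = tnth u ord0.
Proof.
have := resid_step u e ord0; rewrite resid0// mxE => ->.
by rewrite /noise_term eqxx addr0.
Qed.

Let kappa := 2 * tau * (lam 1%N * (lam 1%N - 1)).

Let kappa_ge0 : 0 <= kappa.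
Proof.
rewrite /kappa !mulr_ge0 ?ltW ?subr_gt0//; exact: lt_trans lam1_gt1.
Qed.

Let measurable_step_snd u : measurable_fun setT (fun e => step (u, e)).
Proof. by apply: measurableT_comp; [exact: measurable_step|]. Qed.

Let wdist_step (A B : noise R -> HN R N) (D : 'I_N.+1 -> noise R -> R) e :
  tnth (A e) ord0 = tnth (B e) ord0 ->
  (forall j, resid mu phi lamN tau (row_of_tuple (A e)) j -
     resid mu phi lamN tau (row_of_tuple (B e)) j = D j e) ->
  (1 + kappa) * wdist w (A e) (B e) <= \sum_(j < N.+1) w j * D j e ^+ 2.
Proof.
move=> AB hD.
have := @resid_expansive _ _ _ _ _ _ phi4 _ _ _ lamN0 lamN_ge lam1_gt1 tau0
  (row_of_tuple (A e)) (row_of_tuple (B e)).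
rewrite !mxE => /(_ AB).
rewrite (eq_bigr (fun j => w j * (tnth (A e) j - tnth (B e) j) ^+ 2)); last first.
  by move=> j _; rewrite !mxE.
move=> /le_trans; apply.
by rewrite le_eqVlt (eq_bigr (fun j => w j * D j e ^+ 2)) ?eqxx// => j _; rewrite hD.
Qed.

(** [second_moment] has no cross term, so the forcings differ in mean square by at most [1 + s * L]
    times the squared distance of [u] and [v]; expansivity of the implicit operator divides by
    [1 + kappa]. *)
Lemma step_contraction u v : tnth u ord0 = tnth v ord0 ->
  (\int[nu]_e (wdist w (step (u, e)) (step (v, e)))%:E <=
   ((1 + s * L) / (1 + kappa) * wdist w u v)%:E)%E.
Proof.
move=> uv.
pose X T e j := noise_term q T e j.
pose Tu := G (seq_of u); pose Tv := G (seq_of v).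
pose D (j : 'I_N.+1) e := tnth u j - tnth v j + X Tu e j - X Tv e j.
have mD j : measurable_fun setT (D j).
  apply: measurable_funB; last exact: measurable_noise_term.
  apply: measurable_funD; last exact: measurable_noise_term.
  exact: measurable_cst.
have mWD (j : 'I_N.+1) : measurable_fun setT (fun e => (w j * D j e ^+ 2)%:E).
  apply/measurable_EFinP; apply: measurable_funM => //.
  exact: measurable_funX.
have k1 : 0 < 1 + kappa by rewrite ltr_wpDr.
apply: (@le_trans _ _ (\int[nu]_e
    (((1 + kappa)^-1)%:E * (\sum_(j < N.+1) (w j * D j e ^+ 2)%:E)))%E).
  apply: ge0_le_integral => //.
  - by move=> e _; rewrite lee_fin wdist_ge0.
  - apply/measurable_EFinP.
    exact: measurable_wdist (measurable_step_snd u) (measurable_step_snd v).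
  - apply: emeasurable_funM => //; exact: emeasurable_sum.
  - move=> e _; rewrite sumEFin -EFinM lee_fin mulrC ler_pdivlMr// mulrC.
    apply: (@wdist_step (fun e => step (u, e)) (fun e => step (v, e)) D e).
      exact: etrans (step_mean u e) (etrans uv (esym (step_mean v e))).
    move=> j; apply: etrans (congr2 (fun x y => x - y) (resid_step u e j)
      (resid_step v e j)) _.
    by rewrite opprD addrACA addrA.
have WD0 (j : 'I_N.+1) e : setT e -> (0 <= (w j * D j e ^+ 2)%:E)%E.
  by move=> _; rewrite lee_fin mulr_ge0 ?sqr_ge0// ltW.
rewrite ge0_integralZl_EFin//; last 3 first.
- by move=> e _; apply: sume_ge0 => j _; exact: WD0.
- exact: emeasurable_sum.
- by rewrite invr_ge0 ltW.
rewrite ge0_integral_sum// mulrAC mulrC EFinM; apply: lee_wpmul2l.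
  by rewrite lee_fin invr_ge0 ltW.
(* The zero mode contributes nothing: the means agree and the noise does not act on it. *)
rewrite big_ord_recl/= (_ : (\int[nu]_e _)%E = 0%E) ?add0e; last first.
  apply: integral0_eq => e _.
  by rewrite /D /X /noise_term !eqxx uv subrr addr0 subr0 expr0n mulr0.
have := noise_term_second_moment lam_gt0 s0 second_moment
  (seqB (seq_of u) (seq_of v)) N (G_HS (inH_seq_of u)) (G_HS (inH_seq_of v)).
rewrite (eq_bigr (fun j : 'I_N => \int[nu]_e
   (w (lift ord0 j) * D (lift ord0 j) e ^+ 2)%:E)%E); last first.
  move=> j _; rewrite -ge0_integralZl_EFin//; last 3 first.
  - by move=> e _; rewrite lee_fin sqr_ge0.
  - apply/measurable_EFinP; apply: measurable_funX.
    apply: measurable_funB; last exact: measurable_noise_term.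
    apply: measurable_funD; last exact: measurable_noise_term.
    exact: measurable_cst.
  - by rewrite invr_ge0 ltW.
  by apply: eq_integral => e _; rewrite -EFinM /D -!seq_ofE.
move=> /le_trans; apply.
rewrite mulrDl mul1r EFinD; apply: leeD.
  rewrite lee_fin /wdist big_ord_recl uv subrr expr0n mulr0 add0r.
  by apply: ler_sum => j _; rewrite -!seq_ofE.
rewrite -mulrA EFinM; apply: lee_wpmul2l; first by rewrite lee_fin.
apply: le_trans (G_lip (inH_seq_of u) (inH_seq_of v)) _.
by rewrite sqnorm_seq_of EFinM.
Qed.

(** [u] itself solves the implicit equation with data [resid u], so expansivity compares it with its
    successor; the two data differ by a constant minus square integrable noise. *)
Lemma step_moment u : (\int[nu]_e (wdist w u (step (u, e)))%:E < +oo)%E.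
Proof.
pose X e j := noise_term q (G (seq_of u)) e j.
pose b (j : 'I_N.+1) := resid mu phi lamN tau (row_of_tuple u) j - tnth u j.
have mX j : measurable_fun setT (X^~ j) by exact: measurable_noise_term.
have mX2 j : measurable_fun setT (fun e => (X e j ^+ 2)%:E).
  by apply/measurable_EFinP; exact: measurable_funX.
have X0 j e : setT e -> (0 <= (X e j ^+ 2)%:E)%E by rewrite lee_fin sqr_ge0.
have k1 : 0 < 1 + kappa by rewrite ltr_wpDr.
have fX j : (\int[nu]_e (X e j ^+ 2)%:E < +oo)%E.
  case: j => [|j].
    rewrite (_ : (\int[nu]_e _)%E = 0%E) ?ltry//.
    by apply: integral0_eq => e _; rewrite /X /noise_term eqxx expr0n.
  have lc := l2_coef lam_gt0 (G_HS (inH_seq_of u)) j.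
  have := wint_psum_le s0 second_moment 0 lc.
  under eq_integral do rewrite big_ord0 subr0.
  move=> /le_lt_trans; apply.
  move: lc; rewrite /l2; have := tail_ge0 (coef q (G (seq_of u)) j.+1) 0.
  by case: (tail _ _) => // r _ _; rewrite -EFinM ltry.
have mS : measurable_fun setT (fun e => (\sum_(j < N.+1)
    ((2 * w j)%:E * ((b j ^+ 2)%:E + (X e j ^+ 2)%:E)))%E).
  apply: emeasurable_sum => j; apply: emeasurable_funM => //.
  exact: emeasurable_funD.
apply: (@le_lt_trans _ _ (\int[nu]_e
    (\sum_(j < N.+1) ((2 * w j)%:E * ((b j ^+ 2)%:E + (X e j ^+ 2)%:E))))%E).
  apply: ge0_le_integral => //.
  - by move=> e _; rewrite lee_fin wdist_ge0.
  - apply/measurable_EFinP.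
    exact: (measurable_wdist _ (measurable_cst u) (measurable_step_snd u)).
  - move=> e _; under eq_bigr do rewrite -EFinD -EFinM.
    rewrite sumEFin lee_fin.
    apply: (@le_trans _ _ ((1 + kappa) * wdist w u (step (u, e)))).
      by rewrite mulrDl mul1r lerDl mulr_ge0// wdist_ge0.
    apply: le_trans (@wdist_step (fun=> u) (fun e => step (u, e))
      (fun j e => b j - X e j) e _ _) _.
    + exact: esym (step_mean u e).
    + move=> j; apply: etrans (congr1 (fun y => _ - y) (resid_step u e j)) _.
      by rewrite opprD addrA.
    apply: ler_sum => j _; rewrite (mulrC 2) -mulrA ler_pM2l//.
    move: (b j) (X e j : R) => x y; rewrite -subr_ge0.
    by rewrite (_ : _ - _ = (x + y) ^+ 2) ?sqr_ge0//; ring.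
have W0 j : 0 <= 2 * w j by rewrite mulr_ge0// ltW.
rewrite ge0_integral_sum//; last first.
- move=> j e _; apply: mule_ge0; first by rewrite lee_fin.
  by rewrite -EFinD lee_fin addr_ge0 ?sqr_ge0.
- move=> j; apply: emeasurable_funM => //; exact: emeasurable_funD.
apply: lte_sum_pinfty => j _.
rewrite ge0_integralZl_EFin//; last 2 first.
- by move=> e _; rewrite -EFinD lee_fin addr_ge0 ?sqr_ge0.
- exact: emeasurable_funD.
rewrite ge0_integralD//; last by move=> e _; rewrite lee_fin sqr_ge0.
rewrite integral_cst//= probability_setT mule1.
apply: lte_mul_pinfty; rewrite ?lee_fin//.
by rewrite lte_add_pinfty ?ltry.
by move=> e _; rewrite lee_fin sqr_ge0.
Qed.

End one_step.

(** * The probability kernel of a random map *)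

Section image_kernel.
Context dX (X : measurableType dX) dE (E : measurableType dE).
Context dY (Y : measurableType dY) (R : realType).
Variables (nu : probability E R) (Phi : {mfun (X * E)%type >-> Y}).

Let section_fun (x : X) (e : E) : Y := Phi (x, e).

Let measurable_section_fun x : measurable_fun setT (section_fun x).
Proof. by apply: measurableT_comp => //; exact: measurable_pair2. Qed.

HB.instance Definition _ x :=
  isMeasurableFun.Build _ _ _ _ (section_fun x) (measurable_section_fun x).

Definition image_kernel (x : X) : {measure set Y -> \bar R} :=
  distribution nu (section_fun x).

Let measurable_image_kernel U : measurable U ->
  measurable_fun setT (image_kernel ^~ U).
Proof.
move=> mU; have mPU : measurable (Phi @^-1` U).
  by rewrite -[_ @^-1` _]setTI; exact: measurable_funP.
rewrite (_ : (fun x => _) = nu \o xsection (Phi @^-1` U)).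
  exact: measurable_fun_xsection.
by apply/funext => x /=; congr (nu _); apply/seteqP; split=> e /=;
  rewrite /xsection/= inE.
Qed.

HB.instance Definition _ :=
  isKernel.Build _ _ _ _ _ image_kernel measurable_image_kernel.

Let image_kernel_prob x : image_kernel x [set: Y] = 1%E.
Proof. exact: probability_setT. Qed.

HB.instance Definition _ :=
  Kernel_isProbability.Build _ _ _ _ _ image_kernel image_kernel_prob.

Lemma image_kernelE x B : image_kernel x B = nu [set e | B (Phi (x, e))].
Proof. by []. Qed.

End image_kernel.

Lemma ae_eq_preimage dO (Omega : measurableType dO) (R : realType)
    (P : probability Omega R) dY (Y : measurableType dY) (V V' : Omega -> Y) B :
  measurable_fun setT V -> measurable_fun setT V' -> measurable B ->
  {ae P, forall w, V w = V' w} -> P (V @^-1` B) = P (V' @^-1` B).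
Proof.
move=> mV mV' mB VV'.
have mp (Z : Omega -> Y) : measurable_fun setT Z -> measurable (Z @^-1` B).
  by move=> mZ; rewrite -[_ @^-1` _]setTI; exact: mZ.
rewrite -[V @^-1` B]setIT -[V' @^-1` B]setIT -!integral_indic//; try exact: mp.
apply: ae_eq_integral => //.
- by apply/measurable_EFinP; apply: measurable_indic; exact: mp.
- by apply/measurable_EFinP; apply: measurable_indic; exact: mp.
by apply: filterS VV' => w e _; rewrite !indicE /preimage /in_mem/= /in_set/= e.
Qed.

(** * Identification of the applied increment on the probability space *)

Section applied_noise.
Variables (R : realType) (lam q : nat -> R).
Hypothesis lam_gt0 : forall j, 0 < lam j.+1.
Variables (dO : measure_display) (Omega : measurableType dO).
Variable P : probability Omega R.

Let mode_weight j : R := if j is i.+1 then (lam i.+1)^-1 else 1.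

Let mode_weight_gt0 j : 0 < mode_weight j.
Proof. by case: j => [|j]//=; rewrite invr_gt0. Qed.

Lemma coord_le_sqnorm (c : nat -> R) j :
  ((mode_weight j * c j ^+ 2)%:E <= sqnorm lam (-1) c)%E.
Proof.
have t0 i : (0 <= ((lam i.+1)^-1 * c i.+1 ^+ 2)%:E)%E.
  by rewrite lee_fin mulr_ge0 ?sqr_ge0 ?invr_ge0 ?ltW.
rewrite /sqnorm sqnorm_dotE//; case: j => [|j] /=.
  by rewrite mul1r leeDr// nneseries_ge0.
apply: le_trans (leeDl _ _); last by rewrite lee_fin sqr_ge0.
apply: le_trans (nneseries_lim_ge j.+1 _); last by move=> *.
by rewrite big_nat_recr//= leeDr// sume_ge0.
Qed.

(** In each mode the mean squared distance of [xi] and [xi'] is at most twice the sum of those to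
    the common approximations, which tend to 0. *)
Lemma applied_increment_unique T (dW : Omega -> nat -> R) xi xi' :
  (forall n j, measurable_fun setT (fun w => T (truncate n (dW w)) j)) ->
  applied_increment P lam T dW xi -> applied_increment P lam T dW xi' ->
  {ae P, forall w j, xi w j = xi' w j}.
Proof.
move=> mT [mxi cxi] [mxi' cxi']; apply: ae_foralln => j.
pose D w := mode_weight j * (xi w j - xi' w j) ^+ 2.
have D0 w : 0 <= D w by rewrite mulr_ge0 ?sqr_ge0// ltW.
have mD : measurable_fun setT (fun w => (D w)%:E).
  apply/measurable_EFinP; apply: measurable_funM => //.
  by apply: measurable_funX; exact: measurable_funB.
pose A (X : Omega -> nat -> R) n w :=
  sqnorm lam (-1) (seqB (X w) (T (truncate n (dW w)))).
have mA X n : (forall j, measurable_fun setT (fun w => X w j)) ->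
    measurable_fun setT (A X n).
  by move=> mX; apply: measurable_sqnorm => // i; exact: measurable_funB.
have A0 X n w : (0 <= A X n w)%E by exact: sqnorm_ge0.
have bound n : (\int[P]_w (D w)%:E <=
    2%:E * (\int[P]_w A xi n w + \int[P]_w A xi' n w))%E.
  have mAA := emeasurable_funD (mA _ n mxi) (mA _ n mxi').
  rewrite -ge0_integralD//; [|exact: mA|exact: mA].
  rewrite -ge0_integralZl_EFin//; last by move=> w _; rewrite adde_ge0.
  apply: ge0_le_integral => //.
  - by move=> w _; rewrite lee_fin.
  - exact: emeasurable_funM.
  - move=> w _; apply: (@le_trans _ _ (2%:E * (
      (mode_weight j * (seqB (xi w) (T (truncate n (dW w)))) j ^+ 2)%:E +
      (mode_weight j * (seqB (xi' w) (T (truncate n (dW w)))) j ^+ 2)%:E))%E).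
      rewrite -EFinD -EFinM lee_fin /D /seqB -mulrDr [leRHS]mulrCA.
      apply: ler_wpM2l; first exact: ltW.
      move: (xi w j) (xi' w j) (T _ _) => x y z.
      by rewrite -subr_ge0 (_ : _ - _ = (x + y - 2 * z) ^+ 2) ?sqr_ge0//; ring.
    by apply: lee_wpmul2l => //; apply: leeD; exact: coord_le_sqnorm.
have lim0 : (2%:E * (\int[P]_w A xi n w + \int[P]_w A xi' n w))%E @[n --> \oo]
    --> 0%E.
  rewrite -[X in _ --> X](mule0 2%:E); apply: cvgeZl => //.
  by rewrite -[X in _ --> X](adde0 0%E); apply: cvgeD.
have int0 : (\int[P]_w `|(D w)%:E| = 0)%E.
  under eq_integral do rewrite gee0_abs ?lee_fin//.
  apply/eqP; rewrite eq_le integral_ge0 ?andbT => [|w _]; last by rewrite lee_fin.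
  rewrite -(cvg_lim (@ereal_hausdorff R) lim0); apply: lime_ge.
    by apply/cvg_ex; exists 0%E.
  by apply: nearW => n; exact: bound.
have [/(_ int0) + _] := ae_eq_integral_abs P measurableT mD.
apply: filterS => w /(_ I) [] /eqP.
rewrite mulf_eq0 gt_eqF//= sqrf_eq0 subr_eq0 => /eqP; exact.
Qed.

Variables (F : R -> set (set Omega)) (beta : nat -> R -> Omega -> R).
Hypothesis filtF : filtration F.
Hypothesis hbeta : brownian_family P F beta.
Variable tau : R.
Hypothesis tau0 : 0 < tau.

Lemma incrementE m w : increment q beta tau m w =
  (fun k => if k == 0%N then 0 else Num.sqrt (q k) * increments beta tau m w k.-1).
Proof.
apply/funext => -[|k]; rewrite /increment /seqB /wiener /=; first by rewrite subr0.
by rewrite -mulrBr.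
Qed.

Lemma truncate_increment T n m w : hilbert_schmidt lam q (-1) T ->
  T (truncate n (increment q beta tau m w)) =
  partial_noise q T n (increments beta tau m w).
Proof. by move=> HT; rewrite incrementE (HS_truncate HT). Qed.

HB.instance Definition _ m := isMeasurableFun.Build _ _ _ _ (increments beta tau m)
  (measurable_increments filtF hbeta m tau0).

Definition noise_law : probability (noise R) R :=
  distribution P (increments beta tau 0).

Lemma iid_noise_law : iid (normal_prob 0 (Num.sqrt tau)) noise_law.
Proof. exact: (iid_increments hbeta (m := 0) tau0). Qed.

(** The increments of every step are [iid] for the same Gaussian law; this lets a single kernel
    serve every [m]. *)
Lemma noise_lawE m B : measurable B ->
  noise_law B = P (increments beta tau m @^-1` B).
Proof.
move=> mB.
have im : iid (normal_prob 0 (Num.sqrt tau)) (distribution P (increments beta tau m)).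
  exact: (iid_increments hbeta (m := m) tau0).
exact: (iid_unique iid_noise_law im mB).
Qed.

Lemma integral_increments m (f : noise R -> \bar R) : measurable_fun setT f ->
  (forall e, (0 <= f e)%E) ->
  (\int[P]_w f (increments beta tau m w) = \int[noise_law]_e f e)%E.
Proof.
move=> mf f0.
rewrite (eq_measure_integral (distribution P (increments beta tau m))).
  by rewrite ge0_integral_distribution.
by move=> A mA _; exact: noise_lawE.
Qed.

Lemma noise_law_second_moment n b (c : nat -> R) :
  (\int[noise_law]_e ((b + \sum_(k < n) c k * e k) ^+ 2)%:E
   <= (b ^+ 2 + 6 * tau * \sum_(k < n) c k ^+ 2)%:E)%E.
Proof.
have st0 : 0 < Num.sqrt tau by rewrite sqrtr_gt0.
apply: (iid_second_moment iid_noise_law).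
  by move=> A mA; apply: normal_prob0N => //; rewrite gt_eqF.
by have := normal_second_moment st0; rewrite sqr_sqrtr// ltW.
Qed.

Lemma applied_increment_noise m T : hilbert_schmidt lam q (-1) T ->
  applied_increment P lam T (increment q beta tau m)
    (fun w => noise_term q T (increments beta tau m w)).
Proof.
move=> HT; split=> [j|].
  exact: (measurableT_comp (measurable_noise_term q T j)
    (measurable_increments filtF hbeta m tau0)).
have s0 : 0 <= 6 * tau by rewrite mulr_ge0// ltW.
have := noise_term_cvg lam_gt0 s0 noise_law_second_moment HT.
apply: cvg_trans; apply: near_eq_cvg; apply: nearW => n.
under [RHS]eq_integral do rewrite truncate_increment//.
rewrite (integral_increments m
  (f := fun e => sqnorm lam (-1) (seqB (noise_term q T e) (partial_noise q T n e))))//.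
- apply: measurable_sqnorm => // j; apply: measurable_funB.
    exact: measurable_noise_term.
  exact: measurable_partial_noise.
- by move=> e; exact: sqnorm_ge0.
Qed.

End applied_noise.

(** * The chain, its kernel and its invariant law *)

Section numerical_chain.
Variables (R : realType) (d : nat).
Variables (phi : nat -> d.-tuple (measurableTypeR R) -> R) (lam q : nat -> R).
Hypothesis hphi : neumann_eigenbasis phi lam.
Variables (dO : measure_display) (Omega : measurableType dO).
Variable P : probability Omega R.
Variables (F : R -> set (set Omega)) (beta : nat -> R -> Omega -> R).
Hypothesis hW : Q_wiener P lam F q beta.
Variable G : (nat -> R) -> (nat -> R) -> nat -> R.
Hypothesis hG0 : forall u, inH lam (-1) u -> hilbert_schmidt lam q (-1) (G u).
Variables (L C : R).
Hypothesis L0 : 0 < L.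
Hypothesis G_lip : forall u v, inH lam (-1) u -> inH lam (-1) v ->
  (sqnorm_HS lam q (-1) (opB (G u) (G v)) <= L%:E * sqnorm lam (-1) (seqB u v))%E.
Hypothesis hC : sobolev_constant phi lam C.
Hypothesis L_lt : 5 * L < lam 1%N * (lam 1%N - 1).
Variables (alpha : R) (N : nat) (tau : R).
Hypothesis tau0 : 0 < tau.

Let lam0 : lam 0%N = 0 := basis_lam0 hphi.

Let lam_le j : lam 1%N <= lam j.+1. Proof. exact: basis_lam_le hphi _ _ _. Qed.

Let lam1_gt1 : 1 < lam 1%N.
Proof.
have : 0 < lam 1%N * (lam 1%N - 1) by apply: lt_trans L_lt; rewrite mulr_gt0.
by rewrite (pmulr_rgt0 _ (basis_lam1 hphi)) subr_gt0.
Qed.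

Let lam_gt0 j : 0 < lam j.+1.
Proof. by apply: lt_le_trans (lam_le j); exact: basis_lam1 hphi. Qed.

Let phi4 (k : 'I_N.+1) : integrable4 (cube_measure R d) (phi k).
Proof. exact: (integrable4_eigenfunction hphi hC). Qed.

Let filtF : filtration F := QW_filtration hW.
Let hbeta : brownian_family P F beta := QW_brownian hW.

Local Notation nu := (noise_law filtF hbeta tau0).

Definition chain_step : HN R N * noise R -> HN R N :=
  step phi4 q lam0 lam_le lam1_gt1 tau0 G.

Lemma measurable_chain_step : measurable_fun setT chain_step.
Proof. exact: measurable_step G_lip. Qed.

HB.instance Definition _ :=
  isMeasurableFun.Build _ _ _ _ chain_step measurable_chain_step.

(** Existence for the implicit equation gives one direction and uniqueness the other; the latter
    identifies any version of the scheme with [chain_step]. *)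
Lemma chain_step_scheme u e (V : HN R N) : V = chain_step (u, e) <->
  forall j : 'I_N.+1, tnth V j - tnth u j =
    - tau * lam j ^+ 2 * tnth V j
    - tau * lam j * fourier phi (nonlin (fun_of phi V)) j
    + noise_term q (G (seq_of u)) e j.
Proof.
have residE (W : HN R N) (j : 'I_N.+1) :
    resid (cube_measure R d) (fun k : 'I_N.+1 => phi k) (fun j : 'I_N.+1 => lam j)
      tau (row_of_tuple W) j =
    tnth W j + tau * lam j ^+ 2 * tnth W j +
      tau * lam j * fourier phi (nonlin (fun_of phi W)) j.
  by rewrite (fourier_nonlin hphi hC) /resid !mxE.
split=> [-> j|eqV].
  have := resid_step phi4 q lam0 lam_le lam1_gt1 tau0 G u e j.
  rewrite -/chain_step residE => h; apply/eqP; rewrite subr_eq.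
  apply/eqP; rewrite -[LHS](addrK (tau * lam j ^+ 2 * tnth (chain_step (u, e)) j +
    tau * lam j * fourier phi (nonlin (fun_of phi (chain_step (u, e)))) j)).
  by rewrite addrA h !mulNr; ring.
apply: solve_unique => j; rewrite residE tnth_mktuple.
have /eqP := eqV j; rewrite subr_eq => /eqP h; rewrite {1}h !mulNr; ring.
Qed.

Definition chain_kernel : R.-pker (HN R N) ~> (HN R N) :=
  image_kernel nu chain_step.

Let mincr m : measurable_fun setT (increments beta tau m).
Proof. exact: (measurable_increments filtF hbeta m tau0). Qed.

Let measurable_chain_next m u :
  measurable_fun setT (fun w => chain_step (u, increments beta tau m w)).
Proof.
apply: (measurableT_comp measurable_chain_step).
exact: (measurable_fun_pair (measurable_cst u) (mincr m)).
Qed.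

Lemma transition_chain_kernel :
  transition_kernel P phi lam q beta G tau chain_kernel.
Proof.
move=> m u; exists (fun w => chain_step (u, increments beta tau m w)); last first.
  move=> B mB; rewrite image_kernelE (noise_lawE filtF hbeta tau0 m)//.
  have mu : measurable_fun setT (fun e => chain_step (u, e)).
    apply: (measurableT_comp measurable_chain_step).
    exact: (measurable_fun_pair (measurable_cst u) (@measurable_id _ (noise R) setT)).
  by rewrite -[X in measurable X]setTI; exact: mu.
split; first exact: measurable_chain_next.
exists (fun w => noise_term q (G (seq_of u)) (increments beta tau m w)).
  apply: (applied_increment_noise lam_gt0 filtF hbeta tau0).
  by apply: (hG0); exact: inH_seq_of.
by apply: aeW => w; apply/chain_step_scheme.
Qed.

(** Any admissible [xi] agrees almost surely with the canonical one, as a mean square limit; unique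
    solvability then fixes [V]. The step [m = 0] already determines the kernel. *)
Lemma transition_kernel_unique (K : R.-pker (HN R N) ~> (HN R N)) u B :
  transition_kernel P phi lam q beta G tau K -> measurable B ->
  K u B = nu [set e | B (chain_step (u, e))].
Proof.
move=> hK mB; have [V [mV [xi hxi hV]] ->] := hK 0%N u; last by [].
have HT : hilbert_schmidt lam q (-1) (G (seq_of u)).
  by apply: (hG0); exact: inH_seq_of.
have := applied_increment_noise lam_gt0 filtF hbeta tau0 0 HT.
have mT n j : measurable_fun setT
    (fun w => G (seq_of u) (truncate n (increment q beta tau 0 w)) j).
  under eq_fun do rewrite (truncate_increment beta tau n 0 _ HT).
  exact: (measurableT_comp (measurable_partial_noise q (G (seq_of u)) n j) (mincr 0)).
move=> /(applied_increment_unique lam_gt0 mT hxi) xiE.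
apply: (ae_eq_preimage mV (measurable_chain_next 0 u) mB).
apply: filterS2 xiE hV => w xiw Vw; apply/chain_step_scheme => j.
by rewrite Vw xiw.
Qed.

Lemma invariant_probabilityP (mu : probability (HN R N) R) :
  invariant_probability P phi lam q beta G tau alpha mu <->
  mu (HN_mean alpha) = 1%E /\ stationary nu chain_step mu.
Proof.
split=> -[mu1].
  move=> [K hK hmu]; split=> // B mB; rewrite -hmu//.
  by apply: eq_integral => u _; rewrite (transition_kernel_unique u hK).
move=> st; split=> //; exists chain_kernel; first exact: transition_chain_kernel.
by move=> B mB; exact: st.
Qed.

Lemma invariant_probability_exists_unique :
  exists2 mu : probability (HN R N) R,
    invariant_probability P phi lam q beta G tau alpha mu &
    forall mu' : probability (HN R N) R,
      invariant_probability P phi lam q beta G tau alpha mu' ->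
      forall B, measurable B -> mu' B = mu B.
Proof.
have s0 : 0 <= 6 * tau by rewrite mulr_ge0// ltW.
have iidnu := iid_noise_law filtF hbeta tau0.
have nu2 := noise_law_second_moment filtF hbeta tau0.
pose kappa := lam 1%N * (lam 1%N - 1).
have kappa0 : 0 < kappa by apply: lt_trans L_lt; rewrite mulr_gt0.
pose rho := (1 + 6 * tau * L) / (1 + 2 * tau * kappa).
have rho01 : 0 < rho < 1.
  have den0 : 0 < 1 + 2 * tau * kappa by rewrite addr_gt0// mulr_gt0// mulr_gt0.
  apply/andP; split; first by rewrite divr_gt0// addr_gt0// !mulr_gt0.
  rewrite ltr_pdivrMr// mul1r ltrD2l.
  (* The claim reduces to [3 * L < kappa], for which [5 * L < kappa] leaves room. *)
  have -> : 6 * tau * L = 2 * tau * (3 * L) by ring.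
  rewrite ltr_pM2l ?mulr_gt0//; apply: le_lt_trans L_lt.
  by rewrite ler_pM2r// ler_nat.
have w0 (j : 'I_N.+1) : 0 < weight (fun j : 'I_N.+1 => lam j) j.
  rewrite /weight; case: eqVneq => //; case: j => -[|j] jN //= _.
  by rewrite invr_gt0.
have mean u e := step_mean phi4 q lam0 lam_le lam1_gt1 tau0 G u e.
have contr u v (hu : tnth u ord0 = alpha) (hv : tnth v ord0 = alpha) :=
  step_contraction phi4 lam0 lam_le lam1_gt1 tau0 hG0 G_lip s0 nu2
    (etrans hu (esym hv)).
have mom := step_moment phi4 lam0 lam_le lam1_gt1 tau0 hG0 G_lip s0 nu2.
have [mu mu1 st] :=
  stationary_exists w0 iidnu measurable_chain_step mean rho01 contr mom.
exists mu; first exact/invariant_probabilityP.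
move=> mu' /invariant_probabilityP[mu'1 st'] B mB.
exact: (stationary_unique w0 iidnu measurable_chain_step mean rho01 contr mom
  st mu1 st' mu'1 mB).
Qed.

End numerical_chain.

Unset Implicit Arguments.
Set Strict Implicit.
Set Printing Implicit Defensive.

Theorem theorem4p3 (R : realType) (d : nat) (hd : (1 <= d <= 3)%N)
  (phi : nat -> d.-tuple (measurableTypeR R) -> R) (lam : nat -> R)
  (hphi : neumann_eigenbasis phi lam)
  (dO : measure_display) (Omega : measurableType dO) (P : probability Omega R)
  (F : R -> set (set Omega)) (q : nat -> R) (beta : nat -> R -> Omega -> R)
  (hW : Q_wiener P lam F q beta)
  (G : (nat -> R) -> (nat -> R) -> nat -> R)
  (hG0 : forall u, inH lam (-1) u -> hilbert_schmidt lam q (-1) (G u))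
  (L1 L2 L3 L4 L5 L6 L7 L8 C : R)
  (hG : cond_G phi lam q G L1 L2 L3 L4 L5 L6 L7 L8)
  (hC : sobolev_constant phi lam C)
  (hD : cond_D lam C L2 L3 L5 L7)
  (alpha : R) (N : nat) (tau : R) (htau : 0 < tau < 1) :
  exists2 mu : probability (HN R N) R,
    invariant_probability P phi lam q beta G tau alpha mu &
    forall mu' : probability (HN R N) R,
      invariant_probability P phi lam q beta G tau alpha mu' ->
      forall B, measurable B -> mu' B = mu B.
Proof.
have [[_ L2_gt0 _ _] _] := G_pos hG.
have L2_lt : 5 * L2 < lam 1%N * (lam 1%N - 1).
  by apply: le_lt_trans (D_contraction hD); rewrite le_max lexx.
have /andP[tau0 _] := htau.
exact: (invariant_probability_exists_unique hphi hW hG0 L2_gt0 (G_lipm1 hG) hC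
  L2_lt alpha N tau0).
Qed.
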